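(* Let $r>0$, $b>1$, $\beta>0$, $s\in[0,\tfrac12]$ and $p\ge 1$ be fixed, and let $\{g_\lambda\}_\lambda$ be a regularization function of qualification $q\ge r+s$. For $\sigma,R>0$ put $$\lambda_n:=\min\Big\{\Big(\frac{\sigma^2}{R^2n}\Big)^{\frac{b}{2br+b+1}},1\Big\},\qquad a_n:=R\Big(\frac{\sigma^2}{R^2n}\Big)^{\frac{b(r+s)}{2br+b+1}} .$$ If the number $m=m_n$ of subsample sets (with $m$ dividing $n$) satisfies $$m\le n^{\alpha},\qquad \alpha<\frac{2b\min\{r,1\}}{2br+b+1},$$ then $$\sup_{(\sigma,M,R)\in(0,\infty)^3}\ \limsup_{n\to\infty}\ \sup_{\rho\in\mathcal M_{\sigma,M,R}}\ \frac{\mathbb E_{\rho^{\otimes n}}\Big[\big\|\bar T^s(f_\rho-\tilde f_D^{\lambda_n})\big\|_{\mathcal H_K}^p\Big]^{1/p}}{a_n}<\infty .$$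
   Context: Setting: $\mathcal X$ is a standard Borel space; $K$ is a positive semidefinite kernel on $\mathcal X\times\mathcal X$, bounded in the sense $\sup_x K(x,x)\le\kappa^2$ with $\kappa>0$, with reproducing kernel Hilbert space $\mathcal H_K$ all of whose elements are measurable functions (so $\|f\|_\infty\le\kappa\|f\|_{\mathcal H_K}$). Write $K_x=K(x,\cdot)$ and $K_x\otimes K_x^*$ for the operator $f\mapsto\langle f,K_x\rangle_{\mathcal H_K}K_x$. For a probability measure $\nu$ on $\mathcal X$, $T=T_\nu=\mathbb E_{X\sim\nu}[K_X\otimes K_X^*]$ (Bochner integral; a positive self-adjoint trace class operator on $\mathcal H_K$) and $\bar T=\bar T_\nu=\kappa^{-2}T$. For $\mathbf x=(x_1,\dots,x_N)\in\mathcal X^N$, $\bar T_{\mathbf x}=\kappa^{-2}\frac1N\sum_{i=1}^N K_{x_i}\otimes K_{x_i}^*$. Functions of self-adjoint operators are defined by the spectral calculus. Models: $\mu_1\ge\mu_2\ge\dots$ are the positive eigenvalues of $\bar T_\nu$ (with multiplicity). $\mathcal P^<(b,\beta)$ is the set of probability measures $\nu$ on $\mathcal X$ with $\mu_j\le\beta j^{-b}$ for all $j\ge1$. $\Omega_\nu(r,R)=\{f\in\mathcal H_K: f=\bar T_\nu^r h,\ \|h\|_{\mathcal H_K}\le R\}$. $\mathcal M_{\sigma,M,R}$ is the set of probability distributions $\rho(dx,dy)=\rho(dy|x)\nu(dx)$ on $\mathcal X\times\mathbb R$ with $\nu\in\mathcal P^<(b,\beta)$ such that $\mathbb E_\rho[Y|X=x]=f_\rho(x)$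 for $\nu$-almost all $x$ for some $f_\rho\in\Omega_\nu(r,R)$, and $\mathbb E[|Y-f_\rho(X)|^2\,|\,X]\le\sigma^2$ $\nu$-a.s. (the index $M$ does not enter this definition). In the error expression $\bar T=\bar T_\nu$ with $\nu$ the $\mathcal X$-marginal of $\rho$. Regularization: a regularization function is a function $g:(0,1]\times[0,1]\to\mathbb R$, $g_\lambda=g(\lambda,\cdot)$, for which there are finite constants $D',E,\gamma_0$ such that for all $0<\lambda\le1$: $\sup_{0<t\le1}|tg_\lambda(t)|\le D'$, $\sup_{0<t\le1}|g_\lambda(t)|\le E/\lambda$, and $\sup_{0<t\le1}|r_\lambda(t)|\le\gamma_0$, where $r_\lambda(t)=1-g_\lambda(t)t$. Its qualification is the maximal $q$ such that, for some constant $\gamma_q>0$, $\sup_{0<t\le1}|r_\lambda(t)|t^q\le\gamma_q\lambda^q$ for all $0<\lambda\le1$ (it may be infinite). Data: $D=\{(x_i,y_i)\}_{i=1}^n$ is i.i.d. from $\rho$ (so $D\sim\rho^{\otimes n}$); $n$ is always a multiple of $m$, and $D$ is partitioned into $m$ disjoint subsets $D_1,\dots,D_m$ of size $n/m$, $D_j$ having data vector $(\mathbf x_j,\mathbf y_j)\in(\mathcal X\times\mathbb R)^{n/m}$. Put $\tilde f_D^\lambda=\frac1m\sum_{j=1}^m g_\lambda(\bar T_{\mathbf x_j})\bar T_{\mathbf x_j}f_\rho$. *)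

(* Defs.v *)
From HB Require Import structures.
From mathcomp Require Import all_boot all_order all_algebra.
From mathcomp Require Import all_classical all_reals all_analysis.

Set Implicit Arguments.
Unset Strict Implicit.
Unset Printing Implicit Defensive.

Import Order.TTheory GRing.Theory Num.Theory.
Import numFieldNormedType.Exports.

Local Open Scope classical_set_scope.
Local Open Scope ring_scope.

(* Up to a bijection, the points of [X] are those of a Polish space (a
   separable, complete, Hausdorff pseudometric space) and the measurable sets
   of [X] are its Borel sets. *)
Definition standard_borel (R : realType) d (X : measurableType d) : Prop :=
  exists (P : completePseudoMetricType R) (phi : X -> P),
    [/\ bijective phi, hausdorff_space P,
        (exists2 Q : set P, countable Q & dense Q) &
        @measurable d X = <<s [set phi @^-1` U | U in @open P] >>].

Section product_law.
Context d (T : measurableType d) (R : realType).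

Definition tuple_cons n (z : T * n.-tuple T) : n.+1.-tuple T :=
  [tuple of z.1 :: z.2].

Lemma measurable_tuple_cons n : measurable_fun setT (@tuple_cons n).
Proof. exact: measurable_cons. Qed.

HB.instance Definition _ n :=
  isMeasurableFun.Build _ _ _ _ (@tuple_cons n) (@measurable_tuple_cons n).

(* The law of [n] independent draws from [rho]. *)
Fixpoint iid_law (rho : probability T R) n : probability (n.-tuple T) R :=
  if n is n'.+1 then distribution (rho \x iid_law rho n')%E (@tuple_cons n')
  else dirac [tuple].

End product_law.

Section rkhs.
Context (R : realType) d (X : measurableType d).

Definition psd_kernel (K : X -> X -> R) : Prop :=
  (forall x y, K x y = K y x) /\
  (forall n (x : 'I_n -> X) (c : 'I_n -> R),
    0 <= \sum_(i < n) \sum_(j < n) c i * c j * K (x i) (x j)).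

(* [H] is a Hilbert space of functions on [X] (the element [f] being the
   function [ev f]) with reproducing kernel [K]; [feat x] is [K_x]. *)
Record rkhs (K : X -> X -> R) (H : completeNormedModType R) := Rkhs {
  ip : H -> H -> R;
  ev : H -> X -> R;
  feat : X -> H;
  ip_linear : forall v, linear_for *%R (ip ^~ v);
  ip_sym : forall u v, ip u v = ip v u;
  ip_norm : forall u, ip u u = `|u| ^+ 2;
  ev_linear : forall x, linear_for *%R (ev ^~ x);
  ev_inj : injective ev;
  ev_feat : forall x, ev (feat x) = K x;
  ev_ip : forall f x, ev f x = ip f (feat x) }.

End rkhs.

Section operators.
Context (R : realType) (H : completeNormedModType R).

Definition bounded_op (A : H -> H) : Prop := linear A /\ continuous A.

Definition opnorm (A : H -> H) : \bar R :=
  ereal_sup [set (`|A v|)%:E | v in [set v | `|v| <= 1]].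

Definition opdist (A B : H -> H) : \bar R := opnorm (fun v => A v - B v).

(* Operator-valued simple functions [x |-> \sum_i 1_(A_i)(x) c_i]. *)
Record simple_op d (X : measurableType d) := SimpleOp {
  so_size : nat;
  so_set : 'I_so_size -> set X;
  so_val : 'I_so_size -> H -> H;
  so_measurable : forall i, measurable (so_set i);
  so_bounded : forall i, bounded_op (so_val i) }.

Definition so_eval d (X : measurableType d) (S : simple_op X) (x : X) : H -> H :=
  fun v => \sum_i \1_(so_set (s := S) i) x *: so_val (s := S) i v.

Definition so_integral d (X : measurableType d)
    (nu : probability X R) (S : simple_op X) : H -> H :=
  fun v => \sum_i fine (nu (so_set (s := S) i)) *: so_val (s := S) i v.

(* Bochner integral in the Banach space of bounded operators. *)
Definition is_bochner_integral d (X : measurableType d)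
    (nu : probability X R) (F : X -> H -> H) (I : H -> H) : Prop :=
  bounded_op I /\
  exists S : nat -> simple_op X,
    [/\ {ae nu, forall x, opdist (F x) (so_eval (S k) x) @[k --> \oo] --> 0%E},
        (\int[nu]_x opdist (F x) (so_eval (S k) x))%E @[k --> \oo] --> 0%E &
        opdist I (so_integral nu (S k)) @[k --> \oo] --> 0%E].

(* Equal to [0] when the Bochner integral does not exist. *)
Definition bochner_integral d (X : measurableType d)
    (nu : probability X R) (F : X -> H -> H) : H -> H :=
  xget (fun=> 0) [set I | is_bochner_integral nu F I].

Variable ip : H -> H -> R.

(* [T] is the positive operator \sum_j mu_j <., e_j> e_j, where the mu_j are
   its positive eigenvalues, counted with multiplicity, in nonincreasing order,
   and the e_j are orthonormal eigenvectors. If there are finitely many positive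
   eigenvalues, both sequences are continued by 0. Index 0 is the first one. *)
Definition spectral_decomposition (T : H -> H) (mu : nat -> R) (e : nat -> H) :
    Prop :=
  [/\ forall j, 0 <= mu j.+1 <= mu j,
      forall i j, ip (e i) (e j) = ((i == j) && (mu i != 0))%:R &
      forall v, series (fun j => (mu j * ip v (e j)) *: e j) @ \oo --> T v].

Definition spectral_pair (T : H -> H) : (nat -> R) * (nat -> H) :=
  xget (fun=> 0, fun=> 0)
    [set me | spectral_decomposition T me.1 me.2].

Definition eigenvalues (T : H -> H) : nat -> R := (spectral_pair T).1.

(* Spectral calculus: [phi(T) = phi(0) P_0 + \sum_j phi(mu_j) <., e_j> e_j],
   with [P_0] the orthogonal projection onto the kernel of [T]. *)
Definition spectral_calculus (phi : R -> R) (T : H -> H) : H -> H :=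
  let mu := (spectral_pair T).1 in
  let e := (spectral_pair T).2 in
  fun v =>
    phi 0 *: (v - lim (series (fun j => ip v (e j) *: e j) @ \oo)) +
    lim (series (fun j => (phi (mu j) * ip v (e j)) *: e j) @ \oo).

(* [T^t]; [powR] satisfies [0 `^ 0 = 1], so [T^0] is the identity. *)
Definition op_power (T : H -> H) (t : R) : H -> H :=
  spectral_calculus (fun u => u `^ t) T.

End operators.

Section regularization.
Context (R : realType).
Implicit Type g : R -> R -> R.

Definition residual g (lam t : R) : R := 1 - g lam t * t.

(* Only the values of [g] on ]0, 1] x [0, 1] matter. *)
Definition regularization_function g : Prop :=
  exists D' E gamma0 : R, forall lam, 0 < lam <= 1 -> forall t, 0 < t <= 1 ->
    [/\ `|t * g lam t| <= D', `|g lam t| <= E / lam &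
        `|residual g lam t| <= gamma0].

Definition qualifies g (q : R) : Prop :=
  exists2 gamma_q : R, 0 < gamma_q &
    forall lam, 0 < lam <= 1 -> forall t, 0 < t <= 1 ->
      `|residual g lam t| * t `^ q <= gamma_q * lam `^ q.

Definition is_qualification g (q : \bar R) : Prop :=
  match q with
  | q0%:E => [/\ 0 <= q0, qualifies g q0 &
                 forall q', qualifies g q' -> q' <= q0]
  | +oo%E => forall q', 0 <= q' -> qualifies g q'
  | -oo%E => False
  end.

End regularization.

Section learning.
Context (R : realType) d (X : measurableType d) (K : X -> X -> R)
  (H : completeNormedModType R) (HK : rkhs K H) (kappa : R).

Local Notation Z := (X * measurableTypeR R)%type.

Definition feat_op (x : X) : H -> H := fun f => ip HK f (feat HK x) *: feat HK x.

(* [T_nu] and [kappa^-2 T_nu]. *)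
Definition cov_op (nu : probability X R) : H -> H := bochner_integral nu feat_op.

Definition ncov_op (nu : probability X R) : H -> H :=
  fun f => (kappa ^+ 2)^-1 *: cov_op nu f.

(* Normalized empirical covariance of the inputs with index in [B]. *)
Definition emp_op n (D : n.-tuple Z) (B : {set 'I_n}) : H -> H :=
  fun f => (kappa ^+ 2)^-1 *:
    ((#|B|%:R)^-1 *: \sum_(i in B) feat_op (tnth D i).1 f).

(* P^<(b, beta); the shift is due to eigenvalues being indexed from 0. *)
Definition eigen_decay (b beta : R) : set (probability X R) :=
  [set nu | forall j : nat,
     eigenvalues (ip HK) (ncov_op nu) j <= beta * j.+1%:R `^ (- b)].

(* Omega_nu(r, Rad) *)
Definition source_set (nu : probability X R) (r Rad : R) : set H :=
  [set f | exists2 h : H, f = op_power (ip HK) (ncov_op nu) r h & `|h| <= Rad].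

Definition input (z : Z) : X := z.1.

HB.instance Definition _ :=
  isMeasurableFun.Build _ _ _ _ input (measurable_fst : measurable_fun setT input).

Definition marginal (rho : probability Z R) : probability X R :=
  distribution rho input.

(* [k x] is the conditional law [rho(dy | x)]. *)
Definition disintegration (rho : probability Z R)
    (k : R.-pker X ~> measurableTypeR R) : Prop :=
  forall (A : set X) (B : set (measurableTypeR R)),
    measurable A -> measurable B ->
    rho (A `*` B) = (\int[marginal rho]_(x in A) k x B)%E.

(* The pairs [(rho, f_rho)] with [rho] in the class M_(sigma, M, Rad). Finiteness
   of the integral of [y] includes integrability of [y]. *)
Definition model (b beta r sigma M Rad : R) : set (probability Z R * H) :=
  [set rf | let rho := rf.1 in let f := rf.2 in let nu := marginal rho in
    [/\ eigen_decay b beta nu,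
        source_set nu r Rad f &
        exists k : R.-pker X ~> measurableTypeR R,
          [/\ disintegration rho k,
              {ae nu, forall x,
                (\int[k x]_y (y : R)%:E = (ev HK f x)%:E)%E} &
              {ae nu, forall x,
                (\int[k x]_y ((`|(y : R) - ev HK f x| ^+ 2)%R%:E)
                   <= (sigma ^+ 2)%:E)%E}]]].

(* A partition of the sample into [m] subsamples is given by the map [c] sending
   each index to the number of its subsample. *)
Definition block n m (c : 'I_n -> 'I_m) (j : 'I_m) : {set 'I_n} :=
  [set i | c i == j]%SET.

(* (1/m) \sum_j g_lam(T_xj) T_xj f, with T_xj the operator of block j. *)
Definition avg_approx (g : R -> R -> R) (lam : R) n m (c : 'I_n -> 'I_m)
    (D : n.-tuple Z) (f : H) : H :=
  (m%:R)^-1 *: \sum_(j < m)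
    let T := emp_op D (block c j) in
    spectral_calculus (ip HK) (g lam) T (T f).

(* p-th root of the p-th moment of [||Tbar^s (f - f~_D)||] for D ~ rho^n. *)
Definition approx_error (g : R -> R -> R) (s p lam : R) n m (c : 'I_n -> 'I_m)
    (rho : probability Z R) (f : H) : \bar R :=
  ((\int[iid_law rho n]_D
      ((`|op_power (ip HK) (ncov_op (marginal rho)) s
            (f - avg_approx g lam c D f)| `^ p)%R%:E)) `^ p^-1)%E.

End learning.

Section rates.
Context (R : realType).

Definition lambda_rate (b r sigma Rad : R) (n : nat) : R :=
  Num.min ((sigma ^+ 2 / (Rad ^+ 2 * n%:R)) `^ (b / (2 * b * r + b + 1))) 1.

Definition a_rate (b r s sigma Rad : R) (n : nat) : R :=
  Rad * (sigma ^+ 2 / (Rad ^+ 2 * n%:R)) `^ (b * (r + s) / (2 * b * r + b + 1)).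

End rates.

(* Main.v *)
Require Import Defs.
From HB Require Import structures.
From mathcomp Require Import all_boot all_order all_algebra.
From mathcomp Require Import all_classical all_reals all_analysis.
From mathcomp Require Import measurable_realfun.
From mathcomp Require Import ring lra.

(* Write T for the normalized covariance operator, f = T^r h, and
   r_lam(t) = 1 - g_lam(t) t. The error is the mean over the blocks j of
   T^s r_lam(T_xj) T^r h, which is never expanded into bias and variance: on the
   event [|(T - T_xj) w|^2 <= (lam^(2 max(r,1) - 1) / 4) <(T + lam) w, w>] it is
   at most C lam^(r + s) |h|. Indeed the event makes fractional powers of T and
   of T_xj + lam comparable up to exponent 1 (Heinz), which takes care of T^s and
   of the fractional part of T^r; the integer part of T^r is turned into powers
   of T_xj one factor at a time, each exchange costing the operator T - T_xj
   but freeing one power of r_lam's argument. Outside this event the error is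
   trivially bounded.

   The complement of the event is controlled by high moments: in the eigenbasis
   of T, (T - T_xj)(T + lam)^(-1/2) is a normalized sum of independent centred
   bounded Hilbert-Schmidt matrices, whose variance is governed by the effective
   dimension sum_j mu_j / (mu_j + lam) <= C lam^(-theta), theta slightly above
   1/b. The condition on alpha gives each block a probability of failure smaller
   than any given power of n, so that the union bound over the m blocks is
   harmless. *)

Set Implicit Arguments.
Unset Strict Implicit.
Unset Printing Implicit Defensive.

Import Order.TTheory GRing.Theory Num.Theory.
Import numFieldNormedType.Exports.

Local Open Scope classical_set_scope.
Local Open Scope ring_scope.

(** * Spectral calculus *)

(** The exponent [2 max(r, 1) - 1] is the price of the exchange. For [r >= 1], replacing one factor
    [T] by [T_xj] must itself gain [lam^(r - 1/2)]; for [r < 1] only the comparability of [T + lam]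
    and [T_xj + lam] is needed, and [lam] suffices. The event thus asks that [lam^(-theta) m / n] be
    small against [lam^(2 max(r, 1) - 1)]. With [lam] of order [n^(-b / (2br + b + 1))], [theta]
    close to [1/b] and [min(r, 1) + max(r, 1) = r + 1], this is the condition on [alpha]. Three
    obstacles shape the rest. The dimension is infinite, so moments are bounded for [J x J]
    truncations, uniformly in [J]. Coordinates see [T - T_xj] only on the closed range of [T], so
    the features must be shown to lie there almost surely, although [H] is not assumed separable.
    The error is not known to be measurable in the sample, so it is dominated by a measurable
    function before integration. *)

Record is_inner (R : realType) (H : completeNormedModType R)
    (ip : H -> H -> R) : Prop := IsInner {
  inner_linear : forall v, linear_for *%R (ip ^~ v);
  inner_sym : forall u v, ip u v = ip v u;
  inner_norm : forall u, ip u u = `|u| ^+ 2 }.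

Section inner_product.
Context (R : realType) (H : completeNormedModType R) (ip : H -> H -> R).
Hypothesis ipP : is_inner ip.
Implicit Types u v w : H.

Lemma ipDl u v w : ip (u + v) w = ip u w + ip v w.
Proof.
by have := inner_linear ipP w 1 u v; rewrite scale1r mul1r.
Qed.

Lemma ip0l w : ip 0 w = 0.
Proof.
by apply: (addIr (ip 0 w)); rewrite -ipDl !add0r.
Qed.

Lemma ipZl a u w : ip (a *: u) w = a * ip u w.
Proof.
by have := inner_linear ipP w a u 0; rewrite ip0l !addr0.
Qed.

Lemma ipNl u w : ip (- u) w = - ip u w.
Proof. by rewrite -scaleN1r ipZl mulN1r. Qed.

Lemma ipBl u v w : ip (u - v) w = ip u w - ip v w.
Proof. by rewrite ipDl ipNl. Qed.

Lemma ip0r w : ip w 0 = 0.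
Proof. by rewrite (inner_sym ipP) ip0l. Qed.

Lemma ipDr w u v : ip w (u + v) = ip w u + ip w v.
Proof. by rewrite (inner_sym ipP) ipDl !(inner_sym ipP w). Qed.

Lemma ipZr w a u : ip w (a *: u) = a * ip w u.
Proof. by rewrite (inner_sym ipP) ipZl (inner_sym ipP w). Qed.

Lemma ipNr w u : ip w (- u) = - ip w u.
Proof. by rewrite (inner_sym ipP) ipNl (inner_sym ipP w). Qed.

Lemma ipBr w u v : ip w (u - v) = ip w u - ip w v.
Proof. by rewrite ipDr ipNr. Qed.

Lemma ip_suml I (r : seq I) (P : pred I) (F : I -> H) w :
  ip (\sum_(i <- r | P i) F i) w = \sum_(i <- r | P i) ip (F i) w.
Proof.
by apply: (big_morph (ip ^~ w)) => [u v|]; rewrite ?ipDl ?ip0l.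
Qed.

Lemma ip_sumr I (r : seq I) (P : pred I) (F : I -> H) w :
  ip w (\sum_(i <- r | P i) F i) = \sum_(i <- r | P i) ip w (F i).
Proof.
by apply: (big_morph (ip w)) => [u v|]; rewrite ?ipDr ?ip0r.
Qed.

Lemma ip_ge0 u : 0 <= ip u u.
Proof. by rewrite (inner_norm ipP) sqr_ge0. Qed.

Lemma ip_eq0 u : ip u u = 0 -> u = 0.
Proof.
by rewrite (inner_norm ipP) => /eqP; rewrite expf_eq0 /= normr_eq0 => /eqP.
Qed.

Lemma normD_sqr u v :
  `|u + v| ^+ 2 = `|u| ^+ 2 + 2 * ip u v + `|v| ^+ 2.
Proof.
rewrite -!(inner_norm ipP) ipDl !ipDr (inner_sym ipP v u).
by ring.
Qed.

Lemma cauchy_schwarz u v : `|ip u v| <= `|u| * `|v|.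
Proof.
have [->|v0] := eqVneq v 0; first by rewrite ip0r !normr0 mulr0.
have nv : 0 < `|v| by rewrite normr_gt0.
have := ip_ge0 (`|v| ^+ 2 *: u - ip u v *: v).
rewrite ipBl !ipBr !ipZl !ipZr (inner_sym ipP v u) !(inner_norm ipP) => h.
have {}h : 0 <= `|v| ^+ 2 * ((`|u| * `|v|) ^+ 2 - ip u v ^+ 2) by nra.
have {}h : ip u v ^+ 2 <= (`|u| * `|v|) ^+ 2.
  by move: h; rewrite pmulr_rge0 ?subr_ge0// exprn_gt0.
by rewrite -(@ler_pXn2r _ 2) ?nnegrE ?mulr_ge0// -normrX ger0_norm ?sqr_ge0.
Qed.

Lemma ip_le u v : ip u v <= `|u| * `|v|.
Proof. exact: le_trans (ler_norm _) (cauchy_schwarz _ _). Qed.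

Lemma ipl_continuous w : continuous (ip ^~ w).
Proof.
move=> u; apply/cvgrPdist_le => e e0.
have w1 : 0 < `|w| + 1 by rewrite ltr_wpDl.
near=> v.
rewrite -ipBl (le_trans (cauchy_schwarz _ _))//.
have : `|u - v| <= e / (`|w| + 1).
  near: v; apply: cvgr_dist_le; [exact: cvg_id|exact: divr_gt0].
rewrite ler_pdivlMr// => h.
by apply: le_trans h; rewrite ler_wpM2l// lerDl.
Unshelve. all: by end_near. Qed.

Lemma cvg_ipl (f : nat -> H) l w :
  f @ \oo --> l -> (fun n => ip (f n) w) @ \oo --> ip l w.
Proof. exact: (continuous_cvg _ (@ipl_continuous w l)). Qed.

Lemma ip_ext u v : (forall w, ip u w = ip v w) -> u = v.
Proof.
move=> h; apply/eqP; rewrite -subr_eq0; apply/eqP/ip_eq0.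
by rewrite ipBl h subrr.
Qed.

(** The duality step of the exchange argument: with [u = B v], [ip u u] becomes [ip v (B' u)] for
    the adjoint [B'], so that a bound on [B'] bounds [u]. *)
Lemma norm_le_dual u (M : R) : 0 <= M -> ip u u <= M * `|u| -> `|u| <= M.
Proof.
have [->|u0] := eqVneq u 0; first by rewrite normr0.
by move=> _; rewrite (inner_norm ipP) expr2 ler_pM2r// normr_gt0.
Qed.

End inner_product.

Section spectral.
Context (R : realType) (H : completeNormedModType R) (ip : H -> H -> R).
Hypothesis ipP : is_inner ip.
Context (A : H -> H) (mu : nat -> R) (e : nat -> H).
Hypothesis sd : spectral_decomposition ip A mu e.
Hypothesis mu_le1 : forall j, mu j <= 1.
Implicit Types (u v w : H) (phi psi : R -> R).

Lemma sd_mu_ge0 j : 0 <= mu j.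
Proof.
case: sd => h _ _; case: j => [|j]; last by case/andP: (h j).
by case/andP: (h 0) => /le_trans; apply.
Qed.

Lemma sd_e0 j : mu j = 0 -> e j = 0.
Proof.
case: sd => _ h _ m0; apply: (ip_eq0 ipP).
by rewrite h m0 !eqxx.
Qed.

Lemma sd_ee i j : ip (e i) (e j) = ((i == j) && (mu i != 0))%:R.
Proof. by case: sd. Qed.

Lemma sd_ip_e0 j v : mu j = 0 -> ip v (e j) = 0.
Proof. by move=> /sd_e0 ->; rewrite (ip0r ipP). Qed.

Lemma ip_partial_sum (c : nat -> R) (s : seq nat) i : uniq s -> i \in s ->
  ip (\sum_(j <- s) c j *: e j) (e i) = c i * (mu i != 0)%:R.
Proof.
move=> us is_; rewrite (ip_suml ipP) (bigD1_seq i)//= (ipZl ipP) sd_ee eqxx /=.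
rewrite big1 ?addr0// => j ji; rewrite (ipZl ipP) sd_ee (negPf ji) /=.
by rewrite mulr0.
Qed.

Lemma norm_partial_sum (c : nat -> R) (s : seq nat) : uniq s ->
  `|\sum_(j <- s) c j *: e j| ^+ 2 = \sum_(j <- s) c j ^+ 2 * (mu j != 0)%:R.
Proof.
move=> us; rewrite -(inner_norm ipP) (ip_sumr ipP).
rewrite !big_seq; apply: eq_bigr => i is_.
by rewrite (ipZr ipP) -big_seq ip_partial_sum// mulrA.
Qed.

Lemma coord_mu v j : ip v (e j) * (mu j != 0)%:R = ip v (e j).
Proof.
by have [/sd_ip_e0 ->|_] := eqVneq (mu j) 0; rewrite ?mul0r// mulr1.
Qed.

Lemma bessel v (s : seq nat) : uniq s ->
  \sum_(j <- s) ip v (e j) ^+ 2 <= `|v| ^+ 2.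
Proof.
move=> us; set p := \sum_(j <- s) ip v (e j) *: e j.
have pp : ip p p = \sum_(j <- s) ip v (e j) ^+ 2.
  rewrite (inner_norm ipP) norm_partial_sum//; apply: eq_bigr => j _.
  by rewrite expr2 -mulrA coord_mu.
have vp : ip v p = ip p p.
  rewrite pp (ip_sumr ipP); apply: eq_bigr => j _.
  by rewrite (ipZr ipP) expr2.
have := ip_ge0 ipP (v - p).
rewrite (ipBl ipP) !(ipBr ipP) (inner_sym ipP p v) vp subrr subr0 subr_ge0 pp.
by rewrite (inner_norm ipP).
Qed.

Lemma is_cvg_coord_sqr v : cvgn (series (fun j => ip v (e j) ^+ 2)).
Proof.
apply: nondecreasing_is_cvgn.
  by apply: nondecreasing_series => j _ _; exact: sqr_ge0.
by exists (`|v| ^+ 2) => _ [n _ <-]; rewrite /= bessel// iota_uniq.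
Qed.

(** No continuity is asked for: the operators are diagonal, so the calculus evaluates [phi] only at
    the eigenvalues and at 0, and a bound suffices for convergence. *)
Definition bounded_on_spec phi := exists M : R, forall t : R, 0 <= t <= 1 -> `|phi t| <= M.

Lemma mu01 j : 0 <= mu j <= 1.
Proof. by rewrite sd_mu_ge0 mu_le1. Qed.

Lemma bounded_spec_ge0 phi : bounded_on_spec phi ->
  exists2 M : R, 0 <= M & forall t : R, 0 <= t <= 1 -> `|phi t| <= M.
Proof.
move=> [M h]; exists M => //; apply: le_trans (h 0 _) => //.
by rewrite lexx ler01.
Qed.

(** By orthonormality the squared norm of a block of the series is at most [M^2] times a block of
    the Bessel series; the Cauchy criterion and completeness conclude. *)
Lemma is_cvg_calc phi v : bounded_on_spec phi ->
  cvgn (series (fun j => (phi (mu j) * ip v (e j)) *: e j)).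
Proof.
move=> /bounded_spec_ge0[M M0 hM].
apply/cauchy_cvgP/cauchy_seriesP => eps eps0.
have M1 : 0 < M + 1 by rewrite ltr_wpDl.
have /cauchy_cvgP/cauchy_seriesP h := is_cvg_coord_sqr (v := v).
have {h} := h ((eps / (M + 1)) ^+ 2).
rewrite exprn_gt0 ?divr_gt0// => /(_ isT).
apply: filterS => n; rewrite ger0_norm; last first.
  by apply: sumr_ge0 => i _; exact: sqr_ge0.
move=> h; rewrite -(@ltr_pXn2r _ 2) ?nnegrE//; last exact: ltW.
rewrite norm_partial_sum ?iota_uniq//.
apply: (@le_lt_trans _ _ (M ^+ 2 * \sum_(n.1 <= k < n.2) ip v (e k) ^+ 2)).
  rewrite mulr_sumr; apply: ler_sum => j _.
  have -> : (phi (mu j) * ip v (e j)) ^+ 2 * (mu j != 0)%:R =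
      phi (mu j) ^+ 2 * ip v (e j) ^+ 2.
    by rewrite exprMn -mulrA; congr (_ * _); rewrite expr2 -mulrA coord_mu.
  rewrite ler_wpM2r// ?sqr_ge0// -ler_sqrt ?sqr_ge0//.
  by rewrite !sqrtr_sqr (ger0_norm M0) hM// mu01.
apply: (@le_lt_trans _ _ ((M + 1) ^+ 2 * \sum_(n.1 <= k < n.2) ip v (e k) ^+ 2)).
  rewrite ler_wpM2r ?sumr_ge0// => [i _|]; first exact: sqr_ge0.
  by rewrite ler_sqr ?nnegrE ?lerDl// ltW.
by move: h; rewrite exprMn exprVn ltr_pdivlMr ?exprn_gt0// mulrC.
Qed.

Definition calc phi v := limn (series (fun j => (phi (mu j) * ip v (e j)) *: e j)).

Lemma ip_calc phi v w : bounded_on_spec phi ->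
  series (fun j => phi (mu j) * ip v (e j) * ip w (e j)) @ \oo -->
  ip (calc phi v) w.
Proof.
move=> bphi; have := cvg_ipl ipP (w := w) (is_cvg_calc (v := v) bphi).
apply: cvg_trans; apply: near_eq_cvg; near=> n.
rewrite /series /= (ip_suml ipP); apply: eq_bigr => j _.
by rewrite (ipZl ipP) (inner_sym ipP w).
Unshelve. all: by end_near. Qed.

Lemma calc_coord phi v i : bounded_on_spec phi ->
  ip (calc phi v) (e i) = phi (mu i) * ip v (e i).
Proof.
move=> bphi; have h := cvg_ipl ipP (w := e i) (is_cvg_calc (v := v) bphi).
rewrite -(cvg_lim (@Rhausdorff R) h); apply: cvg_lim; first exact: Rhausdorff.
apply: cvg_near_cst; near=> n.
rewrite /series /= ip_partial_sum ?iota_uniq//.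
  by rewrite -mulrA coord_mu.
rewrite mem_index_iota /=; near: n; exact: nbhs_infty_gt.
Unshelve. all: by end_near. Qed.

Lemma bounded_spec1 : bounded_on_spec (fun=> 1).
Proof. by exists 1 => t _; rewrite normr1. Qed.

Lemma calc_linear phi a v w : bounded_on_spec phi ->
  calc phi (a *: v + w) = a *: calc phi v + calc phi w.
Proof.
move=> bphi; rewrite /calc; apply: cvg_lim; first exact: norm_hausdorff.
have h := cvgD (FF := eventually_filter) (cvgZr (FF := eventually_filter) (k := a) (is_cvg_calc (v := v) bphi)) (is_cvg_calc (v := w) bphi).
apply: cvg_trans h; apply: near_eq_cvg; near=> n.
rewrite fctE /= /series /= scaler_sumr -big_split /=; apply: eq_bigr => j _.
by rewrite (ipDl ipP) (ipZl ipP) scalerA -scalerDl mulrDr mulrCA.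
Unshelve. all: by end_near. Qed.

Lemma eq_calc phi psi v w :
  (forall j, phi (mu j) * ip v (e j) = psi (mu j) * ip w (e j)) ->
  calc phi v = calc psi w.
Proof.
move=> h; rewrite /calc; congr (limn (series _)); apply/funext => j.
by rewrite h.
Qed.

Definition kproj v := v - calc (fun=> 1) v.

Lemma kproj_coord v i : ip (kproj v) (e i) = 0.
Proof.
by rewrite /kproj (ipBl ipP) calc_coord ?mul1r ?subrr//; exact: bounded_spec1.
Qed.

Lemma ip_kproj_calc phi v w : bounded_on_spec phi ->
  ip (calc phi v) (kproj w) = 0.
Proof.
move=> bphi; apply: cvg_unique (ip_calc (v := v) (w := (kproj w)) bphi) _ => //.
rewrite (_ : series _ = cst 0); first exact: cvg_cst.
apply/funext => n; rewrite /series /= big1// => j _.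
by rewrite kproj_coord mulr0.
Qed.

(** [spectral_calculus] with the eigenpairs as parameters, so that it is available for any
    decomposition; [spectral_calculusE] ties it to [spectral_pair]. *)
Definition sc phi v := phi 0 *: kproj v + calc phi v.

Lemma sc_coord phi v i : bounded_on_spec phi ->
  ip (sc phi v) (e i) = phi (mu i) * ip v (e i).
Proof.
by move=> b; rewrite (ipDl ipP) (ipZl ipP) kproj_coord mulr0 add0r calc_coord.
Qed.

Lemma kproj_sc phi v : bounded_on_spec phi -> kproj (sc phi v) = phi 0 *: kproj v.
Proof.
move=> b; rewrite {1}/kproj (_ : calc _ _ = calc phi v) ?addrK//.
by apply: eq_calc => j; rewrite sc_coord// mul1r.
Qed.

Lemma bounded_specM phi psi : bounded_on_spec phi -> bounded_on_spec psi ->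
  bounded_on_spec (fun t => phi t * psi t).
Proof.
move=> [M hM] [N hN]; exists (M * N) => t t01; rewrite normrM.
by apply: ler_pM => //; [exact: hM|exact: hN].
Qed.

Lemma bounded_specD phi psi : bounded_on_spec phi -> bounded_on_spec psi ->
  bounded_on_spec (fun t => phi t + psi t).
Proof.
move=> [M hM] [N hN]; exists (M + N) => t t01; rewrite (le_trans (ler_normD _ _))//.
by apply: lerD; [exact: hM|exact: hN].
Qed.

Lemma bounded_specZ a phi : bounded_on_spec phi ->
  bounded_on_spec (fun t => a * phi t).
Proof.
move=> [M hM]; exists (`|a| * M) => t t01; rewrite normrM ler_wpM2l//; exact: hM.
Qed.

Lemma bounded_spec_id : bounded_on_spec id.
Proof. by exists 1 => t /andP[t0 t1]; rewrite ger0_norm. Qed.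

Lemma sc_comp phi psi v : bounded_on_spec phi -> bounded_on_spec psi ->
  sc phi (sc psi v) = sc (fun t => phi t * psi t) v.
Proof.
move=> bphi bpsi; rewrite {1}/sc kproj_sc// scalerA; congr (_ + _).
by apply: eq_calc => j; rewrite sc_coord// mulrA.
Qed.

Lemma kproj_linear a v w : kproj (a *: v + w) = a *: kproj v + kproj w.
Proof.
rewrite /kproj calc_linear; last exact: bounded_spec1.
by rewrite opprD addrACA scalerBr.
Qed.

Lemma sc_linear phi a v w : bounded_on_spec phi ->
  sc phi (a *: v + w) = a *: sc phi v + sc phi w.
Proof.
move=> b; rewrite /sc kproj_linear calc_linear//.
by rewrite scalerDr scalerA mulrC -scalerA addrACA -scalerDr.
Qed.

Lemma eq_sc phi psi v : (forall t : R, 0 <= t <= 1 -> phi t = psi t) ->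
  sc phi v = sc psi v.
Proof.
move=> h; rewrite /sc h ?lexx ?ler01//; congr (_ + _).
by apply: eq_calc => j; rewrite h// mu01.
Qed.

Lemma sc_sym phi v w : bounded_on_spec phi -> ip (sc phi v) w = ip v (sc phi w).
Proof.
move=> b.
have E x y : ip (sc phi x) y = phi 0 * ip (kproj x) (kproj y) + ip (calc phi x) y.
  rewrite (ipDl ipP) (ipZl ipP); congr (_ * _ + _).
  rewrite -{1}(subrK (calc (fun=> 1) y) y) (ipDr ipP) [X in _ + X](inner_sym ipP).
  by rewrite ip_kproj_calc ?addr0//; exact: bounded_spec1.
rewrite (inner_sym ipP v) !E (inner_sym ipP (kproj v)); congr (_ + _).
apply: cvg_unique (ip_calc (v := v) (w := w) b) _ => //.
apply: cvg_trans (ip_calc (v := w) (w := v) b); apply: near_eq_cvg; near=> n.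
by apply: eq_bigr => j _; rewrite mulrAC.
Unshelve. all: by end_near. Qed.

Definition qform phi v := ip (sc phi v) v.

Lemma qformE phi v : bounded_on_spec phi ->
  series (fun j => phi (mu j) * ip v (e j) ^+ 2) @ \oo -->
  qform phi v - phi 0 * `|kproj v| ^+ 2.
Proof.
move=> b.
have -> : qform phi v - phi 0 * `|kproj v| ^+ 2 = ip (calc phi v) v.
  rewrite /qform (ipDl ipP) (ipZl ipP) -(inner_norm ipP).
  rewrite -{2}(subrK (calc (fun=> 1) v) v) (ipDr ipP) -/(kproj v).
  rewrite [ip (kproj v) (calc _ v)](inner_sym ipP).
  rewrite ip_kproj_calc ?addr0; last exact: bounded_spec1.
  by rewrite addrAC subrr add0r.
apply: cvg_trans (ip_calc (v := v) (w := v) b); apply: near_eq_cvg; near=> n.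
by apply: eq_bigr => j _; rewrite expr2 mulrA.
Unshelve. all: by end_near. Qed.

(** The eigenvalue series and the kernel part in [qformE] are compared separately; the value at
    [t = 0] takes care of the kernel. *)
Lemma qform_le phi psi v : bounded_on_spec phi -> bounded_on_spec psi ->
  (forall t : R, 0 <= t <= 1 -> phi t <= psi t) -> qform phi v <= qform psi v.
Proof.
move=> b1 b2 h.
have h1 := qformE (v := v) b1; have h2 := qformE (v := v) b2.
have : qform phi v - phi 0 * `|kproj v| ^+ 2 <=
       qform psi v - psi 0 * `|kproj v| ^+ 2.
  apply: ler_cvg_to h1 h2 _; near=> n; apply: ler_sum => j _.
  by rewrite ler_wpM2r ?sqr_ge0// h// mu01.
have : phi 0 * `|kproj v| ^+ 2 <= psi 0 * `|kproj v| ^+ 2.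
  by rewrite ler_wpM2r ?sqr_ge0// h// lexx ler01.
lra.
Unshelve. all: by end_near. Qed.

Lemma norm_sc phi v : bounded_on_spec phi ->
  `|sc phi v| ^+ 2 = qform (fun t => phi t ^+ 2) v.
Proof.
move=> b; rewrite -(inner_norm ipP) -sc_sym// sc_comp//.
Qed.

Lemma sc1 v : sc (fun=> 1) v = v.
Proof. by rewrite /sc scale1r /kproj subrK. Qed.

Lemma qform1 v : qform (fun=> 1) v = `|v| ^+ 2.
Proof. by rewrite /qform sc1 (inner_norm ipP). Qed.

Lemma scDphi phi psi v : bounded_on_spec phi -> bounded_on_spec psi ->
  sc (fun t => phi t + psi t) v = sc phi v + sc psi v.
Proof.
move=> b1 b2; rewrite /sc scalerDl addrACA; congr (_ + _).
rewrite /calc; apply: cvg_lim; first exact: norm_hausdorff.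
have h := cvgD (FF := eventually_filter) (is_cvg_calc (v := v) b1) (is_cvg_calc (v := v) b2).
apply: cvg_trans h; apply: near_eq_cvg; near=> n.
rewrite fctE /series /= -big_split /=; apply: eq_bigr => j _.
by rewrite mulrDl scalerDl.
Unshelve. all: by end_near. Qed.

Lemma scZphi a phi v : bounded_on_spec phi ->
  sc (fun t => a * phi t) v = a *: sc phi v.
Proof.
move=> b1; rewrite /sc [RHS]scalerDr [in RHS]scalerA; congr (_ + _).
rewrite /calc; apply: cvg_lim; first exact: norm_hausdorff.
have h := cvgZr (FF := eventually_filter) (k := a) (is_cvg_calc (v := v) b1).
apply: cvg_trans h; apply: near_eq_cvg; near=> n.
rewrite /series /= scaler_sumr; apply: eq_bigr => j _.
by rewrite scalerA mulrA.
Unshelve. all: by end_near. Qed.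

Lemma sc_id v : sc id v = A v.
Proof.
rewrite /sc scale0r add0r; case: sd => _ _ /(_ v) h.
by apply: cvg_lim => //; exact: norm_hausdorff.
Qed.

Lemma bounded_spec_cst (a : R) : bounded_on_spec (fun=> a).
Proof. by exists `|a|. Qed.

Lemma qformD phi psi v : bounded_on_spec phi -> bounded_on_spec psi ->
  qform (fun t => phi t + psi t) v = qform phi v + qform psi v.
Proof. by move=> b1 b2; rewrite /qform scDphi// (ipDl ipP). Qed.

Lemma qformZ a phi v : bounded_on_spec phi ->
  qform (fun t => a * phi t) v = a * qform phi v.
Proof. by move=> b1; rewrite /qform scZphi// (ipZl ipP). Qed.

Lemma bounded_spec_sum (phi : nat -> R -> R) n :
  (forall k, bounded_on_spec (phi k)) ->
  bounded_on_spec (fun t => \sum_(k < n) phi k t).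
Proof.
move=> h; elim: n => [|n IH].
  by exists 0 => t _; rewrite big_ord0 normr0.
under eq_fun do rewrite big_ord_recr /=.
exact: bounded_specD.
Qed.

Lemma qform_sum (phi : nat -> R -> R) n v :
  (forall k, bounded_on_spec (phi k)) ->
  qform (fun t => \sum_(k < n) phi k t) v = \sum_(k < n) qform (phi k) v.
Proof.
move=> h; elim: n => [|n IH].
  rewrite big_ord0; under eq_fun do rewrite big_ord0.
  rewrite -[RHS](mul0r (qform (fun=> 1) v)) -qformZ; last exact: bounded_spec1.
  by under [in RHS]eq_fun do rewrite mul0r.
rewrite big_ord_recr /= -IH -qformD//; last exact: bounded_spec_sum.
by under eq_fun do rewrite big_ord_recr /=.
Qed.

(** This turns scalar inequalities on [[0, 1]] into norm estimates: squared norms are the quadratic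
    forms of [phi^2] and [psi^2], to which [qform_le] applies. *)
Lemma norm_sc_le phi psi v (M : R) : bounded_on_spec phi -> bounded_on_spec psi ->
  0 <= M -> (forall t : R, 0 <= t <= 1 -> `|phi t| <= M * `|psi t|) ->
  `|sc phi v| <= M * `|sc psi v|.
Proof.
move=> b1 b2 M0 h.
rewrite -(@ler_pXn2r _ 2) ?nnegrE ?mulr_ge0// exprMn !norm_sc//.
rewrite {2}/qform -(ipZl ipP) -scZphi; last exact: bounded_specM.
apply: qform_le.
- exact: bounded_specM.
- by apply: bounded_specZ; exact: bounded_specM.
move=> t /h th; rewrite -[phi t ^+ 2]ger0_norm ?sqr_ge0// normrX.
rewrite -[psi t ^+ 2]ger0_norm ?sqr_ge0// normrX -exprMn.
by rewrite ler_pXn2r// nnegrE mulr_ge0.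
Qed.

Lemma norm_sc_le_id phi v (M : R) : bounded_on_spec phi ->
  0 <= M -> (forall t : R, 0 <= t <= 1 -> `|phi t| <= M) ->
  `|sc phi v| <= M * `|v|.
Proof.
move=> b M0 h; rewrite -{2}(sc1 v); apply: norm_sc_le => //.
  exact: bounded_spec1.
by move=> t /h; rewrite normr1 mulr1.
Qed.

(** Since [e j = 0] whenever [mu j = 0], the indicator of 0 kills the whole eigenseries. Symmetry,
    idempotence and contractivity of [kproj] are then instances of the calculus. *)
Lemma kprojE v : kproj v = sc (fun t => (t == 0)%:R) v.
Proof.
rewrite /sc eqxx scale1r /calc (_ : series _ = cst 0) ?lim_cst ?addr0//.
apply/funext => n; rewrite /series /= big1// => j _.
by have [/sd_e0 ->|_] := eqVneq (mu j) 0; rewrite ?scaler0// mul0r scale0r.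
Qed.

Lemma bounded_spec_eq0 : bounded_on_spec (fun t : R => (t == 0)%:R).
Proof. by exists 1 => t _; case: (_ == _); rewrite ?normr1 ?normr0. Qed.

Lemma kproj_sym v w : ip (kproj v) w = ip v (kproj w).
Proof. by rewrite !kprojE sc_sym//; exact: bounded_spec_eq0. Qed.

Lemma kproj_idem v : kproj (kproj v) = kproj v.
Proof.
rewrite [in LHS]kprojE [X in sc _ X]kprojE sc_comp; [|exact: bounded_spec_eq0..].
rewrite kprojE; congr sc; apply/funext => t.
by case: (_ == _); rewrite ?mulr1 ?mulr0.
Qed.

Lemma norm_kproj_le v : `|kproj v| <= `|v|.
Proof.
rewrite kprojE -[leRHS]mul1r; apply: norm_sc_le_id => //.
  exact: bounded_spec_eq0.
by move=> t _; case: (_ == _); rewrite ?normr1 ?normr0.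
Qed.

Lemma sd_kproj v : A (kproj v) = 0.
Proof.
rewrite -sc_id /sc scale0r add0r /calc (_ : series _ = cst 0) ?lim_cst//.
apply/funext => n; rewrite /series /= big1// => j _.
by rewrite kproj_coord mulr0 scale0r.
Qed.

End spectral.

Lemma sd_coord (R : realType) (H : completeNormedModType R) (ip : H -> H -> R)
    (A : H -> H) mu e v i : is_inner ip -> spectral_decomposition ip A mu e ->
  ip (A v) (e i) = mu i * ip v (e i).
Proof.
move=> ipP sd; have h := cvg_ipl ipP (w := e i) (let: And3 _ _ h := sd in h v).
rewrite -(cvg_lim (@Rhausdorff R) h); apply: cvg_lim; first exact: Rhausdorff.
apply: cvg_near_cst; near=> n.
rewrite /series /= (ip_partial_sum ipP sd) ?iota_uniq//.
  by rewrite -mulrA (coord_mu ipP sd).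
rewrite mem_index_iota /=; near: n; exact: nbhs_infty_gt.
Unshelve. all: by end_near. Qed.

Lemma sd_mu_le1 (R : realType) (H : completeNormedModType R) (ip : H -> H -> R)
    (A : H -> H) mu e : is_inner ip -> spectral_decomposition ip A mu e ->
  (forall v, ip (A v) v <= `|v| ^+ 2) -> forall j, mu j <= 1.
Proof.
move=> ipP sd hA j; have := hA (e j); rewrite (sd_coord _ _ ipP sd).
rewrite -(inner_norm ipP) (sd_ee sd) eqxx /=.
by have [->|_] := eqVneq (mu j) 0; rewrite ?mulr1// => _; exact: ler01.
Qed.

(** * Comparison of fractional powers *)

Section dyadic.
Context (R : realType).
Implicit Types (theta y t : R) (K : nat).

Lemma sum_geometric_le (q : R) K : 0 <= q < 1 ->
  \sum_(k < K) q ^+ k <= (1 - q)^-1.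
Proof.
move=> /andP[q0 q1]; rewrite -div1r ler_pdivlMr ?subr_gt0//.
elim: K => [|K IH]; first by rewrite big_ord0 mul0r ler01.
have -> : (\sum_(k < K.+1) q ^+ k) * (1 - q) = 1 - q ^+ K.+1.
  by rewrite mulrC -opprB mulNr -subrX1 opprB.
by rewrite lerBlDr lerDl exprn_ge0.
Qed.

(** The upper bound makes the powers of the weight [q] summable; the lower bound gives [4 q > 1], so
    that the terms growing like [(4 q)^k] are dominated by the last of them. *)
Lemma dyadic_weight theta : 0 < theta < 1 ->
  4^-1 < (4 : R) `^ (- theta) < 1.
Proof.
move=> /andP[t0 t1]; apply/andP; split.
  rewrite -(powR_inv1 (ler0n R 4)) /powR gt_eqF ?ltr0n// ltr_expR.
  by rewrite ltr_pM2r ?ltrN2// ln_gt0 ?ltr1n.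
have l4 : 0 < ln (4 : R) by rewrite ln_gt0 ?ltr1n.
by rewrite /powR gt_eqF ?ltr0n// -[ltRHS]expR0 ltr_expR mulNr oppr_lt0 mulr_gt0.
Qed.

(* The sums [\sum_k 4^(-k theta) min(1, 4^k y)] are of order [y^theta]: the
   correction [- D y] makes the bound stable under [y |-> 4 y]. *)
Lemma dyadic_sum_le theta : 0 < theta < 1 -> exists2 C : R, 0 <= C &
  forall K y, 0 < y ->
    \sum_(k < K) (4 `^ (- theta)) ^+ k * Num.min 1 (4 ^+ k * y) <= C * y `^ theta.
Proof.
move=> th; have /andP[q4 q1] := dyadic_weight th.
have /andP[t0 t1] := th.
set q := 4 `^ (- theta) in q4 q1 *.
have q0 : 0 < q by apply: lt_trans q4; rewrite invr_gt0 ltr0n.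
(* In the induction the first term adds [y] and the shifted sum contributes [- 4 q D y];
   [D (4 q - 1) = 1] makes the two recombine into [- D y]. The summand [4 * D] in [C] pays for [D y]
   when [y <= 4]. *)
pose D := (4 * q - 1)^-1; pose C := (1 - q)^-1 + 4 * D.
have D0 : 0 < D by rewrite invr_gt0; lra.
have q1' : 0 < (1 - q)^-1 by rewrite invr_gt0; lra.
have big y K : \sum_(k < K) q ^+ k * Num.min 1 (4 ^+ k * y) <= (1 - q)^-1.
  apply: le_trans (sum_geometric_le K _); last by rewrite (ltW q0) q1.
  apply: ler_sum => k _; rewrite -[leRHS]mulr1 ler_wpM2l ?exprn_ge0 ?(ltW q0)//.
  by rewrite ge_min lexx.
have y1 y : 1 <= y -> 1 <= y `^ theta.
  by move=> h; rewrite -(powRr0 y) ler_powR// ltW.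
have key K y : 0 < y <= 4 ->
    \sum_(k < K) q ^+ k * Num.min 1 (4 ^+ k * y) <= C * y `^ theta - D * y.
  elim: K y => [|K IH] y /andP[y0 y4].
    rewrite big_ord0; have [yl|yl] := lerP y 1.
      have : y <= y `^ theta by apply: ger1_powR; rewrite ?y0 ?yl// ltW.
      by rewrite /C => h; nra.
    by have := y1 _ (ltW yl); rewrite /C; nra.
  have [yl|yl] := ltrP y 1; last first.
    by apply: le_trans (big _ _) _; have := y1 _ yl; rewrite /C; nra.
  rewrite big_ord_recl /= expr0 mul1r expr0 mul1r.
  have -> : Num.min 1 y = y by apply/min_idPr; exact: ltW.
  have -> : \sum_(i < K) q ^+ bump 0 i * Num.min 1 (4 ^+ bump 0 i * y) =
            q * \sum_(i < K) q ^+ i * Num.min 1 (4 ^+ i * (4 * y)).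
    rewrite mulr_sumr; apply: eq_bigr => i _.
    by rewrite /bump /= add1n exprS -mulrA; congr (_ * (_ * Num.min _ _)); rewrite exprS; ring.
  have h4 : 0 < 4 * y <= 4 by lra.
  have := IH _ h4; rewrite powRM ?ler0n//; last exact: ltW.
  have qe : q * 4 `^ theta = 1.
    by rewrite /q powRN mulVf// gt_eqF// powR_gt0// ltr0n.
  have dE : D * (4 * q - 1) = 1 by rewrite mulVf// gt_eqF//; lra.
  move=> h.
  have : q * (\sum_(k < K) q ^+ k * Num.min 1 (4 ^+ k * (4 * y))) <=
    q * (C * (4 `^ theta * y `^ theta) - D * (4 * y)) by rewrite ler_pM2l.
  have -> : q * (C * (4 `^ theta * y `^ theta) - D * (4 * y)) =
    C * y `^ theta * (q * 4 `^ theta) - (D * (4 * q - 1)) * y - D * y by ring.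
  rewrite qe dE; lra.
exists C; first by rewrite /C; lra.
move=> K y y0; have [yl|yl] := lerP y 4.
  apply: le_trans (key K y _) _; first by rewrite y0.
  by rewrite lerBlDr lerDl mulr_ge0// ltW.
apply: le_trans (big _ _) _.
have : 1 <= y `^ theta by apply: y1; lra.
rewrite /C; nra.
Qed.

Lemma powR_dyadic_le theta t K : 0 < theta < 1 -> 0 <= t <= 1 ->
  (t ^+ 2) `^ theta <=
  \sum_(k < K) (4 `^ (- theta)) ^+ k * (2^-1 ^+ k.+1 < t)%R%:R
    + (4 `^ (- theta)) ^+ K.
Proof.
move=> th /andP[t0 t1]; have /andP[th0 th1] := th.
have q0 : 0 <= (4 : R) `^ (- theta) by exact: powR_ge0.
have small k : t <= 2^-1 ^+ k -> (t ^+ 2) `^ theta <= (4 `^ (- theta)) ^+ k.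
  move=> h.
  have -> : (4 `^ (- theta)) ^+ k = ((2^-1 ^+ k) ^+ 2) `^ theta.
    rewrite exprAC -[in RHS]powR_mulrn ?exprn_ge0 ?invr_ge0 ?sqr_ge0//.
    rewrite powRAC powR_mulrn ?powR_ge0//; congr (_ ^+ _).
    rewrite exprVn -natrX -powR_inv1 ?ler0n// -powRrM mulN1r //.
  apply: ge0_ler_powR; rewrite ?nnegrE ?sqr_ge0//; first exact: ltW.
  by rewrite ler_pXn2r// nnegrE exprn_ge0.
elim: K => [|K IH].
  rewrite big_ord0 add0r expr0.
  by have := small 0%N; rewrite expr0 expr0; exact.
rewrite big_ord_recr /=.
have [h|h] := ltrP (2^-1 ^+ K.+1) t; rewrite ?mulr1 ?mulr0 ?addr0.
  by apply: le_trans IH _; rewrite lerDl exprn_ge0.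
apply: le_trans (small _ h) _; by rewrite lerDr sumr_ge0// => k _; rewrite mulr_ge0 ?exprn_ge0.
Qed.

End dyadic.

Section bounded_functions.
Context (R : realType).
Implicit Types (lam a : R).

Lemma bounded_spec_pow a : 0 <= a -> bounded_on_spec (fun t : R => t `^ a).
Proof.
move=> a0; exists 1 => t /andP[t0 t1]; rewrite ger0_norm ?powR_ge0//.
by rewrite -[leRHS](congr1 (fun f => f a) (powR1 R)) ge0_ler_powR ?nnegrE.
Qed.

Lemma bounded_spec_shift lam : 0 <= lam -> bounded_on_spec (fun t : R => t + lam).
Proof.
move=> lam0; exists (1 + lam) => t /andP[t0 t1].
by rewrite ger0_norm ?addr_ge0// lerD2r.
Qed.

Lemma bounded_spec_shift_pow lam a : 0 <= lam -> 0 <= a ->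
  bounded_on_spec (fun t : R => (t + lam) `^ a).
Proof.
move=> lam0 a0; exists ((1 + lam) `^ a) => t /andP[t0 t1].
by rewrite ger0_norm ?powR_ge0// ge0_ler_powR ?nnegrE ?addr_ge0// lerD2r.
Qed.

Lemma bounded_spec_exp n : bounded_on_spec (fun t : R => t ^+ n).
Proof.
exists 1 => t /andP[t0 t1]; rewrite ger0_norm ?exprn_ge0//.
by rewrite exprn_ile1.
Qed.

Lemma bounded_spec_nat (b : R -> bool) : bounded_on_spec (fun t => (b t)%:R).
Proof. by exists 1 => t _; case: (b t); rewrite ?normr1 ?normr0. Qed.

Lemma bounded_spec_min lam tau : 0 <= lam -> 0 < tau ->
  bounded_on_spec (fun t : R => Num.min 1 ((t + lam) / tau)).
Proof.
move=> lam0 tau0; exists 1 => t /andP[t0 t1]; rewrite ger0_norm ?ge_min ?lexx//.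
by rewrite le_min ler01 divr_ge0 ?addr_ge0// ltW.
Qed.

End bounded_functions.

Section comparison.
Context (R : realType) (H : completeNormedModType R) (ip : H -> H -> R).
Hypothesis ipP : is_inner ip.

Lemma sc_shift A mu e lam w : spectral_decomposition ip A mu e ->
  (forall j, mu j <= 1) -> sc ip mu e (fun t => t + lam) w = A w + lam *: w.
Proof.
move=> sd mu1.
rewrite (scDphi ipP sd mu1); last 2 first.
- exact: bounded_spec_id.
- exact: bounded_spec_cst.
rewrite (sc_id sd); congr (_ + _).
rewrite -{2}(sc1 ip mu e w) -(scZphi ipP sd mu1); last exact: bounded_spec1.
by apply: (eq_sc sd mu1) => // t _; rewrite mulr1.
Qed.

(* The cutoff inequality behind the comparison of fractional powers: [w] is cut
   at the level [tau] of [A + lam], the upper part being estimated in norm and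
   the lower part through [T]. *)
Lemma cutoff_le T muT eT A muA eA (lam C tau : R) u :
  spectral_decomposition ip T muT eT -> (forall j, muT j <= 1) ->
  spectral_decomposition ip A muA eA -> (forall j, muA j <= 1) ->
  0 <= lam -> 0 <= C -> 0 < tau ->
  (forall w, `|T w| <= C * `|A w + lam *: w|) ->
  `|sc ip muT eT (fun t => (tau < t)%R%:R) u| <=
  (1 + C) * `|sc ip muA eA (fun t => Num.min 1 ((t + lam) / tau)) u|.
Proof.
move=> sdT T1 sdA A1 lam0 C0 tau0 hTA.
pose hi t : R := (tau <= t + lam)%R%:R; pose lo t : R := (t + lam < tau)%R%:R.
have bhi : bounded_on_spec hi by exact: bounded_spec_nat.
have blo : bounded_on_spec lo by exact: bounded_spec_nat.
have bT : bounded_on_spec (fun t : R => (tau < t)%R%:R) by exact: bounded_spec_nat.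
have bmin := bounded_spec_min lam0 tau0.
pose v := sc ip muA eA hi u; pose w := sc ip muA eA lo u.
have uE : u = 1 *: v + w.
  rewrite scale1r -(scDphi ipP sdA A1)// -[LHS](sc1 ip muA eA).
  by apply: (eq_sc sdA A1) => t _; rewrite /hi /lo; case: leP => _; rewrite ?addr0 ?add0r.
rewrite {1}uE (sc_linear ipP sdT T1)// scale1r mulrDl mul1r.
rewrite (le_trans (ler_normD _ _))// lerD//.
  apply: (@le_trans _ _ (1 * `|v|)).
    apply: (norm_sc_le_id ipP sdT T1) => // t _.
    by case: (_ < _); rewrite ?normr1 ?normr0.
  rewrite mul1r -[leRHS]mul1r.
  apply: (norm_sc_le ipP sdA A1) => // t /andP[t0 t1]; rewrite mul1r /hi.
  case: (leP tau (t + lam)) => ht; last by rewrite normr0.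
  by rewrite (min_idPl _) // ler_pdivlMr// mul1r.
apply: (@le_trans _ _ (tau^-1 * `|sc ip muT eT id w|)).
  apply: (norm_sc_le ipP sdT T1) => //; first exact: bounded_spec_id.
    by rewrite invr_ge0 ltW.
  move=> t /andP[t0 t1]; case: (ltP tau t) => ht; last first.
    by rewrite normr0 mulr_ge0// invr_ge0 ltW.
  by rewrite normr1 ger0_norm// mulrC ler_pdivlMr// mul1r ltW.
rewrite (sc_id sdT) mulrC ler_pdivrMr//.
apply: le_trans (hTA w) _; rewrite -mulrA ler_wpM2l//.
rewrite -(sc_shift lam w sdA A1) (sc_comp ipP sdA A1)//; last exact: bounded_spec_shift.
rewrite mulrC; apply: (norm_sc_le ipP sdA A1) => //.
- by apply: bounded_specM => //; exact: bounded_spec_shift.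
- exact: ltW.
move=> t /andP[t0 t1]; rewrite /lo; case: (ltP (t + lam) tau) => ht; last first.
  by rewrite mulr0 normr0 mulr_ge0// ltW.
have tl0 : 0 <= t + lam by rewrite addr_ge0.
rewrite mulr1 (min_idPr _); last by rewrite ler_pdivrMr// mul1r ltW.
by rewrite !ger0_norm ?divr_ge0 ?(ltW tau0)// mulrC divfK// gt_eqF.
Qed.

(** The Heinz inequality up to a constant: the square of [T^theta] is dominated by a weighted sum of
    cutoffs, each cutoff is transferred to [A + lam] by [cutoff_le], and [dyadic_sum_le] resums the
    result. The end points 0 and 1, excluded from the dyadic sums, are immediate. *)
Lemma heinz_le (theta C : R) : 0 <= theta <= 1 -> 0 <= C -> exists2 C' : R, 0 <= C' &
  forall T muT eT A muA eA (lam : R) u,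
  spectral_decomposition ip T muT eT -> (forall j, muT j <= 1) ->
  spectral_decomposition ip A muA eA -> (forall j, muA j <= 1) ->
  0 < lam -> (forall w, `|T w| <= C * `|A w + lam *: w|) ->
  `|sc ip muT eT (fun t => t `^ theta) u| <=
  C' * `|sc ip muA eA (fun t => (t + lam) `^ theta) u|.
Proof.
move=> /andP[]; rewrite le_eqVlt => /predU1P[<- _ C0|th0].
  exists 1 => // T muT eT A muA eA lam u sdT T1 sdA A1 lam0 _.
  under eq_fun do rewrite powRr0.
  under [in leRHS]eq_fun do rewrite powRr0.
  by rewrite !sc1 mul1r.
rewrite le_eqVlt => /predU1P[-> C0|th1 C0].
  exists C => // T muT eT A muA eA lam u sdT T1 sdA A1 lam0 h.
  have -> : sc ip muT eT (fun t => t `^ 1) u = T u.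
    rewrite -(sc_id sdT); apply: (eq_sc sdT T1) => t /andP[t0 _].
    by rewrite powRr1.
  have -> : sc ip muA eA (fun t => (t + lam) `^ 1) u = A u + lam *: u.
    rewrite -(sc_shift lam u sdA A1); apply: (eq_sc sdA A1) => t /andP[t0 _].
    by rewrite powRr1// addr_ge0// ltW.
  exact: h.
have th : 0 < theta < 1 by rewrite th0.
have [G G0 hG] := dyadic_sum_le th.
(* [4^theta] comes from using [dyadic_sum_le] at [y = 4 (t + lam)^2], the cutoffs being at levels
   [2^(-k-1)]; the [+ 1] pays for the truncated tail. *)
pose C2 := (1 + C) ^+ 2 * (G * 4 `^ theta) + 1.
have C20 : 0 <= C2 by rewrite addr_ge0// mulr_ge0 ?sqr_ge0// mulr_ge0 ?powR_ge0.
exists (Num.sqrt C2); first exact: sqrtr_ge0.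
move=> T muT eT A muA eA lam u sdT T1 sdA A1 lam0 hTA.
have /andP[q4 q1] := dyadic_weight th; set q := 4 `^ (- theta) in q4 q1 hG.
have q0 : 0 < q by apply: lt_trans q4; rewrite invr_gt0 ltr0n.
(* The tail is cut below [lam^(2 theta)], hence below [(t + lam)^(2 theta)]. [K] depends on [lam],
   but the constant does not. *)
have [K hK] : exists K, q ^+ K <= (lam ^+ 2) `^ theta.
  have l0 : 0 < (lam ^+ 2) `^ theta by rewrite powR_gt0// exprn_gt0.
  have q1' : `|q| < 1 by rewrite ger0_norm// ltW.
  have /cvgrPdist_lt/(_ _ l0)[N _ /(_ N (leqnn _))] := cvg_expr q1'.
  rewrite sub0r normrN ger0_norm ?exprn_ge0 ?(ltW q0)// => h.
  by exists N; exact: ltW.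
have bpA := bounded_spec_shift_pow (ltW lam0) (ltW th0).
have bpT := bounded_spec_pow (ltW th0).
rewrite -(@ler_pXn2r _ 2) ?nnegrE ?mulr_ge0 ?sqrtr_ge0// exprMn sqr_sqrtr//.
pose chi (k : nat) (t : R) : R := (2^-1 ^+ k.+1 < t)%R%:R.
pose h k t : R := Num.min 1 ((t + lam) / 2^-1 ^+ k.+1).
have tau0 k : 0 < (2^-1 : R) ^+ k.+1 by rewrite exprn_gt0// invr_gt0 ltr0n.
have bchi k : bounded_on_spec (chi k) by exact: bounded_spec_nat.
have bh k : bounded_on_spec (h k) by exact: bounded_spec_min (ltW lam0) (tau0 k).
have bqh k : bounded_on_spec (fun t => q ^+ k * (h k t * h k t)).
  by apply: bounded_specZ; exact: bounded_specM.
have bqchi k : bounded_on_spec (fun t => q ^+ k * chi k t) by exact: bounded_specZ.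
have bc : bounded_on_spec (fun=> q ^+ K) by exact: bounded_spec_cst.
have step1 : `|sc ip muT eT (fun t => t `^ theta) u| ^+ 2 <=
    \sum_(k < K) q ^+ k * `|sc ip muT eT (chi k) u| ^+ 2 + q ^+ K * `|u| ^+ 2.
  rewrite (norm_sc ipP sdT T1)//.
  have -> : \sum_(k < K) q ^+ k * `|sc ip muT eT (chi k) u| ^+ 2 + q ^+ K * `|u| ^+ 2
    = qform ip muT eT (fun t => \sum_(k < K) q ^+ k * chi k t + q ^+ K * 1) u.
    rewrite (qformD ipP sdT T1).
    - rewrite (qformZ ipP sdT T1); last exact: bounded_spec1.
      rewrite (qform1 ipP); congr (_ + _).
      rewrite (qform_sum ipP sdT T1 (phi := fun k t => q ^+ k * chi k t))//.
      apply: eq_bigr => k _; rewrite (qformZ ipP sdT T1)// (norm_sc ipP sdT T1)//.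
      congr (_ * qform _ _ _ _ _); apply/funext => t.
      by rewrite /chi; case: (_ < _); rewrite ?expr1n ?expr0n.
    - exact: (bounded_spec_sum (phi := fun k t => q ^+ k * chi k t)).
    - by under eq_fun do rewrite mulr1.
  apply: (qform_le ipP sdT T1).
  - by rewrite -/(bounded_on_spec _); under eq_fun do rewrite expr2; exact: bounded_specM.
  - apply: bounded_specD; last by under eq_fun do rewrite mulr1.
    exact: (bounded_spec_sum (phi := fun k t => q ^+ k * chi k t)).
  move=> t /andP[t0 t1].
  rewrite mulr1 -powR_mulrn ?powR_ge0// powRAC powR_mulrn//.
  by apply: powR_dyadic_le => //; rewrite t0.
apply: le_trans step1 _.
have -> : C2 * `|sc ip muA eA (fun t => (t + lam) `^ theta) u| ^+ 2 =
  (1 + C) ^+ 2 * ((G * 4 `^ theta) * `|sc ip muA eA (fun t => (t + lam) `^ theta) u| ^+ 2)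
  + `|sc ip muA eA (fun t => (t + lam) `^ theta) u| ^+ 2.
  by rewrite /C2; ring.
apply: lerD; last first.
  apply: (@le_trans _ _ ((lam `^ theta * `|u|) ^+ 2)).
    rewrite exprMn ler_wpM2r ?sqr_ge0//; apply: le_trans hK _.
    by rewrite -powR_mulrn ?(ltW lam0)// powRAC powR_mulrn ?powR_ge0.
  rewrite ler_pXn2r ?nnegrE ?mulr_ge0 ?powR_ge0//.
  have -> : lam `^ theta * `|u| = `|sc ip muA eA (fun=> lam `^ theta * 1) u|.
    rewrite (scZphi ipP sdA A1) ?sc1 ?normrZ ?ger0_norm ?powR_ge0//.
    exact: bounded_spec1.
  rewrite -[leRHS]mul1r; apply: (norm_sc_le ipP sdA A1) => //.
    by rewrite mulr1; exact: bounded_spec_cst.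
  move=> t /andP[t0 t1]; rewrite mulr1 mul1r !ger0_norm ?powR_ge0//.
  by rewrite ge0_ler_powR ?nnegrE ?addr_ge0 ?(ltW lam0) ?(ltW th0)// lerDr.
apply: (@le_trans _ _ ((1 + C) ^+ 2 * \sum_(k < K) q ^+ k * `|sc ip muA eA (h k) u| ^+ 2)).
  rewrite mulr_sumr; apply: ler_sum => k _; rewrite [leRHS]mulrCA ler_wpM2l ?exprn_ge0 ?(ltW q0)//.
  rewrite -exprMn ler_pXn2r ?nnegrE ?mulr_ge0 ?addr_ge0//.
  exact: (cutoff_le _ sdT T1 sdA A1 (ltW lam0) C0 (tau0 k)).
rewrite ler_wpM2l ?sqr_ge0//.
have -> : \sum_(k < K) q ^+ k * `|sc ip muA eA (h k) u| ^+ 2 =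
  qform ip muA eA (fun t => \sum_(k < K) q ^+ k * (h k t * h k t)) u.
  rewrite (qform_sum ipP sdA A1 (phi := fun k t => q ^+ k * (h k t * h k t)))//.
  apply: eq_bigr => k _; rewrite (qformZ ipP sdA A1) ?(norm_sc ipP sdA A1)//.
  by apply: bounded_specM.
rewrite (norm_sc ipP sdA A1)// -(qformZ ipP sdA A1); last exact: bounded_specM.
apply: (qform_le ipP sdA A1).
- exact: (bounded_spec_sum (phi := fun k t => q ^+ k * (h k t * h k t))).
- by apply: bounded_specZ; exact: bounded_specM.
move=> t /andP[t0 t1].
have tl0 : 0 < t + lam by rewrite ltr_wpDl.
have y0 : 0 < 4 * (t + lam) ^+ 2 by rewrite mulr_gt0 ?exprn_gt0 ?ltr0n.
have := hG K _ y0; rewrite powRM ?ler0n ?sqr_ge0// mulrA.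
rewrite -[((t + lam) ^+ 2) `^ theta](_ : ((t + lam) `^ theta) ^+ 2 = _); last first.
  by rewrite -powR_mulrn ?powR_ge0// powRAC powR_mulrn// ltW.
apply: le_trans; apply: ler_sum => k _; rewrite ler_wpM2l ?exprn_ge0 ?(ltW q0)//.
have hk0 : 0 <= h k t by rewrite le_min ler01 divr_ge0// ltW.
rewrite le_min; apply/andP; split.
  by rewrite -[leRHS]mulr1 ler_pM// ge_min lexx.
have -> : 4 ^+ k * (4 * (t + lam) ^+ 2) = ((t + lam) / 2^-1 ^+ k.+1) ^+ 2.
  have e4 : (2 : R) ^+ 2 = 4 by rewrite -natrX.
  rewrite exprVn invrK exprMn -exprM mulnC exprM e4 (exprS 4).
  by move: (4 ^+ k) => x; ring.
by rewrite expr2 ler_pM// ge_min lexx orbT.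
Qed.

End comparison.

(** * The approximation error on the favourable event *)

Section approximation.
Context (R : realType) (H : completeNormedModType R) (ip : H -> H -> R).
Hypothesis ipP : is_inner ip.
Context (T : H -> H) (muT : nat -> R) (eT : nat -> H).
Context (A : H -> H) (muA : nat -> R) (eA : nat -> H).
Hypothesis sdT : spectral_decomposition ip T muT eT.
Hypothesis T1 : forall j, muT j <= 1.
Hypothesis sdA : spectral_decomposition ip A muA eA.
Hypothesis A1 : forall j, muA j <= 1.
Context (r s lam Gam : R) (rho : R -> R).
Hypothesis r_gt0 : 0 < r.
Hypothesis s_ge0 : 0 <= s.
Hypothesis lam01 : 0 < lam <= 1.
Hypothesis Gam_ge0 : 0 <= Gam.
Hypothesis rho_bnd : bounded_on_spec rho.
Hypothesis rho_le : forall v : R, 0 <= v <= r + s -> forall t : R, 0 <= t <= 1 ->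
  `|rho t| * (t + lam) `^ v <= Gam * lam `^ v.
Hypothesis TA_le : forall w, `|T w - A w| ^+ 2 <=
  4^-1 * lam `^ (2 * Num.max r 1 - 1) * (ip (T w) w + lam * `|w| ^+ 2).

Let lam_gt0 : 0 < lam. Proof. by case/andP: lam01. Qed.
Let lam_ge0 : 0 <= lam. Proof. exact: ltW. Qed.
Let lam_le1 : lam <= 1. Proof. by case/andP: lam01. Qed.

Lemma T_positive w : 0 <= ip (T w) w.
Proof.
have := qform_le ipP sdT T1 w (bounded_spec_cst 0) (bounded_spec_id R).
rewrite /qform (sc_id sdT) => h; apply: le_trans (h _); last by move=> t /andP[].
have := qformZ ipP sdT T1 0 w (bounded_spec1 R).
by rewrite !mul0r /qform => ->.
Qed.

Lemma shift_sqr w : `|T w + lam *: w| ^+ 2 =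
  `|T w| ^+ 2 + 2 * (lam * ip (T w) w) + lam ^+ 2 * `|w| ^+ 2.
Proof.
rewrite (normD_sqr ipP) (ipZr ipP) normrZ exprMn.
by rewrite -[`|lam| ^+ 2]normrX ger0_norm ?sqr_ge0.
Qed.

Lemma quad_shift_le w : lam * (ip (T w) w + lam * `|w| ^+ 2) <= `|T w + lam *: w| ^+ 2.
Proof.
rewrite shift_sqr; have := T_positive w; have := sqr_ge0 `|T w|.
have := lam_ge0; set x := `|T w| ^+ 2; set y := ip _ _; nra.
Qed.

(** The factor [4^-1] of the event is spent here: as [lam^(2 max(r, 1) - 1) <= lam], the
    perturbation is at most half of [T + lam] and can be absorbed. This gives [T_le_shift], the
    hypothesis of [heinz_le]. *)
Lemma diff_shift_le w : `|T w - A w| <= 2^-1 * `|T w + lam *: w|.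
Proof.
rewrite -(@ler_pXn2r _ 2) ?nnegrE ?mulr_ge0 ?invr_ge0 ?ler0n// exprMn.
apply: le_trans (TA_le w) _; rewrite exprVn -natrX -mulrA ler_wpM2l ?invr_ge0 ?ler0n//.
apply: le_trans (quad_shift_le w).
rewrite ler_wpM2r//.
  by rewrite addr_ge0 ?T_positive// mulr_ge0 ?sqr_ge0.
rewrite -[leRHS]powRr1//; apply: ger_powR; rewrite ?lam_gt0//.
have : 1 <= Num.max r 1 by rewrite le_max lexx orbT.
lra.
Qed.

Lemma T_le_shift w : `|T w| <= 2 * `|A w + lam *: w|.
Proof.
have h1 : `|T w| <= `|T w + lam *: w|.
  rewrite -(@ler_pXn2r _ 2) ?nnegrE// shift_sqr -addrA lerDl.
  by rewrite addr_ge0 ?mulr_ge0 ?sqr_ge0 ?T_positive.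
have h2 := diff_shift_le w.
have h3 : `|T w + lam *: w| <= `|T w - A w| + `|A w + lam *: w|.
  apply: le_trans (ler_normD _ _).
  by rewrite addrA subrK.
lra.
Qed.

(** In the exchange the other factors are functions of [A], so the form of [T + lam] in the event
    must be replaced by that of [A + lam]. By Cauchy-Schwarz the event makes [|ip (T z - A z) z|] at
    most half of the first form, whence a factor 2 between the two. *)
Lemma diff_sqrt_le z : `|T z - A z| <= lam `^ (Num.max r 1 - 2^-1) *
  `|sc ip muA eA (fun t => (t + lam) `^ 2^-1) z|.
Proof.
set q := ip (T z) z + lam * `|z| ^+ 2.
have q0 : 0 <= q by rewrite addr_ge0 ?T_positive// mulr_ge0 ?sqr_ge0.
have bh : bounded_on_spec (fun t : R => (t + lam) `^ 2^-1).
  by apply: bounded_spec_shift_pow => //; rewrite invr_ge0.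
have qA : `|sc ip muA eA (fun t => (t + lam) `^ 2^-1) z| ^+ 2 =
    ip (A z) z + lam * `|z| ^+ 2.
  rewrite (norm_sc ipP sdA A1)// -(inner_norm ipP) -(ipZl ipP) -(ipDl ipP).
  rewrite -(sc_shift ipP lam z sdA A1) /qform; congr (ip _ _).
  apply: (eq_sc sdA A1) => t /andP[t0 t1].
  by rewrite powR12_sqrt ?sqr_sqrtr// addr_ge0.
have lam1 : lam `^ (2 * Num.max r 1 - 1) <= lam.
  rewrite -[leRHS]powRr1//; apply: ger_powR; rewrite ?lam_gt0//.
  have : 1 <= Num.max r 1 by rewrite le_max lexx orbT.
  lra.
have h1 : `|ip (T z - A z) z| <= 2^-1 * q.
  rewrite -(@ler_pXn2r _ 2) ?nnegrE ?mulr_ge0 ?invr_ge0//.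
  apply: (@le_trans _ _ ((`|T z - A z| * `|z|) ^+ 2)).
    by rewrite ler_pXn2r ?nnegrE ?mulr_ge0//; exact: (cauchy_schwarz ipP).
  rewrite exprMn; apply: (@le_trans _ _ (4^-1 * lam * q * `|z| ^+ 2)).
    rewrite ler_wpM2r ?sqr_ge0//; apply: le_trans (TA_le z) _.
    by rewrite -/q ler_wpM2r// ler_wpM2l// invr_ge0.
  have h : lam * `|z| ^+ 2 <= q by rewrite lerDr T_positive.
  have -> : (2^-1 * q) ^+ 2 = 4^-1 * q * q by rewrite exprMn exprVn -natrX; ring.
  have -> : 4^-1 * lam * q * `|z| ^+ 2 = 4^-1 * q * (lam * `|z| ^+ 2) by ring.
  by rewrite ler_wpM2l// mulr_ge0// invr_ge0.
have h2 : q <= 2 * `|sc ip muA eA (fun t => (t + lam) `^ 2^-1) z| ^+ 2.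
  rewrite qA; move: h1; rewrite ler_norml (ipBl ipP) => /andP[_].
  by rewrite /q; lra.
rewrite -(@ler_pXn2r _ 2) ?nnegrE ?mulr_ge0 ?powR_ge0// exprMn.
apply: le_trans (TA_le z) _; rewrite -/q.
have -> : (lam `^ (Num.max r 1 - 2^-1)) ^+ 2 = lam `^ (2 * Num.max r 1 - 1).
  by rewrite -powR_mulrn ?powR_ge0// -powRrM; congr (_ `^ _); lra.
have := powR_ge0 lam (2 * Num.max r 1 - 1).
set x := lam `^ _ in lam1 *; move=> x0.
set y := `|sc _ _ _ _ _| ^+ 2 in h2 *.
have : x * q <= x * (2 * y) by rewrite ler_wpM2l.
have : 0 <= x * y by rewrite mulr_ge0// sqr_ge0.
lra.
Qed.

Lemma bounded_chi n : bounded_on_spec (fun t => (t + lam) `^ s * rho t * t ^+ n).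
Proof.
apply: bounded_specM; last exact: bounded_spec_exp.
by apply: bounded_specM => //; exact: bounded_spec_shift_pow.
Qed.

(** Bounding [t^n] by [(t + lam)^n] leaves a single power of [t + lam], to which [rho_le] applies as
    long as the total exponent is at most [r + s]. *)
Lemma chi_le n a (t : R) : 0 <= a -> s + n%:R + a <= r + s -> 0 <= t <= 1 ->
  `|(t + lam) `^ a * ((t + lam) `^ s * rho t * t ^+ n)| <= Gam * lam `^ (s + n%:R + a).
Proof.
move=> a0 ha /andP[t0 t1]; have tl : 0 < t + lam by rewrite ltr_wpDl.
have v0 : 0 <= s + n%:R + a by rewrite !addr_ge0.
have := @rho_le (s + n%:R + a); rewrite v0 ha => /(_ isT t); rewrite t0 t1 => /(_ isT).
apply: le_trans; rewrite !normrM (ger0_norm (powR_ge0 _ _)) (ger0_norm (powR_ge0 _ _)).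
rewrite (ger0_norm (exprn_ge0 _ t0)).
have -> : (t + lam) `^ (s + n%:R + a) =
    (t + lam) `^ s * (t + lam) ^+ n * (t + lam) `^ a.
  by rewrite !powRD ?(gt_eqF tl) ?implybT// powR_mulrn// ltW.
have -> : (t + lam) `^ a * ((t + lam) `^ s * `|rho t| * t ^+ n) =
  (`|rho t| * ((t + lam) `^ s * (t + lam) `^ a)) * t ^+ n by ring.
have -> : `|rho t| * ((t + lam) `^ s * (t + lam) ^+ n * (t + lam) `^ a) =
  (`|rho t| * ((t + lam) `^ s * (t + lam) `^ a)) * (t + lam) ^+ n by ring.
rewrite ler_wpM2l ?mulr_ge0 ?powR_ge0//.
by rewrite lerXn2r ?nnegrE ?lerDl// ltW.
Qed.

Context (Cr : R) (k : nat) (r' : R).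
Hypothesis Cr_ge0 : 0 <= Cr.
Hypothesis r_split : r = k%:R + r'.
Hypothesis r'01 : 0 <= r' <= 1.
Hypothesis heinz_r' : forall u, `|sc ip muT eT (fun t => t `^ r') u| <=
  Cr * `|sc ip muA eA (fun t => (t + lam) `^ r') u|.

(* Induction on the number [j] of factors [T] still to be exchanged: write
   [T = (T - A) + A]; the term in [A] raises [i] and the term in [T - A] is
   estimated by [diff_sqrt_le]. *)
Lemma exchange_le (j i : nat) h : (i + j)%N = k ->
  `|sc ip muA eA (fun t => (t + lam) `^ s * rho t * t ^+ i)
      (sc ip muT eT (fun t => t `^ (j%:R + r')) h)|
  <= (Cr + j%:R) * (Gam * lam `^ (r + s)) * `|h|.
Proof.
have r'0 : 0 <= r' by case/andP: r'01.
elim: j i => [|j IH] i ij.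
  rewrite addr0; rewrite addn0 in ij; rewrite ij.
  under [X in sc _ _ _ X h]eq_fun do rewrite add0r.
  set psi := fun t => _; have bpsi : bounded_on_spec psi by exact: bounded_chi.
  set u := sc _ _ _ _ _.
  (* Duality brings [T^r'] to the outside, where [heinz_r'] turns it into a power of [A + lam] that
     merges with the function of [A]. *)
  apply: (norm_le_dual ipP); first by rewrite !mulr_ge0 ?powR_ge0.
  rewrite {1}/u (sc_sym ipP sdA A1)// (sc_sym ipP sdT T1); last exact: bounded_spec_pow.
  apply: le_trans (ip_le ipP _ _) _.
  apply: (@le_trans _ _ (`|h| * (Cr * (Gam * lam `^ (r + s) * `|u|)))); last first.
    by rewrite le_eqVlt; apply/orP; left; apply/eqP; ring.
  rewrite ler_wpM2l//; apply: le_trans (heinz_r' _) _; rewrite ler_wpM2l//.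
  rewrite (sc_comp ipP sdA A1)//; last exact: bounded_spec_shift_pow.
  apply: (norm_sc_le_id ipP sdA A1).
  - by apply: bounded_specM => //; exact: bounded_spec_shift_pow.
  - by rewrite mulr_ge0 ?powR_ge0.
  have e : s + k%:R + r' = r + s by rewrite r_split; ring.
  by move=> t t01; rewrite /psi -e; apply: chi_le => //; rewrite e.
have kr : k%:R <= r by rewrite r_split lerDl.
have jr'0 : 0 <= j%:R + r' by rewrite addr_ge0.
set w := sc ip muT eT (fun t => t `^ (j%:R + r')) h.
have wh : `|w| <= `|h|.
  rewrite -[leRHS]mul1r; apply: (norm_sc_le_id ipP sdT T1) => //.
    exact: bounded_spec_pow.
  move=> t /andP[t0 t1]; rewrite ger0_norm ?powR_ge0//.
  by rewrite -[leRHS](congr1 (fun f => f (j%:R + r')) (powR1 R)) ge0_ler_powR ?nnegrE.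
have -> : sc ip muT eT (fun t => t `^ (j.+1%:R + r')) h = (T w - A w) + A w.
  rewrite subrK -(sc_id sdT) /w (sc_comp ipP sdT T1); last 2 first.
  - exact: bounded_spec_id.
  - exact: bounded_spec_pow.
  apply: (eq_sc sdT T1) => t /andP[t0 t1].
  rewrite -{2}(powRr1 t0) -powRD -?natr1; last by rewrite gt_eqF// ltr_pwDl.
  by congr (_ `^ _); ring.
rewrite -[T w - A w]scale1r (sc_linear ipP sdA A1); last exact: bounded_chi.
rewrite scale1r; apply: le_trans (ler_normD _ _) _.
have -> : (Cr + j.+1%:R) * (Gam * lam `^ (r + s)) * `|h| =
  Gam * lam `^ (r + s) * `|h| + (Cr + j%:R) * (Gam * lam `^ (r + s)) * `|h|.
  by rewrite -natr1; ring.
apply: lerD; last first.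
  rewrite -(sc_id sdA w) (sc_comp ipP sdA A1); last 2 first.
  - exact: bounded_chi.
  - exact: bounded_spec_id.
  have -> : (fun t => (t + lam) `^ s * rho t * t ^+ i * id t) =
            (fun t => (t + lam) `^ s * rho t * t ^+ i.+1).
    by apply/funext => t; rewrite exprSr mulrA.
  by apply: IH; rewrite addSnnS.
set psi := fun t => _; have bpsi : bounded_on_spec psi by exact: bounded_chi.
set u := sc ip muA eA psi (T w - A w).
apply: (norm_le_dual ipP); first by rewrite !mulr_ge0 ?powR_ge0.
have -> : ip u u = ip w (T (sc ip muA eA psi u) - A (sc ip muA eA psi u)).
  rewrite {1}/u (sc_sym ipP sdA A1)// (ipBl ipP) (ipBr ipP).
  rewrite -(sc_id sdT w) -(sc_id sdA w) -!(sc_id sdT (sc _ _ _ _ _)).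
  rewrite -(sc_id sdA (sc _ _ _ _ _)).
  by rewrite (sc_sym ipP sdT T1 w)// ?(sc_sym ipP sdA A1 w)//; exact: bounded_spec_id.
apply: le_trans (ip_le ipP _ _) _.
(* A factor [T] remains to be exchanged, so [r >= 1] and [diff_sqrt_le] yields [lam^(r - 1/2)]. The
   other half power comes from the function of [A], and [i + 1 <= r] keeps its exponent in the range
   of [rho_le]. *)
have r1 : 1 <= r.
  apply: le_trans kr; rewrite -ij addnS ler1n //.
have i2 : i%:R + 1 <= r.
  by apply: le_trans kr; rewrite -ij natr1 ler_nat addnS ltnS leq_addr.
apply: (@le_trans _ _ (`|h| * (lam `^ (Num.max r 1 - 2^-1) *
   (Gam * lam `^ (s + i%:R + 2^-1) * `|u|)))).
  apply: ler_pM => //; apply: le_trans (diff_sqrt_le _) _.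
  rewrite ler_wpM2l ?powR_ge0// (sc_comp ipP sdA A1)//; last first.
    by apply: bounded_spec_shift_pow; rewrite ?invr_ge0.
  apply: (norm_sc_le_id ipP sdA A1).
  - by apply: bounded_specM => //; apply: bounded_spec_shift_pow; rewrite ?invr_ge0.
  - by rewrite mulr_ge0 ?powR_ge0.
  move=> t t01; rewrite /psi; apply: chi_le => //; rewrite ?invr_ge0//.
  by move: i2; lra.
rewrite (max_idPl r1).
have -> : `|h| * (lam `^ (r - 2^-1) * (Gam * lam `^ (s + i%:R + 2^-1) * `|u|)) =
  Gam * (lam `^ (r - 2^-1) * lam `^ (s + i%:R + 2^-1)) * `|h| * `|u| by ring.
rewrite -powRD ?(gt_eqF lam_gt0) ?implybT//.
rewrite !ler_wpM2r// ler_wpM2l//; apply: ger_powR; rewrite ?lam_gt0//.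
by have : (0 : R) <= i%:R by []; lra.
Qed.

End approximation.

(** [C] is chosen before the operators and [lam], so the bound is uniform over samples, blocks and
    [n]. [heinz_le] serves twice: for [T^s], and for the fractional part [r'] of the exponent
    [r]. *)
Lemma approximation_le (R : realType) (H : completeNormedModType R)
    (ip : H -> H -> R) (ipP : is_inner ip) (r s Gam : R) :
  0 < r -> 0 <= s <= 1 -> 0 <= Gam -> exists2 C : R, 0 <= C &
  forall T muT eT A muA eA (rho : R -> R) lam h,
  spectral_decomposition ip T muT eT -> (forall j, muT j <= 1) ->
  spectral_decomposition ip A muA eA -> (forall j, muA j <= 1) ->
  0 < lam <= 1 -> bounded_on_spec rho ->
  (forall v : R, 0 <= v <= r + s -> forall t : R, 0 <= t <= 1 ->
    `|rho t| * (t + lam) `^ v <= Gam * lam `^ v) ->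
  (forall w, `|T w - A w| ^+ 2 <=
    4^-1 * lam `^ (2 * Num.max r 1 - 1) * (ip (T w) w + lam * `|w| ^+ 2)) ->
  `|sc ip muT eT (fun t => t `^ s) (sc ip muA eA rho (sc ip muT eT (fun t => t `^ r) h))|
    <= C * lam `^ (r + s) * `|h|.
Proof.
move=> r0 s01 G0; have /andP[s0 s1] := s01.
pose k := Num.truncn r; pose r' := r - k%:R.
have r'01 : 0 <= r' <= 1.
  have := truncn_itv (ltW r0); rewrite -/k => /andP[h1 h2].
  by rewrite subr_ge0 h1 lerBlDr addrC natr1 ltW.
have [Cs Cs0 hs] := heinz_le ipP s01 (ler0n R 2).
have [Cr Cr0 hr] := heinz_le ipP r'01 (ler0n R 2).
exists (Cs * ((Cr + k%:R) * Gam)); first by rewrite !mulr_ge0 ?addr_ge0.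
move=> T muT eT A muA eA rho lam h sdT T1 sdA A1 lam01 brho hrho hTA.
have /andP[lam0 lam1] := lam01.
have hsh w := T_le_shift ipP sdT T1 lam01 hTA w.
apply: le_trans (hs _ _ _ _ _ _ _ _ sdT T1 sdA A1 lam0 hsh) _.
rewrite -!mulrA ler_wpM2l// (sc_comp ipP sdA A1)//; last first.
  by apply: bounded_spec_shift_pow => //; exact: ltW.
have rE : r = k%:R + r' by rewrite /r' subrKC.
have := exchange_le ipP sdT T1 sdA A1 s0 lam01 G0 brho hrho hTA Cr0 rE r'01
  (fun u => hr _ _ _ _ _ _ _ u sdT T1 sdA A1 lam0 hsh) h (add0n k).
rewrite -rE !mulrA; congr (_ <= _); congr (`| sc _ _ _ _ _ |).
by apply/funext => t; rewrite expr0 mulr1.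
Qed.

(** * Finite-rank operators *)

Lemma sum_continuous (R : realType) (T : topologicalType) (V : normedModType R)
    (I : Type) (s : seq I) (f : I -> T -> V) :
  (forall i, continuous (f i)) -> continuous (fun x => \sum_(i <- s) f i x).
Proof.
move=> h; elim: s => [|i s IH] x.
  by rewrite /continuous_at; under eq_fun do rewrite big_nil; rewrite big_nil; exact: cvg_cst.
rewrite /continuous_at; under eq_fun do rewrite big_cons; rewrite big_cons.
by apply: cvgD; [exact: h|exact: IH].
Qed.

Section finite_rank.
Context (R : realType) (H : completeNormedModType R) (ip : H -> H -> R).
Hypothesis ipP : is_inner ip.
Context (N : nat).
Implicit Types (a : 'I_N -> H) (c : 'I_N -> R) (u v w : H).

Definition comb a c : H := \sum_i c i *: a i.
Definition frame_op a v : H := \sum_i ip v (a i) *: a i.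

Lemma frame_op_ip a v w : ip (frame_op a v) w = \sum_i ip v (a i) * ip w (a i).
Proof.
rewrite (ip_suml ipP); apply: eq_bigr => i _.
by rewrite (ipZl ipP) (inner_sym ipP w).
Qed.

Lemma comb_ip a c w : ip (comb a c) w = \sum_i c i * ip w (a i).
Proof.
rewrite (ip_suml ipP); apply: eq_bigr => i _.
by rewrite (ipZl ipP) (inner_sym ipP w).
Qed.

Lemma comb_sqr_continuous a :
  continuous (fun c : 'rV[R]_N => `|comb a (c ord0)| ^+ 2).
Proof.
move=> c; rewrite /continuous_at expr2; under eq_fun do rewrite expr2.
have h : (fun c : 'rV[R]_N => `|comb a (c ord0)|) @ c --> `|comb a (c ord0)|.
  have hs i : continuous (fun c : 'rV[R]_N => c ord0 i *: a i).
    move=> c1; have h := @coord_continuous R 1 N ord0 i c1.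
    exact: (@cvgZr_tmp R H _ (nbhs c1) _ (fun c : 'rV[R]_N => c ord0 i) (c1 ord0 i) (a i) h).
  exact: (cvg_norm (@sum_continuous R 'rV[R]_N H 'I_N (index_enum _) _ hs c)).
exact: (cvgM h h).
Qed.

Lemma unit_coord c i : \sum_i c i ^+ 2 = 1 -> `|c i| <= 1.
Proof.
move=> h; rewrite -(@ler_pXn2r _ 2) ?nnegrE// expr1n -normrX ger0_norm ?sqr_ge0//.
by rewrite -h (bigD1 i)//= lerDl sumr_ge0// => j _; exact: sqr_ge0.
Qed.

(** The maximum is sought over coefficient vectors because their unit sphere is compact, unlike that
    of [H]. *)
Lemma comb_max a : (0 < N)%N -> exists2 c, \sum_i c i ^+ 2 = 1 &
  forall c', \sum_i c' i ^+ 2 = 1 -> `|comb a c'| ^+ 2 <= `|comb a c| ^+ 2.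
Proof.
move=> N0; pose S := [set c : 'rV[R]_N | \sum_i c ord0 i ^+ 2 = 1].
have S0 : S !=set0.
  exists (\row_i (i == Ordinal N0)%:R); rewrite /S /= (bigD1 (Ordinal N0))//=.
  rewrite mxE eqxx expr1n big1 ?addr0// => i /negPf iN.
  by rewrite mxE iN expr0n.
have cS : compact S.
  apply: (@subclosed_compact _ _ [set v : 'rV[R]_N | forall i, `[-1, 1]%classic (v ord0 i)]).
  - pose q (c : 'rV[R]_N) : R := \sum_i c ord0 i ^+ 2.
    have qc : continuous q.
      apply: (@sum_continuous _ 'rV[R]_N R _ _ (fun i (c : 'rV[R]_N) => c ord0 i ^+ 2)) => i c.
      rewrite /continuous_at expr2; under eq_fun do rewrite expr2.
      have h := @coord_continuous R 1 N ord0 i c.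
      exact: (cvgM h h).
    rewrite (_ : S = q @^-1` [set 1])//; apply: preimage_closed => [x _|].
      exact: qc.
    exact: closed_eq.
  - apply: (@rV_compact R N (fun=> `[-1, 1]%classic)) => i; exact: segment_compact.
  - move=> c /= hc i; rewrite in_itv /= -ler_norml; exact: (@unit_coord (c ord0)).
have [c cS1 hc] := EVT_max_rV S0 cS (continuous_subspaceT (@comb_sqr_continuous a)).
exists (c ord0); first by move: cS1; rewrite inE.
move=> c' hc'; have := hc (\row_i c' i); rewrite inE /S /=.
under eq_bigr do rewrite mxE; move=> /(_ hc').
rewrite (_ : comb a ((\row_i c' i) ord0) = comb a c')//.
by apply: eq_bigr => i _; rewrite mxE.
Qed.

(* [de.1] is the largest eigenvalue of the frame operator of [a] (the square of
   the norm of [comb a]), with a unit eigenvector [de.2], or [0] if [a = 0]. *)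
Definition top_pair a (de : R * H) : Prop :=
  [/\ 0 <= de.1,
      forall c, `|comb a c| ^+ 2 <= de.1 * \sum_i c i ^+ 2,
      forall M : R, 0 <= M -> (forall c, `|comb a c| ^+ 2 <= M * \sum_i c i ^+ 2) ->
        de.1 <= M,
      ip de.2 de.2 = (de.1 != 0)%:R &
      frame_op a de.2 = de.1 *: de.2].

(* The image under [comb a] of a maximizer of [|comb a c|] on the unit sphere is
   an eigenvector, by the equality case of the Cauchy-Schwarz inequality. *)
Lemma top_pair_exists a : exists de, top_pair a de.
Proof.
have [N0|N0] := posnP N.
  exists (0, 0); split => //=.
  - move=> c; rewrite mul0r /comb big1 ?normr0 ?expr0n//.
    by move=> [i iN]; exfalso; rewrite N0 in iN.
  - by rewrite eqxx (ip0l ipP).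
  - rewrite scaler0 /frame_op big1// => i _; by rewrite (ip0l ipP) scale0r.
have [c c1 hc] := comb_max a N0.
pose d := `|comb a c| ^+ 2.
have dmax c' : `|comb a c'| ^+ 2 <= d * \sum_i c' i ^+ 2.
  set q := \sum_i _; have q0 : 0 <= q by apply: sumr_ge0 => i _; exact: sqr_ge0.
  have [qz|qz] := eqVneq q 0.
    have cz i : c' i = 0.
      apply/eqP; rewrite -sqrf_eq0; move/eqP: qz; rewrite psumr_eq0; last first.
        by move=> ? _; exact: sqr_ge0.
      by move/allP => /(_ i); rewrite mem_index_enum => /(_ isT).
    rewrite qz mulr0 /comb big1 ?normr0 ?expr0n// => i _; by rewrite cz scale0r.
  have qp : 0 < q by rewrite lt_def qz.
  have sq : Num.sqrt q ^+ 2 = q by rewrite sqr_sqrtr.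
  have := hc (fun i => (Num.sqrt q)^-1 * c' i).
  have -> : \sum_i ((Num.sqrt q)^-1 * c' i) ^+ 2 = 1.
    under eq_bigr do rewrite exprMn exprVn sq.
    by rewrite -mulr_sumr mulVf.
  move=> /(_ erefl).
  have -> : comb a (fun i => (Num.sqrt q)^-1 * c' i) = (Num.sqrt q)^-1 *: comb a c'.
    by rewrite /comb scaler_sumr; apply: eq_bigr => i _; rewrite scalerA.
  rewrite normrZ exprMn -normrX exprVn sq ger0_norm ?invr_ge0// mulrC ler_pdivrMr//.
pose e := comb a c; pose y i := ip e (a i).
have d0 : 0 <= d by exact: sqr_ge0.
have yc : \sum_i c i * y i = d by rewrite -comb_ip (inner_norm ipP).
have yy : ip (comb a y) e = \sum_i y i ^+ 2.
  by rewrite comb_ip; apply: eq_bigr => i _; rewrite expr2.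
set Y := \sum_i y i ^+ 2 in yy.
have Y0 : 0 <= Y by apply: sumr_ge0 => i _; exact: sqr_ge0.
have YY : Y ^+ 2 <= d * Y * d.
  rewrite -{1}yy; apply: (@le_trans _ _ ((`|comb a y| * `|e|) ^+ 2)).
    rewrite -[leLHS]ger0_norm ?sqr_ge0// normrX ler_pXn2r ?nnegrE ?mulr_ge0//.
    exact: (cauchy_schwarz ipP).
  by rewrite exprMn -/d ler_wpM2r// dmax.
have Yd : Y <= d ^+ 2.
  have [->|Yn] := eqVneq Y 0; first exact: sqr_ge0.
  have Yp : 0 < Y by rewrite lt_def Yn.
  by move: YY; rewrite expr2 mulrAC ler_pM2r// -expr2.
have ydc i : y i = d * c i.
  have h : \sum_i (y i - d * c i) ^+ 2 <= 0.
    have -> : \sum_i (y i - d * c i) ^+ 2 =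
        Y - 2 * d * (\sum_i c i * y i) + d ^+ 2 * \sum_i c i ^+ 2.
      rewrite /Y !mulr_sumr -sumrB -big_split /=; apply: eq_bigr => j _; ring.
    rewrite yc c1; move: Yd; lra.
  have h0 : \sum_i (y i - d * c i) ^+ 2 = 0.
    by apply/eqP; rewrite eq_le h sumr_ge0// => j _; exact: sqr_ge0.
  move/eqP: h0; rewrite psumr_eq0; last by move=> ? _; exact: sqr_ge0.
  move/allP => /(_ i); rewrite mem_index_enum => /(_ isT).
  by rewrite /= sqrf_eq0 subr_eq0 => /eqP.
have fe : frame_op a e = d *: e.
  rewrite /frame_op /e /comb scaler_sumr; apply: eq_bigr => i _.
  by rewrite -/e -/(y i) ydc scalerA.
have dM (M : R) : 0 <= M -> (forall c, `|comb a c| ^+ 2 <= M * \sum_i c i ^+ 2) -> d <= M.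
  by move=> M0 /(_ c); rewrite c1 mulr1.
have [dz|dn] := eqVneq d 0.
  exists (0, 0); split => //=.
  - by move=> c'; rewrite -[X in X * _]dz; exact: dmax.
  - by rewrite eqxx (ip0l ipP).
  - rewrite scaler0 /frame_op big1// => i _; by rewrite (ip0l ipP) scale0r.
have sd2 : Num.sqrt d ^+ 2 = d by rewrite sqr_sqrtr.
exists (d, (Num.sqrt d)^-1 *: e); split => //=.
- rewrite (ipZl ipP) (ipZr ipP) (inner_norm ipP) mulrA -expr2 exprVn sd2 dn.
  by rewrite -/d mulVf.
- rewrite scalerA mulrC -scalerA -fe /frame_op scaler_sumr.
  by apply: eq_bigr => i _; rewrite (ipZl ipP) scalerA.
Qed.

Definition deflate a e (i : 'I_N) : H := a i - ip (a i) e *: e.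

Section deflation.
Context (a : 'I_N -> H) (d : R) (e : H).
Hypothesis de : top_pair a (d, e).

Lemma ip_deflate i : ip (deflate a e i) e = 0.
Proof.
case: de => /= _ _ _ ee fe.
rewrite /deflate (ipBl ipP) (ipZl ipP) ee.
have [dz|] := eqVneq d 0; last by rewrite mulr1 subrr.
have -> : e = 0 by apply: (ip_eq0 ipP); rewrite ee dz eqxx.
by rewrite (ip0r ipP) mul0r subrr.
Qed.

(** For [d != 0] the eigenvector equation puts [e] in the span of the [a i]; for [d = 0], [e] is
    zero. Orthogonality to earlier eigenvectors is inherited in this way. *)
Lemma top_pair_perp f : (forall i, ip (a i) f = 0) -> ip e f = 0.
Proof.
case: de => /= _ _ _ ee fe h.
have [dz|dn] := eqVneq d 0.
  by rewrite (_ : e = 0) ?(ip0l ipP)//; apply: (ip_eq0 ipP); rewrite ee dz eqxx.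
apply: (mulfI dn); rewrite mulr0 -(ipZl ipP) -fe frame_op_ip big1// => i _.
by rewrite (inner_sym ipP f) h mulr0.
Qed.

Lemma frame_op_deflate v :
  frame_op (deflate a e) v = frame_op a v - (d * ip v e) *: e.
Proof.
case: de => /= _ _ _ ee fe.
have E : \sum_i ip e (a i) * ip v (a i) = d * ip v e.
  by rewrite -frame_op_ip fe (ipZl ipP) (inner_sym ipP e).
have e2 : d * ip e e = d.
  by rewrite ee; have [->|_] := eqVneq d 0; rewrite ?mul0r ?mulr1.
apply: (ip_ext ipP) => w.
rewrite (ipBl ipP) (ipZl ipP) !frame_op_ip.
have E' : \sum_i ip e (a i) * ip w (a i) = d * ip w e.
  by rewrite -frame_op_ip fe (ipZl ipP) (inner_sym ipP e).
have E2 : \sum_i ip e (a i) * ip e (a i) = d.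
  by rewrite -frame_op_ip fe (ipZl ipP) e2.
transitivity (\sum_i ip v (a i) * ip w (a i)
  - ip w e * (\sum_i ip e (a i) * ip v (a i))
  - ip v e * (\sum_i ip e (a i) * ip w (a i))
  + ip v e * ip w e * (\sum_i ip e (a i) * ip e (a i))).
  rewrite !mulr_sumr -!sumrB -big_split /=; apply: eq_bigr => i _.
  rewrite /deflate !(ipBr ipP) !(ipZr ipP) (inner_sym ipP (a i) e); ring.
rewrite E E' E2 (inner_sym ipP e w); ring.
Qed.

Lemma comb_deflate c : `|comb (deflate a e) c| ^+ 2 <= `|comb a c| ^+ 2.
Proof.
case: de => /= _ _ _ ee fe.
have -> : comb a c = comb (deflate a e) c + (\sum_i c i * ip (a i) e) *: e.
  rewrite /comb scaler_suml -big_split /=; apply: eq_bigr => i _.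
  by rewrite /deflate scalerBr scalerA subrK.
have z : ip (comb (deflate a e) c) e = 0.
  by rewrite comb_ip big1// => i _; rewrite (inner_sym ipP) ip_deflate mulr0.
by rewrite (normD_sqr ipP) (ipZr ipP) z !mulr0 addr0 lerDl sqr_ge0.
Qed.

Lemma trace_deflate :
  \sum_i `|deflate a e i| ^+ 2 = \sum_i `|a i| ^+ 2 - d.
Proof.
case: de => /= _ _ _ ee fe.
have e2 : d * ip e e = d.
  by rewrite ee; have [->|_] := eqVneq d 0; rewrite ?mul0r ?mulr1.
have E2 : \sum_i ip e (a i) * ip e (a i) = d.
  by rewrite -frame_op_ip fe (ipZl ipP) e2.
rewrite -[X in _ = _ - X]E2 -sumrB; apply: eq_bigr => i _.
rewrite -(inner_norm ipP) {2}/deflate (ipBr ipP) (ipZr ipP) ip_deflate mulr0 subr0.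
by rewrite (inner_sym ipP) /deflate (ipBr ipP) (ipZr ipP) (inner_norm ipP) (inner_sym ipP e).
Qed.

End deflation.

Lemma frame_op_le a d e v : top_pair a (d, e) -> `|frame_op a v| <= d * `|v|.
Proof.
move=> [/= d0 h _ _ _].
apply: (norm_le_dual ipP); first by rewrite mulr_ge0.
have h1 : `|frame_op a v| ^+ 2 <= d * (`|frame_op a v| * `|v|).
  apply: le_trans (h (fun i => ip v (a i))) _; rewrite ler_wpM2l//.
  rewrite (_ : \sum_i _ = ip (frame_op a v) v); first exact: (ip_le ipP).
  by rewrite frame_op_ip; apply: eq_bigr => i _; rewrite expr2.
by rewrite (inner_norm ipP); apply: le_trans h1 _; rewrite mulrAC mulrA.
Qed.

(** Repeated deflation. After [n] steps the remainder has norm at most [mu n], and [mu] tends to 0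
    because its partial sums are bounded by the trace [\sum_i |a i|^2]. *)
Lemma frame_op_spectral a : exists mu e, spectral_decomposition ip (frame_op a) mu e.
Proof.
have [step hstep] := choice top_pair_exists.
pose fix st k := if k is k'.+1 then deflate (st k') (step (st k')).2 else a.
pose mu k := (step (st k)).1; pose e k := (step (st k)).2.
have hs k : top_pair (st k) (mu k, e k).
  by rewrite /mu /e -surjective_pairing.
have mu0 k : 0 <= mu k by case: (hs k).
have perp k l : (k < l)%N -> forall i, ip (st l i) (e k) = 0.
  elim: l => // l IH; rewrite ltnS leq_eqVlt => /predU1P[-> i|kl i].
    exact: (ip_deflate (hs l)).
  rewrite /= /deflate (ipBl ipP) (ipZl ipP) IH// sub0r.
  by rewrite (top_pair_perp (hs l) (IH kl)) mulr0 oppr0.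
have eperp k l : (k < l)%N -> ip (e l) (e k) = 0.
  by move=> kl; apply: (top_pair_perp (hs l)) => i; exact: perp.
exists mu, e; split.
- move=> k; rewrite mu0 /=; case: (hs k.+1) => /= _ _ h _ _; apply: h => // c.
  by apply: le_trans (comb_deflate (hs k) c) _; case: (hs k).
- move=> i j; have [ij|ij|->] := ltngtP i j.
  + by rewrite /= (inner_sym ipP) eperp.
  + by rewrite /= eperp.
  + by case: (hs j).
move=> v.
have dec n : frame_op a v = series (fun j => (mu j * ip v (e j)) *: e j) n + frame_op (st n) v.
  elim: n => [|n ->]; first by rewrite /series /= big_geq// add0r.
  by rewrite /= (frame_op_deflate (hs n)) seriesSr -addrA; congr (_ + _); rewrite addrC subrK.
have tr n : series mu n = \sum_i `|a i| ^+ 2 - \sum_i `|st n i| ^+ 2.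
  elim: n => [|n IH]; first by rewrite /series /= big_geq// subrr.
  by rewrite seriesSr IH /= (trace_deflate (hs n)); ring.
have cmu : mu @ \oo --> 0.
  apply: cvg_series_cvg_0; apply: nondecreasing_is_cvgn.
    by apply: nondecreasing_series => k _ _; exact: mu0.
  exists (\sum_i `|a i| ^+ 2) => _ [n _ <-].
  by rewrite tr lerBlDr lerDl sumr_ge0// => i _; exact: sqr_ge0.
apply/cvgrPdist_le => eps eps0.
have ep : 0 < eps / (`|v| + 1) by rewrite divr_gt0// ltr_wpDl.
have /cvgrPdist_le/(_ _ ep) h := cmu.
near=> n.
rewrite {1}(dec n) addrAC subrr add0r.
apply: le_trans (frame_op_le v (hs n)) _.
apply: (@le_trans _ _ (mu n * (`|v| + 1))); first by rewrite ler_wpM2l// lerDl.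
rewrite -ler_pdivlMr ?ltr_wpDl//.
have : `|0 - mu n| <= eps / (`|v| + 1) by near: n.
by rewrite sub0r normrN ger0_norm.
Unshelve. all: by end_near. Qed.

End finite_rank.

(** * Moments of sums of independent vectors *)

Section iid.
Context d (T : measurableType d) (R : realType) (rho : probability T R).
Local Open Scope ereal_scope.

(** Tonelli with the new observation innermost: the others are then fixed, as [moment_step]
    requires. *)
Lemma iid_law_integralS n (f : n.+1.-tuple T -> \bar R) :
  measurable_fun setT f -> (forall D, 0 <= f D) ->
  \int[iid_law rho n.+1]_D f D =
  \int[iid_law rho n]_D \int[rho]_z f (tuple_cons (z, D)).
Proof.
move=> mf f0 /=; rewrite ge0_integral_distribution//.
rewrite (fubini_tonelli2 (f \o @tuple_cons _ T n))//.
  by apply: measurableT_comp => //; exact: measurable_tuple_cons.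
by move=> x; exact: f0.
Qed.

Lemma iid_law0 (f : 0.-tuple T -> \bar R) : measurable_fun setT f ->
  \int[iid_law rho 0]_D f D = f [tuple].
Proof. by move=> mf /=; rewrite integral_dirac// diracT mul1e. Qed.

Lemma bounded_integrable (f : T -> R) (M : R) : measurable_fun setT f ->
  (forall z, (`|f z| <= M)%R) -> rho.-integrable setT (EFin \o f).
Proof.
move=> mf hM; apply: measurable_bounded_integrable => //.
  by apply: le_lt_trans (probability_le1 rho _) _ => //; exact: ltry.
exists M; split; first by rewrite num_real.
by move=> x xM z _ /=; apply: le_trans (hM z) (ltW xM).
Qed.

End iid.

Lemma integral_cst_probability d (T : measurableType d) (R : realType)
    (rho : probability T R) (a : R) : (\int[rho]_z a%:E = a%:E)%E.
Proof. by rewrite integral_cst// -[X in (_ * X)%E]/(rho setT) (probability_setT rho) mule1. Qed.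

Section moment.
Context (R : realType).

(** The recursion is the one that closes the induction in [binom_le], where a further factor
    [a + 2 b + c] creates cross terms. *)
Fixpoint binom_const k : R :=
  if k is k'.+1 then 1 + 6 * k.+1%:R + 6 * binom_const k' else 1.

Lemma binom_const_ge1 k : 1 <= binom_const k.
Proof.
elim: k => //= k IH; rewrite -addrA lerDl addr_ge0 ?mulr_ge0//.
by apply: le_trans IH.
Qed.

(* The second-order term in [b] is absorbed thanks to [b ^ 2 <= a c]; only the
   linear term, which has mean zero in the application, keeps its sign. *)
Lemma binom_le k (a b c : R) : 0 <= a -> 0 <= c -> b ^+ 2 <= a * c ->
  (a + 2 * b + c) ^+ k.+1 <=
  a ^+ k.+1 + 2 * k.+1%:R * a ^+ k * b + binom_const k * (a ^+ k * c + c ^+ k.+1).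
Proof.
move=> a0 c0 bac.
have bl : `|b| <= (a + c) / 2.
  rewrite -(@ler_pXn2r _ 2) ?nnegrE ?divr_ge0 ?addr_ge0// -normrX ger0_norm ?sqr_ge0//.
  apply: le_trans bac _; rewrite expr_div_n.
  have := sqr_ge0 (a - c); rewrite -natrX; lra.
have b1 : b <= (a + c) / 2 by apply: le_trans bl; exact: ler_norm.
have b2 : - b <= (a + c) / 2 by apply: le_trans bl; rewrite -normrN ler_norm.
have x0 : 0 <= a + 2 * b + c by lra.
have x1 : a + 2 * b + c <= 2 * (a + c) by lra.
(* Intermediate monomials are interpolated between the two extreme ones, according to which of [a]
   and [c] is larger. *)
have mixed (i j : nat) : a ^+ i.+1 * c ^+ j.+1 <= a ^+ (i + j).+1 * c + c ^+ (i + j).+2.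
  have [ac|ac] := leP a c.
    apply: (@le_trans _ _ (c ^+ (i + j).+2)).
      rewrite -addSn -addnS exprD ler_wpM2r ?exprn_ge0//.
      by rewrite lerXn2r ?nnegrE.
    by rewrite lerDr mulr_ge0// exprn_ge0.
  apply: (@le_trans _ _ (a ^+ (i + j).+1 * c)).
    rewrite (exprSr c) mulrA ler_wpM2r// -addSn exprD ler_wpM2l ?exprn_ge0//.
    by rewrite lerXn2r ?nnegrE ?(ltW ac).
  by rewrite lerDl exprn_ge0.
elim: k => [|k IH].
  rewrite !expr1 !expr0 /=; lra.
set n := k.+1 in IH *.
have e0 : 0 <= a ^+ k * c + c ^+ n by rewrite addr_ge0 ?mulr_ge0 ?exprn_ge0.
rewrite exprSr; apply: (@le_trans _ _
  ((a ^+ n + 2 * n%:R * a ^+ k * b + binom_const k * (a ^+ k * c + c ^+ n))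
   * (a + 2 * b + c))); first exact: ler_wpM2r.
have ak : a ^+ n = a ^+ k * a by rewrite /n exprSr.
have ann : a ^+ n.+1 = a ^+ k * a * a by rewrite exprSr ak.
have cn : c ^+ n.+1 = c ^+ n * c by rewrite exprSr.
have cn0 : 0 <= c ^+ n by rewrite exprn_ge0.
have ak0 : 0 <= a ^+ k by rewrite exprn_ge0.
have n0 : (0 : R) <= n%:R by [].
have C1 := binom_const_ge1 k.
have m1 : a ^+ k * c * c <= a ^+ k * a * c + c ^+ n * c.
  have := mixed k 0%N; rewrite addn0 expr1 => h.
  have [ac|ac] := leP a c.
    have : a ^+ k * c * c <= c ^+ n * c.
      by rewrite ler_wpM2r// /n exprSr ler_wpM2r// lerXn2r ?nnegrE.
    have : 0 <= a ^+ k * a * c by rewrite !mulr_ge0.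
    lra.
  have : a ^+ k * c * c <= a ^+ k * a * c by rewrite ler_wpM2r// ler_wpM2l// ltW.
  have : 0 <= c ^+ n * c by rewrite mulr_ge0.
  lra.
have m2 : a * c ^+ n <= a ^+ k * a * c + c ^+ n * c.
  by have := mixed 0%N k; rewrite add0n expr1 -/n ak cn.
have s1 : a ^+ k * b ^+ 2 <= a ^+ k * (a * c) by rewrite ler_wpM2l.
have s2 : a ^+ k * c * b <= a ^+ k * c * ((a + c) / 2) by rewrite ler_wpM2l ?mulr_ge0.
have s3 : (a ^+ k * c + c ^+ n) * (a + 2 * b + c) <=
          (a ^+ k * c + c ^+ n) * (2 * (a + c)) by rewrite ler_wpM2l.
have s1' : n%:R * (a ^+ k * b ^+ 2) <= n%:R * (a ^+ k * (a * c)) by rewrite ler_wpM2l.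
have s2' : n%:R * (a ^+ k * c * b) <= n%:R * (a ^+ k * c * ((a + c) / 2)) by rewrite ler_wpM2l.
have s3' : binom_const k * ((a ^+ k * c + c ^+ n) * (a + 2 * b + c)) <=
  binom_const k * ((a ^+ k * c + c ^+ n) * (2 * (a + c))).
  by rewrite ler_wpM2l// (le_trans ler01).
have m1' : n%:R * (a ^+ k * c * c) <= n%:R * (a ^+ k * a * c + c ^+ n * c) by rewrite ler_wpM2l.
have m1'' : binom_const k * (a ^+ k * c * c) <= binom_const k * (a ^+ k * a * c + c ^+ n * c).
  by rewrite ler_wpM2l// (le_trans ler01).
have m2'' : binom_const k * (a * c ^+ n) <= binom_const k * (a ^+ k * a * c + c ^+ n * c).
  by rewrite ler_wpM2l// (le_trans ler01).
have p1 : 0 <= n%:R * (c ^+ n * c) by rewrite !mulr_ge0.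
have p2 : 0 <= n%:R * (a ^+ k * a * c) by rewrite !mulr_ge0.
have p3 : 0 <= c ^+ n * c by rewrite mulr_ge0.
have p4 : 0 <= binom_const k * (a ^+ k * a * c) by rewrite !mulr_ge0// (le_trans ler01).
have p5 : 0 <= binom_const k * (c ^+ n * c) by rewrite !mulr_ge0// (le_trans ler01).
have p6 : 0 <= a ^+ k * a * c by rewrite !mulr_ge0.
rewrite [binom_const n]/= ann cn ak -(natr1 n).
move: s1' s2' s3' m1' m1'' m2'' p1 p2 p3 p4 p5 p6.
set B := binom_const k; set N := n%:R; set A := a ^+ k; set C := c ^+ n.
nra.
Qed.

End moment.

(* The integral of a nonnegative function is defined as a supremum over simple
   functions, so that monotonicity needs no measurability. *)
Lemma ge0_integral_mono d (T : measurableType d) (R : realType)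
    (mu : {measure set T -> \bar R}) (f g : T -> \bar R) :
  (forall x, 0 <= f x)%E -> (forall x, f x <= g x)%E ->
  (\int[mu]_x f x <= \int[mu]_x g x)%E.
Proof.
move=> f0 fg; rewrite !ge0_integralTE//; last by move=> x; exact: le_trans (fg x).
apply: ereal_sup_le => _ [h /= hf <-]; exists h => //= x.
exact: le_trans (fg x).
Qed.

Lemma sum_cauchy_schwarz (R : realType) (I : finType) (x y : I -> R) :
  (\sum_i x i * y i) ^+ 2 <= (\sum_i x i ^+ 2) * (\sum_i y i ^+ 2).
Proof.
set b := \sum_i x i * y i; set A := \sum_i x i ^+ 2; set C := \sum_i y i ^+ 2.
have A0 : 0 <= A by apply: sumr_ge0 => i _; exact: sqr_ge0.
have [Az|An] := eqVneq A 0.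
  suff -> : b = 0 by rewrite Az mul0r expr0n.
  rewrite /b big1// => i _; move/eqP: Az; rewrite psumr_eq0; last first.
    by move=> ? _; exact: sqr_ge0.
  move/allP => /(_ i); rewrite mem_index_enum => /(_ isT) /=.
  by rewrite sqrf_eq0 => /eqP ->; rewrite mul0r.
have Ap : 0 < A by rewrite lt_def An.
have : 0 <= \sum_i (A * y i - b * x i) ^+ 2 by apply: sumr_ge0 => i _; exact: sqr_ge0.
have -> : \sum_i (A * y i - b * x i) ^+ 2 =
    A ^+ 2 * C - 2 * A * b * (\sum_i x i * y i) + b ^+ 2 * A.
  rewrite [b ^+ 2 * A]mulr_sumr [A ^+ 2 * C]mulr_sumr [2 * A * b * _]mulr_sumr.
  by rewrite -sumrB -big_split /=; apply: eq_bigr => i _; ring.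
rewrite -/b => h.
have {}h : 0 <= A * (A * C - b ^+ 2) by move: h; lra.
by move: h; rewrite pmulr_rge0// subr_ge0.
Qed.

Section moment_iid.
Context d (T : measurableType d) (R : realType) (rho : probability T R).
Context (I : finType) (xi : I -> T -> R) (B2 sig2 : R).
Hypothesis mxi : forall i, measurable_fun setT (xi i).
Hypothesis B2_ge0 : 0 <= B2.
Hypothesis sig2_ge0 : 0 <= sig2.
Hypothesis xi_bnd : forall z, \sum_i xi i z ^+ 2 <= B2.
Hypothesis xi_mean : forall i, (\int[rho]_z (xi i z)%:E = 0)%E.
Hypothesis xi_var : (\int[rho]_z (\sum_i xi i z ^+ 2)%:E <= sig2%:E)%E.

Let xi_bnd1 i z : `|xi i z| <= B2 + 1.
Proof.
have h : xi i z ^+ 2 <= B2.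
  apply: le_trans (xi_bnd z); rewrite (bigD1 i)//= lerDl sumr_ge0// => j _.
  exact: sqr_ge0.
rewrite ler_norml; have := sqr_ge0 (xi i z - 1); have := sqr_ge0 (xi i z + 1).
by move: h => ? ? ?; apply/andP; split; nra.
Qed.

(* The linear term of [binom_le] integrates to zero. *)
Lemma moment_step k (s : I -> R) :
  (\int[rho]_z ((\sum_i (s i + xi i z) ^+ 2) ^+ k.+1)%:E <=
   ((\sum_i s i ^+ 2) ^+ k.+1 +
     binom_const R k * sig2 * ((\sum_i s i ^+ 2) ^+ k + B2 ^+ k))%:E)%E.
Proof.
set A := \sum_i s i ^+ 2.
have A0 : 0 <= A by apply: sumr_ge0 => i _; exact: sqr_ge0.
pose q z := \sum_i xi i z ^+ 2.
have q0 z : 0 <= q z by apply: sumr_ge0 => i _; exact: sqr_ge0.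
pose c1 := 2 * k.+1%:R * A ^+ k; pose c2 := binom_const R k * (A ^+ k + B2 ^+ k).
have C1 : 0 <= binom_const R k by apply: le_trans (binom_const_ge1 _ k).
have c20 : 0 <= c2 by rewrite mulr_ge0// addr_ge0 ?exprn_ge0.
have mq : measurable_fun setT q.
  by apply: measurable_sum => i; exact: measurable_funX.
have pw z : (\sum_i (s i + xi i z) ^+ 2) ^+ k.+1 <=
    A ^+ k.+1 + \sum_i c1 * s i * xi i z + c2 * q z.
  have -> : \sum_i (s i + xi i z) ^+ 2 = A + 2 * (\sum_i s i * xi i z) + q z.
    by rewrite /A /q mulr_sumr -!big_split /=; apply: eq_bigr => i _; ring.
  apply: le_trans (binom_le k A0 (q0 z) (sum_cauchy_schwarz _ _)) _.
  apply: lerD.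
    rewrite lerD2l mulr_sumr le_eqVlt; apply/orP; left; apply/eqP.
    by apply: eq_bigr => i _; rewrite mulrA.
  rewrite /c2 -mulrA ler_wpM2l// mulrDl lerD2l exprSr ler_wpM2r//.
  by rewrite lerXn2r ?nnegrE//; exact: xi_bnd.
have ixi i : rho.-integrable setT (EFin \o xi i).
  exact: (bounded_integrable _ (mxi i) (xi_bnd1 i)).
have ics i : rho.-integrable setT (fun z => ((c1 * s i)%:E * (xi i z)%:E)%E).
  by apply: integrableZl => //; exact: ixi.
have iq : rho.-integrable setT (fun z => (q z)%:E).
  apply: (bounded_integrable _ mq (M := B2)) => z.
  by rewrite ger0_norm//; exact: xi_bnd.
have icq : rho.-integrable setT (fun z => (c2%:E * (q z)%:E)%E).
  exact: integrableZl.
have icst : rho.-integrable setT (fun=> (A ^+ k.+1)%:E).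
  exact: finite_measure_integrable_cst.
have isum : rho.-integrable setT (fun z => (\sum_i (c1 * s i)%:E * (xi i z)%:E)%E).
  exact: integrable_sum.
apply: (@le_trans _ _ (\int[rho]_z ((A ^+ k.+1)%:E +
    (\sum_i (c1 * s i)%:E * (xi i z)%:E) + c2%:E * (q z)%:E))%E).
  apply: ge0_integral_mono => z.
    by rewrite lee_fin exprn_ge0// sumr_ge0// => i _; exact: sqr_ge0.
  have -> : (\sum_i (c1 * s i)%:E * (xi i z)%:E = (\sum_i c1 * s i * xi i z)%:E)%E.
    by rewrite -sumEFin; apply: eq_bigr => i _; rewrite EFinM.
  rewrite -EFinM -!EFinD lee_fin.
  exact: pw.
rewrite integralD//; last exact: integrableD.
rewrite integralD// integral_sum// integral_cst_probability.
rewrite big1 ?adde0; last first.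
  by move=> i _; rewrite integralZl ?xi_mean ?mule0//; exact: ixi.
rewrite integralZl// EFinD leeD2l//.
apply: (@le_trans _ _ (c2%:E * sig2%:E)%E).
  by apply: lee_wpmul2l => //; rewrite lee_fin.
by rewrite -EFinM lee_fin /c2 mulrAC.
Qed.

(** The boolean weights select one block, while the law remains that of the whole sample; no
    marginal law of a subsample has to be identified. *)
Definition wsum n (w : 'I_n -> bool) (D : n.-tuple T) i : R :=
  \sum_(t < n) (w t)%:R * xi i (tnth D t).

Lemma measurable_wsum_sqr n (w : 'I_n -> bool) k :
  measurable_fun [set: n.-tuple T] (fun D => (\sum_i wsum w D i ^+ 2) ^+ k).
Proof.
apply: measurable_funX; apply: measurable_sum => i; apply: measurable_funX.
apply: measurable_sum => t; apply: measurable_funM => //.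
by apply: measurableT_comp => //; exact: measurable_tnth.
Qed.

Fixpoint moment_const k : R :=
  if k is k'.+1 then binom_const R k' * (moment_const k' + 1) else 1.

Lemma moment_const_ge0 k : 0 <= moment_const k.
Proof.
elim: k => //= k IH; rewrite mulr_ge0 ?addr_ge0//.
exact: le_trans (binom_const_ge1 _ k).
Qed.

Lemma wsumS n (w : 'I_n.+1 -> bool) z D i :
  wsum w (tuple_cons (z, D)) i =
  (w ord0)%:R * xi i z + wsum (fun t => w (lift ord0 t)) D i.
Proof.
rewrite /wsum big_ord_recl; congr (_ + _); apply: eq_bigr => t _.
by congr (_ * xi i _); rewrite (tnth_nth z) /= (tnth_nth z).
Qed.

(** A Rosenthal-type bound whose constant does not depend on the size of [I]: [V] dominates the
    total variance plus the squared sup bound. The induction is on [k], with an inner one on [n]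
    that adds one observation by [moment_step]. *)
Lemma moment_le k n (w : 'I_n -> bool) (V : R) :
  (\sum_t (w t)%:R) * sig2 + B2 <= V ->
  (\int[iid_law rho n]_D ((\sum_i wsum w D i ^+ 2) ^+ k)%:E <=
   (moment_const k * V ^+ k)%:E)%E.
Proof.
elim: k n w V => [|k IH] n w V wV.
  under eq_integral do rewrite expr0.
  by rewrite integral_cst//= probability_setT mule1 lee_fin mulr1.
have sum0 n' (w' : 'I_n' -> bool) : 0 <= \sum_t (w' t)%:R :> R by exact: sumr_ge0.
have V0 : 0 <= V by apply: le_trans wV; rewrite addr_ge0 ?mulr_ge0.
have C0 : 0 <= binom_const R k by apply: le_trans (binom_const_ge1 _ k).
have M0 := moment_const_ge0 k.
have BV : B2 <= V by apply: le_trans wV; rewrite lerDr mulr_ge0.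
pose c := binom_const R k * sig2.
have c0 : 0 <= c by rewrite mulr_ge0.
(* This form is linear in the number of selected observations, so that each of them adds one
   increment while [V] stays fixed. *)
suff : (\int[iid_law rho n]_D ((\sum_i wsum w D i ^+ 2) ^+ k.+1)%:E <=
   ((\sum_t (w t)%:R) * (c * (moment_const k + 1) * V ^+ k))%:E)%E.
  move/le_trans; apply; rewrite lee_fin /= /c exprSr.
  have -> : (\sum_t (w t)%:R) * (binom_const R k * sig2 * (moment_const k + 1) * V ^+ k)
    = (binom_const R k * (moment_const k + 1) * V ^+ k) * ((\sum_t (w t)%:R) * sig2) by ring.
  rewrite [leRHS]mulrA ler_wpM2l ?mulr_ge0 ?exprn_ge0 ?addr_ge0//.
  by apply: le_trans wV; rewrite lerDl.
elim: n w wV => [|n IHn] w wV.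
  rewrite iid_law0; last by apply/measurable_EFinP; exact: measurable_wsum_sqr.
  rewrite lee_fin big_ord0 mul0r big1 ?expr0n// => i _.
  by rewrite /wsum big_ord0 expr0n.
rewrite iid_law_integralS; last 2 first.
- by apply/measurable_EFinP; exact: measurable_wsum_sqr.
- by move=> D; rewrite lee_fin exprn_ge0// sumr_ge0// => i _; exact: sqr_ge0.
pose w' t := w (lift ord0 t).
have w'V : (\sum_t (w' t)%:R) * sig2 + B2 <= V.
  apply: le_trans wV; rewrite big_ord_recl lerD2r ler_wpM2r//.
  by rewrite lerDr.
pose a D := \sum_i wsum w' D i ^+ 2.
have a0 D : 0 <= a D by apply: sumr_ge0 => i _; exact: sqr_ge0.
have ma j : measurable_fun [set: n.-tuple T] (fun D => a D ^+ j).
  exact: measurable_wsum_sqr.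
under eq_integral do under eq_integral do under eq_bigr do rewrite wsumS.
rewrite big_ord_recl mulrDl.
case: (w ord0); last first.
  rewrite mul0r add0r; apply: le_trans (IHn w' w'V).
  apply: ge0_integral_mono => D.
    by apply: integral_ge0 => z _; rewrite lee_fin exprn_ge0// sumr_ge0// => i _; exact: sqr_ge0.
  under eq_integral do under eq_bigr do rewrite mul0r add0r.
  by rewrite integral_cst_probability.
apply: (@le_trans _ _ (\int[iid_law rho n]_D ((a D ^+ k.+1)%:E +
     (c%:E * ((a D ^+ k)%:E + (B2 ^+ k)%:E))))%E).
  apply: ge0_integral_mono => D.
    by apply: integral_ge0 => z _; rewrite lee_fin exprn_ge0// sumr_ge0// => i _; exact: sqr_ge0.
  under eq_integral do under eq_bigr do rewrite mul1r addrC.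
  exact: moment_step.
rewrite ge0_integralD//; last 4 first.
- by move=> D _; rewrite lee_fin exprn_ge0.
- by apply/measurable_EFinP; exact: ma.
- by move=> D _; rewrite mule_ge0 ?adde_ge0 ?lee_fin ?exprn_ge0.
- apply: measurable_funeM; apply: emeasurable_funD => //.
  by apply/measurable_EFinP; exact: ma.
rewrite ge0_integralZl//; last 2 first.
- by apply: emeasurable_funD => //; apply/measurable_EFinP; exact: ma.
- by move=> D _; rewrite adde_ge0 ?lee_fin ?exprn_ge0.
rewrite ge0_integralD//; last 3 first.
- by move=> D _; rewrite lee_fin exprn_ge0.
- by apply/measurable_EFinP; exact: ma.
- by move=> D _; rewrite lee_fin exprn_ge0.
rewrite integral_cst_probability [leRHS]EFinD addeC.
apply: leeD; last exact: IHn.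
apply: (@le_trans _ _ (c%:E * ((moment_const k * V ^+ k)%:E + (B2 ^+ k)%:E))%E).
  by apply: lee_wpmul2l; rewrite ?lee_fin// leeD2r//; exact: IH.
rewrite -EFinD -EFinM lee_fin mul1r -mulrA ler_wpM2l// mulrDl mul1r lerD2l.
by rewrite lerXn2r ?nnegrE.
Qed.

End moment_iid.

(** * The covariance operator *)

Section operator_norm.
Context (R : realType) (H : completeNormedModType R).

Lemma opnorm_ge (F : H -> H) v : `|v| <= 1 -> ((`|F v|)%:E <= opnorm F)%E.
Proof. by move=> v1; apply: ereal_sup_ubound; exists v. Qed.

End operator_norm.

Section covariance.
Context (R : realType) d (X : measurableType d) (K : X -> X -> R) (kappa : R).
Context (H : completeNormedModType R) (HK : rkhs K H).
Hypothesis kappa_gt0 : 0 < kappa.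
Hypothesis K_bounded : forall x, K x x <= kappa ^+ 2.
Hypothesis H_measurable : forall f : H, measurable_fun setT (ev HK f).

Lemma rkhs_inner : is_inner (ip HK).
Proof.
by split; [exact: (ip_linear HK)|exact: (ip_sym HK)|exact: (ip_norm HK)].
Qed.
Let hP := rkhs_inner.

Lemma feat_norm_le x : `|feat HK x| <= kappa.
Proof.
rewrite -(@ler_pXn2r _ 2) ?nnegrE ?(ltW kappa_gt0)//.
by rewrite -(inner_norm hP) -(ev_ip HK) (ev_feat HK).
Qed.

Lemma ev_le f x : `|ev HK f x| <= `|f| * kappa.
Proof.
rewrite (ev_ip HK); apply: le_trans (cauchy_schwarz hP _ _) _.
by rewrite ler_wpM2l// feat_norm_le.
Qed.

Lemma ip_feat_op x u v : ip HK (feat_op HK x u) v = ev HK u x * ev HK v x.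
Proof.
by rewrite /feat_op (ipZl hP) !(ev_ip HK) (inner_sym hP v).
Qed.

Context (nu : probability X R).

Lemma integrable_evM u v :
  nu.-integrable setT (EFin \o (fun x => ev HK u x * ev HK v x)).
Proof.
apply: (bounded_integrable nu (M := (`|u| * kappa) * (`|v| * kappa))).
  by apply: measurable_funM; exact: H_measurable.
by move=> x; rewrite normrM ler_pM// ev_le.
Qed.

Definition ev_int u v : R := fine (\int[nu]_x (ev HK u x * ev HK v x)%:E)%E.

Lemma ev_intE u v : (\int[nu]_x (ev HK u x * ev HK v x)%:E = (ev_int u v)%:E)%E.
Proof.
by rewrite fineK// integrable_fin_num//; exact: integrable_evM.
Qed.

Section bochner.
Context (I : H -> H).
Hypothesis hI : is_bochner_integral nu (feat_op HK) I.

(** The identity is exact for simple functions; on the unit ball the two errors are bounded by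
    operator distances that tend to 0. *)
Lemma bochner_weak1 u v : `|u| <= 1 -> `|v| <= 1 -> ip HK (I u) v = ev_int u v.
Proof.
move=> u1 v1; case: hI => _ [S [_ hS hI2]].
pose sk k x := ip HK (so_eval (S k) x u) v.
pose ck k (i : 'I_(so_size (S k))) := ip HK (so_val (s := S k) i u) v.
have skE k x : sk k x = \sum_i ck k i * \1_(so_set (s := S k) i) x.
  rewrite /sk /so_eval (ip_suml hP); apply: eq_bigr => i _.
  by rewrite (ipZl hP) mulrC.
have mset k i : measurable (so_set (s := S k) i) by exact: so_measurable.
have iind k i : nu.-integrable setT (fun x => (\1_(so_set (s := S k) i) x)%:E).
  exact: integrable_indic.
have iZ k i : nu.-integrable setT
    (fun x => ((ck k i)%:E * (\1_(so_set (s := S k) i) x)%:E)%E).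
  exact: integrableZl.
have skE' k : (fun x => (sk k x)%:E) =
    (fun x => \sum_i (ck k i)%:E * (\1_(so_set (s := S k) i) x)%:E)%E.
  apply/funext => x; rewrite skE -sumEFin; apply: eq_bigr => i _.
  by rewrite EFinM.
have isk k : nu.-integrable setT (fun x => (sk k x)%:E).
  by rewrite skE'; exact: integrable_sum.
have intsk k : (\int[nu]_x (sk k x)%:E = (ip HK (so_integral nu (S k) u) v)%:E)%E.
  rewrite skE' integral_sum// /so_integral (ip_suml hP) -sumEFin.
  apply: eq_bigr => i _; rewrite integralZl// integral_indic// setIT.
  rewrite (ipZl hP) EFinM fineK ?fin_num_measure// muleC.
  by [].
have bnd k : ((`|ip HK (I u) v - ev_int u v|)%:E <=
    opdist I (so_integral nu (S k)) +
    \int[nu]_x opdist (feat_op HK x) (so_eval (S k) x))%E.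
  have -> : ip HK (I u) v - ev_int u v = ip HK (I u - so_integral nu (S k) u) v +
      (ip HK (so_integral nu (S k) u) v - ev_int u v).
    by rewrite (ipBl hP); ring.
  apply: (@le_trans _ _ ((`|ip HK (I u - so_integral nu (S k) u) v|)%:E +
      (`|ip HK (so_integral nu (S k) u) v - ev_int u v|)%:E)%E).
    by rewrite -EFinD lee_fin ler_normD.
  apply: leeD.
    apply: le_trans (opnorm_ge (fun w => I w - so_integral nu (S k) w) u1).
    rewrite lee_fin; apply: le_trans (cauchy_schwarz hP _ _) _.
    by rewrite -[leRHS]mulr1 ler_wpM2l.
  have -> : ((`|ip HK (so_integral nu (S k) u) v - ev_int u v|)%:E =
      `| \int[nu]_x ((sk k x)%:E - (ev HK u x * ev HK v x)%:E) |)%E.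
    rewrite integralB//; last exact: integrable_evM.
    by rewrite intsk ev_intE -EFinB.
  apply: le_trans (le_abse_integral _ _ _) _ => //.
    apply: emeasurable_funB; first by case/integrableP : (isk k).
    by have /integrableP[] := integrable_evM u v.
  apply: ge0_integral_mono => x; first exact: abse_ge0.
  rewrite -EFinB abse_EFin.
  apply: le_trans (opnorm_ge (fun w => feat_op HK x w - so_eval (S k) x w) u1).
  rewrite lee_fin -ip_feat_op /sk -(ipBl hP) [leRHS]distrC.
  apply: le_trans (cauchy_schwarz hP _ _) _.
  by rewrite -[leRHS]mulr1 ler_wpM2l.
have : ((`|ip HK (I u) v - ev_int u v|)%:E <= 0 + 0)%E.
  apply: (@cvge_ge _ \oo _ _ (fun k => opdist I (so_integral nu (S k)) +
    \int[nu]_x opdist (feat_op HK x) (so_eval (S k) x))%E).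
    by apply: nearW => k; exact: bnd.
  exact: cvgeD.
by rewrite adde0 lee_fin normr_le0 subr_eq0 => /eqP.
Qed.

Lemma bochner_weak u v : ip HK (I u) v = ev_int u v.
Proof.
(* Dividing by [|w| + 1] rather than [|w|] reaches the unit ball without excluding [w = 0]. *)
have norm1 (w : H) : exists2 w', `|w'| <= 1 & w = (`|w| + 1) *: w'.
  exists ((`|w| + 1)^-1 *: w).
    rewrite normrZ ger0_norm ?invr_ge0 ?addr_ge0// mulrC ler_pdivrMr ?ltr_wpDl//.
    by rewrite mul1r lerDl.
  by rewrite scalerA divff ?scale1r// gt_eqF// ltr_wpDl.
have [u' u'1 ->] := norm1 u; have [v' v'1 ->] := norm1 v.
set a := `|u| + 1; set b := `|v| + 1.
have -> : I (a *: u') = a *: I u'.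
  case: hI => [[lin _] _]; have I0 : I 0 = 0.
    by have := lin (-1) 0 0; rewrite scaler0 addr0 scaleN1r addNr.
  by have := lin a u' 0; rewrite I0 !addr0.
rewrite (ipZl hP) (ipZr hP) bochner_weak1//.
have evZ c w x : ev HK (c *: w) x = c * ev HK w x.
  by rewrite !(ev_ip HK) (ipZl hP).
apply: EFin_inj; rewrite !EFinM -!ev_intE.
transitivity (\int[nu]_x ((a * b)%:E * (ev HK u' x * ev HK v' x)%:E))%E.
  by rewrite integralZl ?EFinM ?muleA//; exact: integrable_evM.
by apply: eq_integral => x _; rewrite !evZ -EFinM; congr (_%:E); ring.
Qed.

Context (mu : nat -> R) (e : nat -> H) (T : H -> H).
Hypothesis TI : forall v, T v = (kappa ^+ 2)^-1 *: I v.
Hypothesis sd : spectral_decomposition (ip HK) T mu e.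

Let k2_gt0 : 0 < kappa ^+ 2. Proof. exact: exprn_gt0. Qed.

Lemma cov_op_ip u v : ip HK (T u) v = (kappa ^+ 2)^-1 * ev_int u v.
Proof. by rewrite TI (ipZl hP) bochner_weak. Qed.

Lemma cov_op_le v : ip HK (T v) v <= `|v| ^+ 2.
Proof.
rewrite cov_op_ip mulrC ler_pdivrMr// -lee_fin -ev_intE.
rewrite -(integral_cst_probability nu (`|v| ^+ 2 * kappa ^+ 2)).
apply: ge0_integral_mono => x; rewrite lee_fin; first exact: sqr_ge0.
rewrite -expr2 -exprMn -[leLHS]ger0_norm ?sqr_ge0// normrX.
by rewrite ler_pXn2r ?nnegrE ?mulr_ge0 ?(ltW kappa_gt0)// ev_le.
Qed.

Lemma cov_mu_le1 j : mu j <= 1.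
Proof. exact: (sd_mu_le1 hP sd cov_op_le). Qed.

Local Notation P0 := (kproj (ip HK) mu e).

(** [T] annihilates [P0 v], so the integral of the square of the function [P0 v] vanishes. *)
Lemma ae_perp v : {ae nu, forall x, ip HK (P0 v) (feat HK x) = 0}.
Proof.
have h : (\int[nu]_x `|(ev HK (P0 v) x * ev HK (P0 v) x)%:E| = 0)%E.
  under eq_integral => x _ do rewrite gee0_abs ?lee_fin ?sqr_ge0//.
  rewrite ev_intE.
  have := cov_op_ip (P0 v) (P0 v).
  rewrite (sd_kproj hP sd cov_mu_le1) (ip0l hP) => /esym/eqP.
  by rewrite mulf_eq0 invr_eq0 (gt_eqF k2_gt0) /= => /eqP ->.
have mf : measurable_fun setT (fun x => (ev HK (P0 v) x * ev HK (P0 v) x)%:E).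
  by have /integrableP[] := integrable_evM (P0 v) (P0 v).
have /(_ h) := (ae_eq_integral_abs nu measurableT mf).1.
apply: filterS => x /(_ Logic.I) [] /eqP.
by rewrite mulf_eq0 orbb -(ev_ip HK) => /eqP.
Qed.

(* [ae_perp] gives a null set depending on [v]. The approximating simple functions
   take countably many values, so that countably many [v] of the form [feat y]
   suffice to approximate every [feat_op x]. *)
Lemma ae_feat_range : {ae nu, forall x, P0 (feat HK x) = 0}.
Proof.
have mu1 := cov_mu_le1.
case: hI => _ [S [hS _ _]].
(* [pat k x] records which sets of [S k] contain [x]. [S k] is constant on a pattern, and there are
   only countably many triples of index, pattern and precision. *)
pose pat k x : seq bool := [seq `[< so_set (s := S k) i x >] | i <- enum 'I_(so_size (S k))].
have patE k x y : pat k x = pat k y -> so_eval (S k) x = so_eval (S k) y.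
  move=> /eq_in_map h; apply/funext => w; apply: eq_bigr => i _.
  rewrite !indicE; congr (_%:R *: _).
  have hi : `[< so_set (s := S k) i x >] = `[< so_set (s := S k) i y >].
    exact: (h i (mem_enum _ _)).
  congr nat_of_bool; apply/idP/idP; rewrite !in_setE => hx; apply/asboolP.
    by rewrite -hi; apply/asboolP.
  by rewrite hi; apply/asboolP.
pose near_simple (z : nat * seq bool * nat) y :=
  pat z.1.1 y = z.1.2 /\ (opdist (feat_op HK y) (so_eval (S z.1.1) y) <= (z.2.+1%:R^-1)%:E)%E.
have hc z : exists o : option X, if o is Some y then near_simple z y
    else forall y, ~ near_simple z y.
  have [[y hy]|hn] := pselect (exists y, near_simple z y); first by exists (Some y).
  by exists None => y hy; apply: hn; exists y.
have [pick hpick] := choice hc.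
(* One representative is chosen for each triple, and the corresponding null sets are united along
   the enumeration of the triples. *)
have hperp : {ae nu, forall x, forall n : nat,
    forall z y, unpickle n = Some z -> pick z = Some y ->
    ip HK (P0 (feat HK y)) (feat HK x) = 0}.
  apply: ae_foralln => n; case: (unpickle n : option (nat * seq bool * nat)) => [z|]; last first.
    by apply: filterE => x z y.
  case pz : (pick z) => [y|]; last first.
    by apply: filterE => x z' y [<-]; rewrite pz.
  apply: filterS (ae_perp (feat HK y)) => x hx z' y' [<-].
  by rewrite pz => -[<-].
apply: filterS2 hS hperp => x hx hp.
have key (j : nat) : `|P0 (feat HK x)| ^+ 2 <= 4 * j.+1%:R^-1.
  have j0 : (0 : R) < j.+1%:R^-1 by rewrite invr_gt0.
  have [k hk] : exists k, (opdist (feat_op HK x) (so_eval (S k) x) <= (j.+1%:R^-1)%:E)%E.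
    apply: contrapT => hn; have : ((j.+1%:R^-1)%:E <= 0 :> \bar R)%E.
      apply: (@cvge_ge _ \oo _ _ (fun k => opdist (feat_op HK x) (so_eval (S k) x))) => //.
      by apply: nearW => k; rewrite leNgt; apply/negP => /ltW hk; apply: hn; exists k.
    by rewrite lee_fin leNgt j0.
  have := hpick (k, pat k x, j); case pz : (pick _) => [y|]; last first.
    by move=> /(_ x) []; split.
  move=> [/= pxy hy].
  have bx : ip HK (P0 (feat HK y)) (feat HK x) = 0.
    by apply: (hp (pickle (k, pat k x, j)) (k, pat k x, j)) pz; rewrite pickleK.
  pose eps : R := 2 * j.+1%:R^-1.
  have dist1 w : `|w| <= 1 -> `|feat_op HK x w - feat_op HK y w| <= eps.
    move=> w1; have h1 := le_trans (opnorm_ge _ w1) hk.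
    have h2 := le_trans (opnorm_ge _ w1) hy.
    rewrite !lee_fin in h1 h2.
    have -> : feat_op HK x w - feat_op HK y w =
      (feat_op HK x w - so_eval (S k) x w) - (feat_op HK y w - so_eval (S k) y w).
      by rewrite (patE _ _ _ pxy) opprB addrA subrK.
    apply: le_trans (ler_normB _ _) _.
    by rewrite /eps mulr_natl mulr2n lerD.
  have dist w : `|feat_op HK x w - feat_op HK y w| <= eps * `|w|.
    have [->|w0] := eqVneq w 0.
      by rewrite /feat_op !(ip0l hP) !scale0r subrr !normr0 mulr0.
    have nw : 0 < `|w| by rewrite normr_gt0.
    have := dist1 (`|w|^-1 *: w); rewrite normrZ ger0_norm ?invr_ge0//.
    rewrite mulVf ?gt_eqF// => /(_ (lexx _)).
    have -> : feat_op HK x (`|w|^-1 *: w) - feat_op HK y (`|w|^-1 *: w) =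
        `|w|^-1 *: (feat_op HK x w - feat_op HK y w).
      by rewrite /feat_op !(ipZl hP) scalerBr !scalerA.
    by rewrite normrZ ger0_norm ?invr_ge0// mulrC ler_pdivrMr.
  set a := P0 (feat HK x); set b := P0 (feat HK y) in bx.
  have aa : ip HK a (feat HK x) = `|a| ^+ 2.
    by rewrite -(inner_norm hP) {2}/a -(kproj_sym hP sd mu1) (kproj_idem hP sd mu1).
  have bb : ip HK b (feat HK y) = `|b| ^+ 2.
    by rewrite -(inner_norm hP) {2}/b -(kproj_sym hP sd mu1) (kproj_idem hP sd mu1).
  have ab : ip HK a (feat HK y) = ip HK a b.
    by rewrite /b -(kproj_sym hP sd mu1) (kproj_idem hP sd mu1).
  have ax : `|a| <= `|feat HK x| by exact: (norm_kproj_le hP sd mu1).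
  have hb := dist b; have ha := dist a.
  have eps0 : 0 <= eps by rewrite mulr_ge0 ?(ltW j0).
  (* The closeness of [feat_op x] and [feat_op y] is first tested on [b], which [feat_op x]
     annihilates. Tested on [a], it then makes [feat_op x a] small, while its norm is at least
     [|a|^3]. *)
  have hby : `|b| * `|feat HK y| <= eps.
    have [b0|b0] := eqVneq b 0; first by rewrite b0 normr0 mul0r.
    have nb : 0 < `|b| by rewrite normr_gt0.
    move: hb; rewrite /feat_op bx bb scale0r sub0r normrN normrZ normrX normr_id.
    by rewrite expr2 -mulrA mulrC ler_pM2r.
  have h1 : `|feat_op HK y a| <= eps * `|a|.
    rewrite /feat_op ab normrZ mulrC.
    apply: (@le_trans _ _ (`|feat HK y| * (`|a| * `|b|))).
      by rewrite ler_wpM2l// (cauchy_schwarz hP).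
    have -> : `|feat HK y| * (`|a| * `|b|) = (`|b| * `|feat HK y|) * `|a| by ring.
    by rewrite ler_wpM2r.
  have h2 : `|feat_op HK x a| <= 2 * eps * `|a|.
    have := ler_normD (feat_op HK x a - feat_op HK y a) (feat_op HK y a).
    rewrite subrK; move: ha h1; lra.
  have [a0|a0] := eqVneq a 0; first by rewrite a0 normr0 expr0n /= mulr_ge0// ltW.
  have na : 0 < `|a| by rewrite normr_gt0.
  move: h2; rewrite /feat_op aa normrZ normrX normr_id => h2.
  have : `|a| ^+ 2 * `|a| <= 2 * eps * `|a|.
    by apply: le_trans h2; rewrite ler_wpM2l ?sqr_ge0.
  by rewrite ler_pM2r// /eps mulrA -natrM.
have h : `|P0 (feat HK x)| ^+ 2 <= 0.
  apply/ler_addgt0Pr => eps eps0; rewrite add0r.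
  have e4 : 0 < eps / 4 by rewrite divr_gt0.
  pose j := Num.truncn (eps / 4)^-1.
  apply: le_trans (key j) _.
  rewrite mulrC -ler_pdivlMr// -[leRHS]invrK lef_pV2 ?posrE ?invr_gt0//.
  by have := truncnS_gt (eps / 4)^-1; move/ltW.
by apply/eqP; rewrite -normr_eq0 -sqrf_eq0 eq_le h sqr_ge0.
Qed.

End bochner.

End covariance.

(** * Deviation of the empirical covariance *)

Section deviation.
Context d (T : measurableType d) (R : realType) (rho : probability T R).
Context (a : nat -> T -> R) (mu : nat -> R) (lam Nb : R).
Hypothesis ma : forall j, measurable_fun setT (a j).
Hypothesis a_le1 : forall J z, \sum_(j < J) a j z ^+ 2 <= 1.
Hypothesis a_cov : forall l j,
  (\int[rho]_z (a l z * a j z)%:E = ((l == j)%:R * mu j)%:E)%E.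
Hypothesis mu_ge0 : forall j, 0 <= mu j.
Hypothesis lam01 : 0 < lam <= 1.
Hypothesis Nb_ge : forall J, \sum_(j < J) mu j / (mu j + lam) <= Nb.

Let lam_gt0 : 0 < lam. Proof. by case/andP: lam01. Qed.
Let ml_gt0 j : 0 < mu j + lam. Proof. by rewrite ltr_wpDl. Qed.
Let ml_ge0 j : 0 <= mu j + lam. Proof. exact: ltW. Qed.

(* Entry [(l, j)], in the eigenbasis of [T], of the contribution of one observation
   to [(T - A) (T + lam)^(-1/2)]; [a j z] is the [j]-th coordinate of the
   normalized feature. *)
Definition dev l j z : R :=
  ((l == j)%:R * mu j - a l z * a j z) / Num.sqrt (mu j + lam).

Lemma a_sqr_le1 j z : a j z ^+ 2 <= 1.
Proof.
apply: le_trans (a_le1 j.+1 z).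
by rewrite big_ord_recr /= lerDr sumr_ge0// => i _; exact: sqr_ge0.
Qed.

Lemma aM_le1 l j z : `|a l z * a j z| <= 1.
Proof.
rewrite -(@ler_pXn2r _ 2) ?nnegrE// expr1n -normrX ger0_norm ?sqr_ge0// exprMn.
by rewrite -[leRHS]mul1r ler_pM ?sqr_ge0 ?a_sqr_le1.
Qed.

Lemma measurable_dev l j : measurable_fun setT (dev l j).
Proof.
apply: measurable_funM => //; apply: measurable_funB => //.
exact: measurable_funM.
Qed.

Lemma integrable_aM l j : rho.-integrable setT (fun z => (a l z * a j z)%:E).
Proof.
apply: (bounded_integrable rho (M := 1)); last exact: aM_le1.
exact: measurable_funM.
Qed.

Lemma trace_le1 J : \sum_(j < J) mu j <= 1.
Proof.
rewrite -lee_fin -sumEFin -(integral_cst_probability rho 1).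
have -> : (\sum_(j < J) (mu j)%:E = \int[rho]_z \sum_(j < J) (a j z * a j z)%:E)%E.
  rewrite integral_sum//; last by move=> j; exact: integrable_aM.
  by apply: eq_bigr => j _; rewrite a_cov eqxx mul1r.
apply: ge0_integral_mono => z; rewrite sumEFin lee_fin.
  by apply: sumr_ge0 => j _; rewrite -expr2 sqr_ge0.
by under eq_bigr do rewrite -expr2; exact: a_le1.
Qed.

Lemma dev_mean l j : (\int[rho]_z (dev l j z)%:E = 0)%E.
Proof.
have -> : (fun z => (dev l j z)%:E) = (fun z => (Num.sqrt (mu j + lam))^-1%:E *
    (((l == j)%:R * mu j)%:E - (a l z * a j z)%:E))%E.
  by apply/funext => z; rewrite -EFinB -EFinM mulrC.
have icst : rho.-integrable setT (fun=> ((l == j)%:R * mu j)%:E).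
  exact: finite_measure_integrable_cst.
rewrite integralZl//; last by apply: integrableB => //; exact: integrable_aM.
rewrite integralB//; last exact: integrable_aM.
by rewrite integral_cst_probability a_cov subee// mule0.
Qed.

Lemma dev_sqr l j z : dev l j z ^+ 2 =
  ((l == j)%:R * mu j - a l z * a j z) ^+ 2 / (mu j + lam).
Proof. by rewrite /dev expr_div_n sqr_sqrtr. Qed.

(** From [(x - y)^2 <= 2 x^2 + 2 y^2]: the diagonal part contributes at most twice the trace, the
    rank-one part at most [2 / lam], and [lam <= 1] merges them into [4 / lam]. *)
Lemma dev_le J z : \sum_(l < J) \sum_(j < J) dev l j z ^+ 2 <= 4 / lam.
Proof.
have lam1 : 1 <= lam^-1 by case/andP: lam01 => l0 l1; rewrite invf_ge1.
apply: (@le_trans _ _ (\sum_(l < J) \sum_(j < J)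
   (2 * ((l == j)%:R * mu j) + 2 * lam^-1 * (a l z ^+ 2 * a j z ^+ 2)))).
  apply: ler_sum => l _; apply: ler_sum => j _; rewrite dev_sqr.
  rewrite ler_pdivrMr//; set x := (_ == _)%:R * mu j; set y := a l z * a j z.
  have -> : a l z ^+ 2 * a j z ^+ 2 = y ^+ 2 by rewrite exprMn.
  have x0 : 0 <= x by rewrite mulr_ge0.
  have xm : x <= mu j by rewrite /x; case: (_ == _); rewrite ?mul1r ?mul0r.
  have h1 : (x - y) ^+ 2 <= 2 * x ^+ 2 + 2 * y ^+ 2.
    by have := sqr_ge0 (x + y); lra.
  have h2 : x ^+ 2 <= x * (mu j + lam).
    by rewrite expr2 ler_wpM2l// (le_trans xm)// lerDl ltW.
  have h3 : y ^+ 2 <= lam^-1 * y ^+ 2 * (mu j + lam).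
    rewrite mulrAC -[leLHS]mul1r ler_wpM2r ?sqr_ge0//.
    by rewrite mulrC ler_pdivlMr// mul1r lerDr.
  lra.
under eq_bigr do rewrite big_split /= -!mulr_sumr.
rewrite big_split /= -!mulr_sumr -mulr_suml.
have -> : \sum_(l < J) \sum_(j < J) (l == j)%:R * mu j = \sum_(j < J) mu j.
  apply: eq_bigr => l _; rewrite (bigD1 l)//= eqxx mul1r big1 ?addr0// => j jl.
  by rewrite eq_sym (negPf jl) mul0r.
have t1 := trace_le1 J; have s1 := a_le1 J z.
have s0 : 0 <= \sum_(j < J) a j z ^+ 2 by apply: sumr_ge0 => j _; exact: sqr_ge0.
have : (\sum_(j < J) a j z ^+ 2) * (\sum_(j < J) a j z ^+ 2) <= 1.
  by rewrite -[leRHS]mulr1 ler_pM.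
set S := _ * _ => hS.
have : 2 * lam^-1 * S <= 2 * lam^-1 * 1 by rewrite ler_wpM2l// mulr_ge0// invr_ge0 ltW.
lra.
Qed.

(** Summing column [j] over [l] and using [\sum_l a_l^2 <= 1] leaves [(mu_j^2 + (1 - 2 mu_j) a_j^2)
    / (mu_j + lam)], whose mean is at most [mu_j / (mu_j + lam)]: the effective dimension
    appears. *)
Lemma dev_var J : (\int[rho]_z (\sum_(l < J) \sum_(j < J) dev l j z ^+ 2)%:E <= Nb%:E)%E.
Proof.
pose c j := (1 - 2 * mu j) / (mu j + lam).
apply: (@le_trans _ _ (\int[rho]_z ((\sum_(j < J) mu j ^+ 2 / (mu j + lam))%:E +
   \sum_(j < J) (c j)%:E * (a j z * a j z)%:E))%E).
  apply: ge0_integral_mono => z.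
    by rewrite lee_fin; apply: sumr_ge0 => l _; apply: sumr_ge0 => j _; exact: sqr_ge0.
  have -> : (\sum_(j < J) (c j)%:E * (a j z * a j z)%:E =
             (\sum_(j < J) c j * (a j z * a j z))%:E)%E.
    by rewrite -sumEFin; apply: eq_bigr => j _; rewrite EFinM.
  rewrite -EFinD lee_fin exchange_big /= -big_split /=; apply: ler_sum => j _.
  have -> : \sum_(l < J) dev l j z ^+ 2 =
      (mu j ^+ 2 - 2 * mu j * a j z ^+ 2 + a j z ^+ 2 * \sum_(l < J) a l z ^+ 2) / (mu j + lam).
    under eq_bigr do rewrite dev_sqr; rewrite -mulr_suml; congr (_ / _).
    have E (l : 'I_J) : ((l == j :> nat)%:R * mu j - a l z * a j z) ^+ 2 =
        (l == j)%:R * (mu j ^+ 2 - 2 * mu j * a j z ^+ 2) + a j z ^+ 2 * a l z ^+ 2.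
      have -> : (l == j :> nat) = (l == j) by [].
      by case: eqVneq => [->|_]; rewrite ?mul1r ?mul0r ?add0r; ring.
    under eq_bigr do rewrite E; rewrite big_split /= -mulr_sumr; congr (_ + _).
    by rewrite (bigD1 j)//= eqxx mul1r big1 ?addr0// => l /negPf ->; rewrite mul0r.
  rewrite /c [X in _ <= _ + X]mulrAC -mulrDl ler_wpM2r ?invr_ge0//.
  have := a_le1 J z; have := sqr_ge0 (a j z).
  set S := \sum_(l < J) _ => h0 h1.
  have : a j z ^+ 2 * S <= a j z ^+ 2 * 1 by rewrite ler_wpM2l.
  lra.
have ic j : rho.-integrable setT (fun z => ((c j)%:E * (a j z * a j z)%:E)%E).
  by apply: integrableZl => //; exact: integrable_aM.
rewrite integralD//; last 2 first.
- exact: finite_measure_integrable_cst.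
- exact: integrable_sum.
rewrite integral_cst_probability integral_sum//.
have -> : (\sum_(i < J) \int[rho]_x ((c i)%:E * (a i x * a i x)%:E) =
           (\sum_(i < J) c i * mu i)%:E)%E.
  rewrite -sumEFin; apply: eq_bigr => j _; rewrite integralZl//; last exact: integrable_aM.
  by rewrite a_cov eqxx mul1r EFinM.
rewrite -EFinD lee_fin; apply: le_trans (Nb_ge J); rewrite -big_split /=.
apply: ler_sum => j _; rewrite /c [X in _ + X <= _]mulrAC -mulrDl ler_wpM2r ?invr_ge0//.
have := sqr_ge0 (mu j); lra.
Qed.

Section tail.
Context (n : nat) (w : 'I_n -> bool).

Definition dev_sum (D : n.-tuple T) l j : R := \sum_(t < n) (w t)%:R * dev l j (tnth D t).

Definition dev_norm J (D : n.-tuple T) : R :=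
  \sum_(l < J) \sum_(j < J) dev_sum D l j ^+ 2.

Lemma measurable_dev_norm J : measurable_fun [set: n.-tuple T] (dev_norm J).
Proof.
apply: measurable_sum => l; apply: measurable_sum => j; apply: measurable_funX.
apply: measurable_sum => t; apply: measurable_funM => //.
apply: measurableT_comp; first exact: measurable_dev.
exact: measurable_tnth.
Qed.

Lemma dev_norm_ge0 J D : 0 <= dev_norm J D.
Proof. by apply: sumr_ge0 => l _; apply: sumr_ge0 => j _; exact: sqr_ge0. Qed.

Lemma dev_norm_mono D : nondecreasing_seq (dev_norm ^~ D).
Proof.
apply/nondecreasing_seqP => J.
rewrite /dev_norm big_ord_recr /= -[leLHS]addr0 lerD//; last first.
  by apply: sumr_ge0 => j _; exact: sqr_ge0.
apply: ler_sum => l _; rewrite big_ord_recr /= lerDl.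
exact: sqr_ge0.
Qed.

Let V : R := (\sum_t (w t)%:R) * Nb + 4 / lam.

Lemma dev_moment k J : (\int[iid_law rho n]_D (dev_norm J D ^+ k)%:E <=
  (moment_const R k * V ^+ k)%:E)%E.
Proof.
have Nb0 : 0 <= Nb by apply: le_trans (Nb_ge 0); rewrite big_ord0.
have h := @moment_le _ T R rho ('I_J * 'I_J)%type (fun lj => dev lj.1 lj.2) (4 / lam) Nb.
have {h} := h (fun lj => measurable_dev lj.1 lj.2).
have -> : (fun D => (dev_norm J D ^+ k)%:E) = (fun D =>
    ((\sum_i wsum (fun lj : 'I_J * 'I_J => dev lj.1 lj.2) w D i ^+ 2) ^+ k)%:E).
  by apply/funext => D; rewrite /dev_norm pair_bigA.
apply => //.
- by rewrite divr_ge0// ltW.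
- by move=> z; rewrite -(pair_bigA _ (fun l j : 'I_J => dev l j z ^+ 2)); exact: dev_le.
- by move=> i; exact: dev_mean.
- under eq_integral => z _ do rewrite -(pair_bigA _ (fun l j : 'I_J => dev l j z ^+ 2)).
  exact: dev_var.
Qed.

(** The truncations increase with [J], so this is the event that the squared Hilbert-Schmidt norm of
    the infinite matrix exceeds [thr], written without an infinite sum. *)
Definition dev_bad (thr : R) := [set D : n.-tuple T | exists J, thr < dev_norm J D].

Lemma dev_badE thr : dev_bad thr = \bigcup_J [set D | thr < dev_norm J D].
Proof. by apply/seteqP; split => D [J]; [exists J|exists J]. Qed.

Lemma measurable_dev_lt thr J : measurable [set D : n.-tuple T | thr < dev_norm J D].
Proof.
rewrite (_ : [set D | _] = [set: n.-tuple T] `&` dev_norm J @^-1` `]thr, +oo[).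
  by apply: measurable_dev_norm => //; exact: measurable_itv.
by apply/seteqP; split => D /=; rewrite in_itv /= andbT; [split|case].
Qed.

Lemma measurable_dev_bad thr : measurable (dev_bad thr).
Proof. by rewrite dev_badE; apply: bigcup_measurable => J _; exact: measurable_dev_lt. Qed.

(** Markov's inequality for each truncation, with a bound that does not depend on [J], then
    continuity from below of the measure. *)
Lemma dev_bad_le thr k : 0 < thr ->
  (iid_law rho n (dev_bad thr) <= (moment_const R k * (V / thr) ^+ k)%:E)%E.
Proof.
move=> thr0; have mbad := measurable_dev_bad thr; rewrite dev_badE in mbad *.
have sub J J' : (J <= J')%N ->
    [set D | thr < dev_norm J D] `<=` [set D | thr < dev_norm J' D].
  by move=> JJ' D /= h; apply: lt_le_trans h (dev_norm_mono D JJ').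
have h := @nondecreasing_cvg_mu _ _ _ (iid_law rho n) _ (measurable_dev_lt thr) mbad
  (fun J J' JJ' => introT (subsetPset _ _) (sub J J' JJ')).
apply: cvge_le h; apply: nearW => J /=.
have tk : 0 < thr ^+ k by rewrite exprn_gt0.
have -> : iid_law rho n [set D | thr < dev_norm J D] =
    (\int[iid_law rho n]_D (\1_[set D | thr < dev_norm J D] D)%:E)%E.
  by rewrite integral_indic ?setIT//; exact: measurable_dev_lt.
apply: (@le_trans _ _ (\int[iid_law rho n]_D ((thr ^+ k)^-1%:E * (dev_norm J D ^+ k)%:E))%E).
  apply: ge0_integral_mono => D; first by rewrite lee_fin.
  rewrite -EFinM lee_fin indicE; have [/set_mem /= hD|_] := boolP (D \in _).
    rewrite mulrC ler_pdivlMr// mul1r lerXn2r ?nnegrE ?(ltW hD)// ?(ltW thr0)//.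
    exact: dev_norm_ge0.
  by rewrite mulr_ge0 ?invr_ge0 ?(ltW tk)// exprn_ge0// dev_norm_ge0.
rewrite ge0_integralZl//; last 3 first.
- by apply/measurable_EFinP; apply: measurable_funX; exact: measurable_dev_norm.
- by move=> D _; rewrite lee_fin exprn_ge0// dev_norm_ge0.
- by rewrite lee_fin invr_ge0 ltW.
apply: (@le_trans _ _ ((thr ^+ k)^-1%:E * (moment_const R k * V ^+ k)%:E)%E).
  by apply: lee_wpmul2l; rewrite ?lee_fin ?invr_ge0 ?(ltW tk)//; exact: dev_moment.
by rewrite -EFinM lee_fin expr_div_n mulrC mulrA.
Qed.

End tail.
End deviation.

(** The expected number of observations in a null set; in this form it is one more summand in the
    union bound of [approx_error_le]. *)
Lemma iid_law_null d (T : measurableType d) (R : realType) (rho : probability T R)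
    (N : set T) n : measurable N -> rho N = 0%E ->
  (\int[iid_law rho n]_D (\sum_(t < n) (\1_N (tnth D t))%:E) = 0)%E.
Proof.
move=> mN N0.
have m1 : measurable_fun setT (\1_N : T -> R) by exact: measurable_indic.
elim: n => [|n IH].
  by under eq_integral do rewrite big_ord0; rewrite integral0.
have mf k : measurable_fun [set: k.-tuple T]
    (fun D => (\sum_(t < k) (\1_N (tnth D t))%:E)%E : \bar R).
  apply: emeasurable_sum => t; apply/measurable_EFinP.
  by apply: measurableT_comp => //; exact: measurable_tnth.
rewrite iid_law_integralS//; last by move=> D; exact: sume_ge0.
rewrite -[RHS]IH; apply: eq_integral => D _.
under eq_integral => z _.
  rewrite big_ord_recl (tnth_nth z) /=.
  under eq_bigr => t _ do rewrite (tnth_nth z) /= -(tnth_nth z).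
  over.
rewrite ge0_integralD//; last 2 first.
- by apply/measurable_EFinP.
- by move=> z _; exact: sume_ge0.
have -> : (\int[rho]_x (\1_N x)%:E = 0)%E.
  by rewrite integral_indic// setIT; exact: N0.
rewrite add0e.
by rewrite sumEFin integral_cst_probability.
Qed.

(** * From matrix entries in the eigenbasis back to an operator inequality *)

Section empirical.
Context (R : realType) d (X : measurableType d) (K : X -> X -> R) (kappa : R).
Context (H : completeNormedModType R) (HK : rkhs K H).
Hypothesis kappa_gt0 : 0 < kappa.
Hypothesis K_bounded : forall x, K x x <= kappa ^+ 2.
Context (n : nat) (D : n.-tuple (X * measurableTypeR R)%type) (B : {set 'I_n}).
Hypothesis B_gt0 : (0 < #|B|)%N.
Let hP := rkhs_inner HK.
Let A := emp_op HK kappa D B.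
Let c : R := (kappa ^+ 2)^-1 * (#|B|%:R)^-1.

Let c_ge0 : 0 <= c. Proof. by rewrite mulr_ge0 ?invr_ge0 ?sqr_ge0. Qed.

(** The vectors of indices outside [B] are set to zero, so that the family is still indexed by
    ['I_n] and [frame_op_spectral] applies. *)
Lemma emp_op_frame :
  A = frame_op (ip HK) (fun i => (Num.sqrt c * (i \in B)%:R) *: feat HK (tnth D i).1).
Proof.
apply/funext => v; rewrite /A /emp_op scalerA -/c scaler_sumr /frame_op big_mkcond /=.
apply: eq_bigr => i _; rewrite (ipZr hP) scalerA; case: ifP => _.
  rewrite !mulr1 /feat_op scalerA; congr (_ *: _).
  by rewrite -{1}(sqr_sqrtr c_ge0); ring.
by rewrite mulr0 mul0r scale0r.
Qed.

Lemma emp_op_ip u v :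
  ip HK (A u) v = c * \sum_(i in B) ev HK u (tnth D i).1 * ev HK v (tnth D i).1.
Proof.
rewrite /A /emp_op scalerA -/c (ipZl hP) (ip_suml hP); congr (_ * _).
by apply: eq_bigr => i _; rewrite ip_feat_op.
Qed.

Lemma emp_op_le v : ip HK (A v) v <= `|v| ^+ 2.
Proof.
rewrite emp_op_ip /c -mulrA mulrC ler_pdivrMr ?exprn_gt0// mulrC ler_pdivrMr ?ltr0n//.
apply: (@le_trans _ _ (\sum_(i in B) (`|v| * kappa) ^+ 2)).
  apply: ler_sum => i _; rewrite -expr2 -[leLHS]ger0_norm ?sqr_ge0// normrX.
  rewrite ler_pXn2r ?nnegrE ?mulr_ge0 ?(ltW kappa_gt0)//.
  exact: ev_le.
by rewrite sumr_const exprMn mulr_natr.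
Qed.

Lemma emp_op_spectral : exists mu e,
  spectral_decomposition (ip HK) A mu e /\ forall j, mu j <= 1.
Proof.
have [mu [e sd]] := frame_op_spectral hP
  (fun i => (Num.sqrt c * (i \in B)%:R) *: feat HK (tnth D i).1).
rewrite -emp_op_frame in sd.
by exists mu, e; split => //; exact: (sd_mu_le1 hP sd emp_op_le).
Qed.

Context (T : H -> H) (mu : nat -> R) (e : nat -> H).
Hypothesis sd : spectral_decomposition (ip HK) T mu e.
Hypothesis mu_le1 : forall j, mu j <= 1.
Context (lam delta2 : R).
Hypothesis lam_gt0 : 0 < lam.

Let a j (z : X * measurableTypeR R) : R := ev HK (e j) z.1 / kappa.

Hypothesis range : forall i, i \in B ->
  kproj (ip HK) mu e (feat HK (tnth D i).1) = 0.
Hypothesis good : forall J,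
  dev_norm a mu lam (fun i => i \in B) J D <= (#|B|%:R) ^+ 2 * delta2.

Let N : R := #|B|%:R.
Let N_gt0 : 0 < N. Proof. by rewrite ltr0n. Qed.
Let ml_gt0 j : 0 < mu j + lam.
Proof. by rewrite ltr_wpDl//; exact: (sd_mu_ge0 sd). Qed.

Lemma dev_sumE l j : dev_sum a mu lam (fun i => i \in B) D l j =
  N * ip HK (T (e l) - A (e l)) (e j) / Num.sqrt (mu j + lam).
Proof.
rewrite /dev_sum /dev (ipBl hP) (sd_coord _ _ hP sd) (sd_ee sd) emp_op_ip.
under eq_bigr do rewrite mulrA.
rewrite -mulr_suml; congr (_ / _).
have -> : mu j * ((l == j) && (mu l != 0))%:R = (l == j)%:R * mu j.
  have [->|_] /= := eqVneq l j; last by rewrite mulr0 mul0r.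
  by have [->|_] := eqVneq (mu j) 0; rewrite ?mul0r ?mulr0// mulrC.
under eq_bigr do rewrite mulrBr.
rewrite sumrB -mulr_suml mulrBr; congr (_ - _).
  congr (_ * _); rewrite /N -sum1_card natr_sum [RHS]big_mkcond /=.
  by apply: eq_bigr => i _; case: (i \in B).
have -> : N * (c * \sum_(i in B) ev HK (e l) (tnth D i).1 * ev HK (e j) (tnth D i).1) =
  (kappa ^+ 2)^-1 * \sum_(i in B) ev HK (e l) (tnth D i).1 * ev HK (e j) (tnth D i).1.
  by rewrite mulrA /c mulrCA -/N divff ?mulr1// gt_eqF.
rewrite mulr_sumr [RHS]big_mkcond /=; apply: eq_bigr => i _; case: ifP => _.
  by rewrite mul1r /a mulrACA -invfM -expr2 mulrC.
by rewrite mul0r.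
Qed.

Let q w := ip HK (T w) w + lam * `|w| ^+ 2.

Lemma qform_partial_le J w : \sum_(j < J) (mu j + lam) * ip HK w (e j) ^+ 2 <= q w.
Proof.
under eq_bigr do rewrite mulrDl; rewrite big_split /= -mulr_sumr; apply: lerD.
  have h := qformE hP sd mu_le1 (v := w) (bounded_spec_id R).
  rewrite mul0r subr0 /qform (sc_id sd) in h.
  rewrite -(cvg_lim (@Rhausdorff R) h).
  have := nondecreasing_cvgn_le _ (cvgP _ h) J; rewrite /series /= big_mkord; apply.
  apply: nondecreasing_series => j _ _.
  by rewrite mulr_ge0 ?sqr_ge0//; exact: (sd_mu_ge0 sd).
rewrite ler_wpM2l ?(ltW lam_gt0)//.
have := bessel hP sd w (iota_uniq 0 J).
by rewrite -(big_mkord xpredT (fun j => ip HK w (e j) ^+ 2)) /index_iota subn0.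
Qed.

Lemma A_sym u v : ip HK (A u) v = ip HK u (A v).
Proof.
rewrite (inner_sym hP u) !emp_op_ip; congr (_ * _).
by apply: eq_bigr => i _; rewrite mulrC.
Qed.

Lemma T_sym u v : ip HK (T u) v = ip HK u (T v).
Proof. by rewrite -!(sc_id sd) (sc_sym hP sd mu_le1)//; exact: bounded_spec_id. Qed.

(** The sampled features have no kernel component, so [T - A] maps into the closed span of the
    [e j], and its coordinates determine it. *)
Lemma kproj_diff w : kproj (ip HK) mu e (T w - A w) = 0.
Proof.
apply: (ip_ext hP) => v; rewrite (kproj_sym hP sd mu_le1) (ip0l hP) (ipBl hP).
rewrite T_sym (sd_kproj hP sd mu_le1) (ip0r hP) sub0r emp_op_ip big1 ?mulr0 ?oppr0// => i iB.
rewrite [ev HK (kproj _ _ _ v) _](ev_ip HK) (kproj_sym hP sd mu_le1) range// (ip0r hP).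
by rewrite mulr0.
Qed.

(** Expand [w] in the eigenbasis and apply Cauchy-Schwarz with the weights [sqrt (mu j + lam)]: one
    factor collects the entries of [dev_sum], the other is bounded by [q w]. Inner sums are
    truncated at [J], which then tends to infinity. *)
Lemma diff_partial_le L w :
  \sum_(l < L) ip HK (T w - A w) (e l) ^+ 2 <= delta2 * q w.
Proof.
pose v l := T (e l) - A (e l).
pose S J l := \sum_(0 <= j < J) 1 * ip HK (v l) (e j) * ip HK w (e j).
have cS l : (fun J => S J l) @ \oo --> ip HK (T w - A w) (e l).
  have h := ip_calc hP sd mu_le1 (v := v l) (w := w) (bounded_spec1 R).
  suff <- : ip HK (calc (ip HK) mu e (fun=> 1) (v l)) w = ip HK (T w - A w) (e l) by exact: h.
  have : calc (ip HK) mu e (fun=> 1) (v l) = v l.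
    by apply/esym/eqP; rewrite -subr_eq0; apply/eqP; exact: (kproj_diff (e l)).
  by move=> ->; rewrite (inner_sym hP) /v (ipBr hP) (ipBl hP) T_sym A_sym.
have cQ : (fun J => \sum_(l < L) S J l ^+ 2) @ \oo -->
    \sum_(l < L) ip HK (T w - A w) (e l) ^+ 2.
  have H1 l : (fun J => S J l ^+ 2) @ \oo --> ip HK (T w - A w) (e l) ^+ 2.
    by rewrite expr2; under eq_fun do rewrite expr2; apply: cvgM; exact: cS.
  elim: (index_enum _) => [|l s IH].
    by under eq_fun do rewrite big_nil; rewrite big_nil; exact: cvg_cst.
  by under eq_fun do rewrite big_cons; rewrite big_cons; apply: cvgD.
have q0 : 0 <= q w by apply: le_trans (qform_partial_le 0 w); rewrite big_ord0.
apply: (ler_cvg_to cQ (cvg_cst (delta2 * q w))); near=> J.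
have LJ : (L <= J)%N by near: J; exact: nbhs_infty_ge.
apply: (@le_trans _ _ (\sum_(l < J) S J l ^+ 2)).
  rewrite -!(big_mkord xpredT (fun l => S J l ^+ 2)).
  rewrite [leRHS](@big_cat_nat _ _ _ L)//= lerDl sumr_ge0// => l _.
  exact: sqr_ge0.
apply: (@le_trans _ _ (\sum_(l < J) (N ^- 2 * \sum_(j < J)
    dev_sum a mu lam (fun i => i \in B) D l j ^+ 2) * q w)).
  apply: ler_sum => l _.
  pose x (j : 'I_J) := N^-1 * dev_sum a mu lam (fun i => i \in B) D l j.
  pose y (j : 'I_J) := Num.sqrt (mu j + lam) * ip HK w (e j).
  have -> : S J l = \sum_j x j * y j.
    rewrite /S big_mkord; apply: eq_bigr => j _; rewrite mul1r /x /y dev_sumE.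
    have sq : Num.sqrt (mu j + lam) != 0 by rewrite sqrtr_eq0 -ltNge.
    rewrite -/(v l) !mulrA mulVf ?gt_eqF// mul1r; congr (_ * _).
    by rewrite divfK.
  apply: le_trans (sum_cauchy_schwarz x y) _; apply: ler_pM.
  - by apply: sumr_ge0 => j _; exact: sqr_ge0.
  - by apply: sumr_ge0 => j _; exact: sqr_ge0.
  - rewrite mulr_sumr; apply: ler_sum => j _; rewrite /x exprMn exprVn.
    exact: lexx.
  - apply: le_trans (qform_partial_le J w); apply: ler_sum => j _.
    by rewrite /y exprMn sqr_sqrtr// ltW.
rewrite -mulr_suml -mulr_sumr ler_wpM2r//.
rewrite mulrC ler_pdivrMr ?exprn_gt0// mulrC.
exact: good.
Unshelve. all: by end_near. Qed.

Lemma diff_sqr_le w : `|T w - A w| ^+ 2 <= delta2 * q w.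
Proof.
have h := qformE hP sd mu_le1 (v := T w - A w) (bounded_spec1 R).
rewrite (qform1 hP) kproj_diff normr0 expr0n /= mulr0 subr0 in h.
apply: (ler_cvg_to h (cvg_cst (delta2 * q w))); near=> L.
apply: le_trans (diff_partial_le L w); rewrite /series /= big_mkord.
by apply: ler_sum => l _; rewrite mul1r.
Unshelve. all: by end_near. Qed.

End empirical.

(** * Effective dimension and residuals *)

Section effective_dimension.
Context (R : realType).

(* Grouping the terms two by two shows that the partial sum of order [2J+1] is
   at most [1 + 2^(1-a)] times the one of order [J]. *)
Lemma riemann_sum_le (a : R) : 1 < a -> exists2 C : R, 0 <= C &
  forall J, \sum_(j < J) j.+1%:R `^ (- a) <= C.
Proof.
move=> a1; pose u j : R := j.+1%:R `^ (- a).
have u0 j : 0 <= u j by exact: powR_ge0.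
pose q : R := 2 * 2 `^ (- a).
have q0 : 0 < q by rewrite mulr_gt0// powR_gt0.
have q1 : q < 1.
  have l2 : 0 < ln (2 : R) by rewrite ln_gt0 ?ltr1n.
  have -> : q = 2 `^ (1 - a) by rewrite powRD ?powRr1// (gt_eqF (_ : 0 < 2)) ?implybT.
  rewrite /powR gt_eqF// -[ltRHS]expR0 ltr_expR.
  by have : (1 - a) * ln 2 < 0 by rewrite nmulr_rlt0// subr_lt0.
have uodd i : u i.*2.+1 = 2 `^ (- a) * u i.
  by rewrite /u -powRM// -natrM mul2n doubleS.
have ueven i : u i.*2.+2 <= 2 `^ (- a) * u i.
  rewrite -uodd /u !powRN lef_pV2 ?posrE ?powR_gt0//.
  by rewrite ge0_ler_powR ?nnegrE// ?ler_nat// (le_trans ler01)// ltW.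
have step J : \sum_(j < J.*2.+1) u j <= 1 + q * \sum_(j < J) u j.
  elim: J => [|J IH].
    by rewrite double0 big_ord1 big_ord0 mulr0 addr0 /u powR1.
  rewrite doubleS [X in X <= _]big_ord_recr [X in X + _ <= _]big_ord_recr.
  rewrite [X in _ <= _ + _ * X]big_ord_recr /= mulrDr addrA -[X in X <= _]addrA.
  apply: lerD => //.
  by rewrite uodd /q -mulrA mulr_natl mulr2n lerD2l ueven.
exists (1 - q)^-1; first by rewrite invr_ge0 subr_ge0 ltW.
move=> J; have h : \sum_(j < J) u j <= \sum_(j < J.*2.+1) u j.
  rewrite -!(big_mkord xpredT u) [leRHS](@big_cat_nat _ _ _ J)//=.
    by rewrite lerDl sumr_ge0.
  by rewrite -addnn -addnS leq_addr.
have := le_trans h (step J).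
rewrite -div1r ler_pdivlMr ?subr_gt0//; lra.
Qed.

(** With [x = mu j / lam] and [theta <= 1], each summand [x / (x + 1)] is at most [x^theta]; the
    decay of [mu] then gives a series in [j^(- b theta)]. Its convergence is the reason for
    [theta > 1/b]. *)
Lemma effective_dim_le (b beta theta : R) : 0 < beta -> 0 < theta <= 1 ->
  1 < b * theta -> exists2 C : R, 0 < C &
  forall (mu : nat -> R) lam J, 0 < lam -> (forall j, 0 <= mu j) ->
  (forall j, mu j <= beta * j.+1%:R `^ (- b)) ->
  \sum_(j < J) mu j / (mu j + lam) <= C * lam `^ (- theta).
Proof.
move=> beta0 /andP[th0 th1] bth; have [S S0 hS] := riemann_sum_le bth.
exists (beta `^ theta * (S + 1)); first by rewrite mulr_gt0 ?powR_gt0// ltr_wpDl.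
move=> mu lam J lam0 mu0 muj.
apply: (@le_trans _ _ (\sum_(j < J) (beta `^ theta * lam `^ (- theta)) *
   j.+1%:R `^ (- (b * theta)))); last first.
  rewrite -mulr_sumr mulrAC ler_wpM2r ?powR_ge0// ler_wpM2l ?powR_ge0//.
  by apply: le_trans (hS J) _; rewrite lerDl.
apply: ler_sum => j _.
have ml : 0 < mu j + lam by rewrite ltr_wpDl.
have -> : beta `^ theta * lam `^ (- theta) * j.+1%:R `^ (- (b * theta)) =
    ((beta * j.+1%:R `^ (- b)) / lam) `^ theta.
  rewrite !powRM ?invr_ge0 ?mulr_ge0 ?powR_ge0 ?(ltW lam0) ?(ltW beta0)//.
  rewrite -(powR_inv1 (ltW lam0)) -!powRrM mulN1r mulNr.
  by rewrite mulrAC.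
apply: (@le_trans _ _ ((mu j / lam) `^ theta)); last first.
  apply: ge0_ler_powR; rewrite ?nnegrE ?divr_ge0 ?mulr_ge0 ?powR_ge0 ?(ltW lam0) ?(ltW th0) ?(ltW beta0)//.
  by rewrite ler_wpM2r ?invr_ge0 ?(ltW lam0).
have [->|m0] := eqVneq (mu j) 0; first by rewrite mul0r powR_ge0.
have mp : 0 < mu j by rewrite lt_def m0 mu0.
have [h|h] := leP (mu j / lam) 1.
  apply: (@le_trans _ _ (mu j / lam)).
    by rewrite ler_wpM2l// lef_pV2 ?posrE// lerDr.
  by rewrite ger1_powR ?divr_gt0.
apply: (@le_trans _ _ 1).
  by rewrite ler_pdivrMr// mul1r lerDl ltW.
by rewrite -[leLHS](powRr0 (mu j / lam)) ler_powR ?(ltW th0)// ltW.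
Qed.

End effective_dimension.

Section residual_bound.
Context (R : realType).

(** The definition leaves [g lam 0] free, so its absolute value is added to the bound. *)
Lemma bounded_spec_reg (g : R -> R -> R) lam : regularization_function g ->
  0 < lam <= 1 -> bounded_on_spec (g lam).
Proof.
move=> [D' [E [gamma0 hg]]] lam01; exists (E / lam + `|g lam 0|) => t /andP[t0 t1].
move: t0; rewrite le_eqVlt => /predU1P[<-|t0].
  have [|_ h _] := hg _ lam01 1; first by rewrite ltr01 lexx.
  by rewrite lerDr (le_trans _ h).
by have [|_ h _] := hg _ lam01 t; rewrite ?t0// (le_trans h)// lerDl.
Qed.

(** For [t <= lam] a bound on the residual suffices, [t + lam] being at most [2 lam]. For [t > lam]
    the qualification at [Q] passes down to [v <= Q], since [t^(v - Q) <= lam^(v - Q)]. The residual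
    is 1 at [t = 0], hence the 1 in [M]. *)
Lemma residual_le (g : R -> R -> R) (q : \bar R) (v0 : R) :
  regularization_function g -> is_qualification g q -> 0 <= v0 -> (v0%:E <= q)%E ->
  exists2 Gam : R, 1 <= Gam & forall lam, 0 < lam <= 1 ->
    forall v, 0 <= v <= v0 -> forall t, 0 <= t <= 1 ->
    `|residual g lam t| * (t + lam) `^ v <= Gam * lam `^ v.
Proof.
move=> [D' [E [gamma0 hg]]] hq v00 v0q.
have [Q v0Q [gam gam0 hgam]] : exists2 Q, v0 <= Q & qualifies g Q.
  case: q hq v0q => [q0| |] //=.
    by move=> [_ h _]; rewrite lee_fin => ?; exists q0.
  by move=> h _; exists v0 => //; exact: h.
pose M := 1 + `|gamma0| + gam.
have M0 : 0 <= M by rewrite !addr_ge0// ltW.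
have res0 lam : residual g lam 0 = 1 by rewrite /residual mulr0 subr0.
exists (2 `^ Q * M).
  have : 1 <= 2 `^ Q :> R by rewrite -[leLHS](powRr0 2) ler_powR ?ler1n// (le_trans v00).
  have : 1 <= M by rewrite /M -addrA lerDl addr_ge0// ltW.
  by move=> h1 h2; rewrite -[leLHS]mulr1 ler_pM.
move=> lam lam01 v /andP[v_ge0 vv0] t /andP[t0 t1]; have /andP[l0 l1] := lam01.
have two_v : 2 `^ v <= 2 `^ Q :> R by rewrite ler_powR ?ler1n// (le_trans vv0).
have rM : `|residual g lam t| <= M.
  move: t0; rewrite le_eqVlt => /predU1P[<-|t0].
    by rewrite res0 normr1 /M -addrA lerDl addr_ge0// ltW.
  have [|_ _ h] := hg _ lam01 t; first by rewrite t0.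
  apply: le_trans h _; apply: le_trans (ler_norm _) _.
  by rewrite /M addrAC lerDr addr_ge0// ltW.
have [tl|lt] := leP t lam.
  apply: (@le_trans _ _ (M * (2 * lam) `^ v)).
    apply: ler_pM => //; first exact: powR_ge0.
    by rewrite ge0_ler_powR ?nnegrE ?addr_ge0 ?mulr_ge0 ?(ltW l0)//; lra.
  rewrite powRM ?(ltW l0)// mulrA ler_wpM2r ?powR_ge0// mulrC ler_wpM2r//.
have tp : 0 < t by apply: lt_trans lt.
apply: (@le_trans _ _ (`|residual g lam t| * (2 `^ v * t `^ v))).
  rewrite ler_wpM2l// -powRM// ge0_ler_powR ?nnegrE ?addr_ge0 ?mulr_ge0 ?(ltW l0)//.
  lra.
have key : `|residual g lam t| * t `^ v <= gam * lam `^ v.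
  have h := hgam _ lam01 t; have {}h : `|residual g lam t| * t `^ Q <= gam * lam `^ Q.
    by apply: h; rewrite tp.
  have tv : t `^ v = t `^ Q * t `^ (v - Q).
    by rewrite -powRD ?subrKC// (gt_eqF tp) implybT.
  have lv : lam `^ v = lam `^ Q * lam `^ (v - Q).
    by rewrite -powRD ?subrKC// (gt_eqF l0) implybT.
  rewrite tv lv !mulrA; apply: ler_pM => //; rewrite ?mulr_ge0 ?powR_ge0//.
  have e : v - Q = - (Q - v) by rewrite opprB.
  rewrite e !powRN lef_pV2 ?posrE ?powR_gt0// ge0_ler_powR ?nnegrE ?(ltW l0) ?(ltW lt)//.
  by rewrite subr_ge0 (le_trans vv0).
rewrite mulrCA -mulrA; apply: ler_pM; rewrite ?powR_ge0 ?mulr_ge0 ?powR_ge0//.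
apply: le_trans key _; rewrite ler_wpM2r ?powR_ge0//.
by rewrite /M lerDr addr_ge0.
Qed.

End residual_bound.

Section spectral_pairs.
Context (R : realType) (H : completeNormedModType R) (ip : H -> H -> R).
Hypothesis ipP : is_inner ip.

Lemma spectral_calculusE phi T v :
  spectral_calculus ip phi T v = sc ip (spectral_pair ip T).1 (spectral_pair ip T).2 phi v.
Proof.
rewrite /spectral_calculus /sc /kproj /calc; congr (_ *: (_ - limn (series _)) + _).
by apply/funext => j; rewrite mul1r.
Qed.

Lemma spectral_pairP T : (exists mu e, spectral_decomposition ip T mu e) ->
  spectral_decomposition ip T (spectral_pair ip T).1 (spectral_pair ip T).2.
Proof.
move=> [mu [e h]]; rewrite /spectral_pair.
by apply: (@xgetPex _ _ [set me | spectral_decomposition ip T me.1 me.2]); exists (mu, e).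
Qed.

Lemma sc_e0 mu (e : nat -> H) phi v : phi 0 = 0 -> (forall j, e j = 0) ->
  sc ip mu e phi v = 0.
Proof.
move=> p0 e0; rewrite /sc p0 scale0r add0r /calc (_ : series _ = cst 0) ?lim_cst//.
by apply/funext => n; rewrite /series /= big1// => j _; rewrite e0 scaler0.
Qed.

Lemma sc0 mu (e : nat -> H) phi : sc ip mu e phi 0 = 0.
Proof.
have c0 psi : calc ip mu e psi 0 = 0.
  rewrite /calc (_ : series _ = cst 0) ?lim_cst//.
  apply/funext => n; rewrite /series /= big1// => j _.
  by rewrite (ip0l ipP) mulr0 scale0r.
by rewrite /sc /kproj !c0 subrr scaler0 addr0.
Qed.

Lemma sc_mean A mu e phi m (v : 'I_m -> H) : spectral_decomposition ip A mu e ->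
  (forall j, mu j <= 1) -> bounded_on_spec phi ->
  sc ip mu e phi (m%:R^-1 *: \sum_j v j) = m%:R^-1 *: \sum_j sc ip mu e phi (v j).
Proof.
move=> sd mu1 b; rewrite -[X in sc _ _ _ _ X]addr0 (sc_linear ipP sd mu1)// sc0 addr0.
congr (_ *: _); elim: (index_enum _) => [|j s IH]; first by rewrite !big_nil sc0.
rewrite !big_cons -[v j]scale1r (sc_linear ipP sd mu1)// IH.
by rewrite !scale1r.
Qed.

End spectral_pairs.

(** * The error of the averaged estimator *)

Section pointwise.
Context (R : realType) d (X : measurableType d) (K : X -> X -> R) (kappa : R).
Context (H : completeNormedModType R) (HK : rkhs K H).
Hypothesis kappa_gt0 : 0 < kappa.
Hypothesis K_bounded : forall x, K x x <= kappa ^+ 2.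
Let hP := rkhs_inner HK.
Context (g : R -> R -> R) (r s lam Gam : R).
Hypothesis g_reg : regularization_function g.
Hypothesis r_gt0 : 0 < r.
Hypothesis s_ge0 : 0 <= s.
Hypothesis lam01 : 0 < lam <= 1.
Hypothesis Gam_ge1 : 1 <= Gam.
Hypothesis hGam : forall v, 0 <= v <= r + s -> forall t, 0 <= t <= 1 ->
  `|residual g lam t| * (t + lam) `^ v <= Gam * lam `^ v.

Lemma bounded_residual : bounded_on_spec (residual g lam).
Proof.
exists Gam => t t01; have := @hGam 0; rewrite lexx addr_ge0 ?(ltW r_gt0)//.
by move=> /(_ isT t t01); rewrite !powRr0 !mulr1.
Qed.

Context (T : H -> H) (mu : nat -> R) (e : nat -> H).
Hypothesis sd : spectral_decomposition (ip HK) T mu e.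
Hypothesis mu_le1 : forall j, mu j <= 1.
Context (n m : nat) (c : 'I_n -> 'I_m) (D : n.-tuple (X * measurableTypeR R)%type).
Hypothesis m_gt0 : (0 < m)%N.
Hypothesis block_gt0 : forall j, (0 < #|block c j|)%N.
Context (h : H).

Let f := sc (ip HK) mu e (fun t => t `^ r) h.
Let A j := emp_op HK kappa D (block c j).
Let resA j v := sc (ip HK) (spectral_pair (ip HK) (A j)).1
  (spectral_pair (ip HK) (A j)).2 (residual g lam) v.

Lemma emp_op_pair j :
  spectral_decomposition (ip HK) (A j) (spectral_pair (ip HK) (A j)).1
    (spectral_pair (ip HK) (A j)).2 /\
  forall i, (spectral_pair (ip HK) (A j)).1 i <= 1.
Proof.
have hsd : spectral_decomposition (ip HK) (A j) (spectral_pair (ip HK) (A j)).1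
    (spectral_pair (ip HK) (A j)).2.
  apply: spectral_pairP.
  have [mu' [e' [h' _]]] := emp_op_spectral HK kappa_gt0 K_bounded D (block_gt0 j).
  by exists mu', e'.
split => //; apply: (sd_mu_le1 hP hsd).
exact: emp_op_le.
Qed.

Lemma residual_avg v : v - avg_approx HK kappa g lam c D v = m%:R^-1 *: \sum_j resA j v.
Proof.
have m0 : m%:R != 0 :> R by rewrite pnatr_eq0 -lt0n.
have {1}-> : v = m%:R^-1 *: \sum_(j < m) v.
  by rewrite sumr_const card_ord -[v *+ m]scaler_nat scalerA mulVf// scale1r.
rewrite /avg_approx -scalerBr -sumrB; congr (_ *: _); apply: eq_bigr => j _.
have [sdA A1] := emp_op_pair j; rewrite /resA spectral_calculusE -/(A j).
have bg := bounded_spec_reg g_reg lam01.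
have bgi : bounded_on_spec (fun t => g lam t * t).
  by apply: bounded_specM => //; exact: bounded_spec_id.
have -> : residual g lam = (fun t => 1 + -1 * (g lam t * t)).
  by apply/funext => t; rewrite /residual mulN1r.
rewrite (scDphi hP sdA A1); last 2 first.
- exact: bounded_spec1.
- exact: bounded_specZ.
rewrite sc1 (scZphi hP sdA A1)// scaleN1r; congr (_ - _).
rewrite -[X in sc _ _ _ (g lam) X](sc_id sdA) (sc_comp hP sdA A1)//.
exact: bounded_spec_id.
Qed.

Lemma avg_error_le (M : R) :
  (forall j, `|sc (ip HK) mu e (fun t => t `^ s) (resA j f)| <= M) ->
  `|sc (ip HK) mu e (fun t => t `^ s) (f - avg_approx HK kappa g lam c D f)| <= M.
Proof.
move=> hM; rewrite residual_avg (sc_mean hP _ sd mu_le1); last exact: bounded_spec_pow.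
rewrite normrZ ger0_norm ?invr_ge0// mulrC ler_pdivrMr ?ltr0n//.
apply: le_trans (ler_norm_sum _ _ _) _.
apply: (@le_trans _ _ (\sum_(j < m) M)); first exact: ler_sum.
by rewrite sumr_const card_ord mulr_natr.
Qed.

Lemma avg_error_trivial :
  `|sc (ip HK) mu e (fun t => t `^ s) (f - avg_approx HK kappa g lam c D f)|
    <= Gam * `|h|.
Proof.
have pow1 (a t : R) : 0 <= a -> 0 <= t <= 1 -> `|t `^ a| <= 1.
  move=> a0 /andP[t0 t1]; rewrite ger0_norm ?powR_ge0//.
  by rewrite -[leRHS](congr1 (fun f => f a) (powR1 R)) ge0_ler_powR ?nnegrE.
apply: avg_error_le => j; have [sdA A1] := emp_op_pair j.
apply: (@le_trans _ _ `|resA j f|).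
  rewrite -[leRHS]mul1r; apply: (norm_sc_le_id hP sd mu_le1) => //.
    exact: bounded_spec_pow.
  by move=> t; exact: pow1.
apply: (@le_trans _ _ (Gam * `|f|)).
  apply: (norm_sc_le_id hP sdA A1); first exact: bounded_residual.
    exact: le_trans Gam_ge1.
  move=> t t01; have := @hGam 0; rewrite lexx addr_ge0 ?(ltW r_gt0)//.
  by move=> /(_ isT t t01); rewrite !powRr0 !mulr1.
rewrite ler_wpM2l ?(le_trans _ Gam_ge1)// -[leRHS]mul1r.
apply: (norm_sc_le_id hP sd mu_le1) => //.
  by apply: bounded_spec_pow; exact: ltW.
by move=> t; apply: pow1; exact: ltW.
Qed.

End pointwise.

Section error_bound.
Context (R : realType) d (X : measurableType d) (K : X -> X -> R) (kappa : R).
Context (H : completeNormedModType R) (HK : rkhs K H).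
Hypothesis kappa_gt0 : 0 < kappa.
Hypothesis K_bounded : forall x, K x x <= kappa ^+ 2.
Hypothesis H_measurable : forall f : H, measurable_fun setT (ev HK f).
Let hP := rkhs_inner HK.
Local Notation Z := (X * measurableTypeR R)%type.

(* If the Bochner integral or the spectral decomposition does not exist, then the
   default values in the definitions make [op_power] vanish. *)
Lemma cov_op_cases (nu : probability X R) (r : R) h : 0 < r ->
  op_power (ip HK) (ncov_op HK kappa nu) r h = 0 \/
  exists I, [/\ is_bochner_integral nu (feat_op HK) I,
    forall v, ncov_op HK kappa nu v = (kappa ^+ 2)^-1 *: I v &
    spectral_decomposition (ip HK) (ncov_op HK kappa nu)
      (spectral_pair (ip HK) (ncov_op HK kappa nu)).1
      (spectral_pair (ip HK) (ncov_op HK kappa nu)).2].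
Proof.
move=> r0; set T := ncov_op HK kappa nu.
have p0 : 0 `^ r = 0 :> R by rewrite powR0// gt_eqF.
have [hsd|hn] := pselect (exists mu e, spectral_decomposition (ip HK) T mu e); last first.
  left; rewrite /op_power spectral_calculusE; apply: sc_e0 => // j.
  rewrite /spectral_pair; case: xgetP => [me _ hme|_ //].
  by exfalso; apply: hn; exists me.1, me.2.
have hp := spectral_pairP hsd.
have [[I hI]|hn] := pselect (exists I, is_bochner_integral nu (feat_op HK) I).
  right; exists (cov_op HK nu); split => //.
  rewrite /cov_op /bochner_integral.
  by apply: (@xgetPex _ _ [set I | is_bochner_integral nu (feat_op HK) I]); exists I.
left; have T0 v : T v = 0.
  rewrite /T /ncov_op /cov_op /bochner_integral.
  case: xgetP => [I _ hI|_]; last by rewrite scaler0.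
  by exfalso; apply: hn; exists I.
rewrite /op_power spectral_calculusE; apply: sc_e0 => // j.
apply: (sd_e0 hP hp); have := sd_coord (((spectral_pair (ip HK) T).2) j) j hP hp.
rewrite T0 (ip0l hP) (sd_ee hp) eqxx /=.
by have [->//|_] := eqVneq; rewrite mulr1 => /esym.
Qed.

Lemma avg_approx0 g lam n m (c : 'I_n -> 'I_m) (D : n.-tuple Z) :
  avg_approx HK kappa g lam c D 0 = 0.
Proof.
rewrite /avg_approx big1 ?scaler0// => j _.
have -> : emp_op HK kappa D (block c j) 0 = 0.
  rewrite /emp_op big1 ?scaler0// => i _.
  by rewrite /feat_op (ip0l hP) scale0r.
by rewrite spectral_calculusE sc0.
Qed.

Lemma approx_error0 g s p lam n m (c : 'I_n -> 'I_m) (rho : probability Z R) :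
  1 <= p -> approx_error HK kappa g s p lam c rho 0 = 0%E.
Proof.
move=> p1; have p0 : 0 < p by apply: lt_le_trans p1.
rewrite /approx_error; under eq_integral => D _ do rewrite avg_approx0 subr0.
rewrite /op_power spectral_calculusE sc0// normr0 powR0 ?gt_eqF// integral0.
by rewrite poweR0r// invr_eq0 gt_eqF.
Qed.

Context (g : R -> R -> R) (r s p lam Gam C theta Nc : R).
Hypothesis g_reg : regularization_function g.
Hypothesis r_gt0 : 0 < r.
Hypothesis s_ge0 : 0 <= s.
Hypothesis p_ge1 : 1 <= p.
Hypothesis lam01 : 0 < lam <= 1.
Hypothesis Gam_ge1 : 1 <= Gam.
Hypothesis hGam : forall v, 0 <= v <= r + s -> forall t, 0 <= t <= 1 ->
  `|residual g lam t| * (t + lam) `^ v <= Gam * lam `^ v.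
Hypothesis C_ge0 : 0 <= C.
Hypothesis hC : forall T muT eT A muA eA (rho : R -> R) lam h,
  spectral_decomposition (ip HK) T muT eT -> (forall j, muT j <= 1) ->
  spectral_decomposition (ip HK) A muA eA -> (forall j, muA j <= 1) ->
  0 < lam <= 1 -> bounded_on_spec rho ->
  (forall v : R, 0 <= v <= r + s -> forall t : R, 0 <= t <= 1 ->
    `|rho t| * (t + lam) `^ v <= Gam * lam `^ v) ->
  (forall w, `|T w - A w| ^+ 2 <=
    4^-1 * lam `^ (2 * Num.max r 1 - 1) * (ip HK (T w) w + lam * `|w| ^+ 2)) ->
  `|sc (ip HK) muT eT (fun t => t `^ s)
     (sc (ip HK) muA eA rho (sc (ip HK) muT eT (fun t => t `^ r) h))|
    <= C * lam `^ (r + s) * `|h|.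
Context (b beta : R).
Hypothesis hN : forall (mu : nat -> R) lam J, 0 < lam -> (forall j, 0 <= mu j) ->
  (forall j, mu j <= beta * j.+1%:R `^ (- b)) ->
  \sum_(j < J) mu j / (mu j + lam) <= Nc * lam `^ (- theta).
Context (n m n0 : nat) (c : 'I_n -> 'I_m).
Hypothesis m_gt0 : (0 < m)%N.
Hypothesis n0_gt0 : (0 < n0)%N.
Hypothesis block_card : forall j, #|block c j| = n0.

Let lam_gt0 : 0 < lam. Proof. by case/andP: lam01. Qed.

(* The constant of the favourable event, and the bound on the probability of its
   complement given by Markov's inequality for the moment of order [k] and the
   union bound over the [m] blocks of size [n0]. *)
Definition delta_sqr : R := 4^-1 * lam `^ (2 * Num.max r 1 - 1).

Definition bad_prob k : R := m%:R * (moment_const R k *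
  ((n0%:R * (Nc * lam `^ (- theta)) + 4 / lam) / (n0%:R ^+ 2 * delta_sqr)) ^+ k).

(** The [p]-th power of the error is dominated pointwise by a constant plus the trivial bound times
    [ind], which is measurable; [ge0_integral_mono] then needs nothing about the error itself. *)
Lemma approx_error_le k (sigma M Rad : R) rho f : 0 <= Rad ->
  model HK kappa b beta r sigma M Rad (rho, f) ->
  (approx_error HK kappa g s p lam c rho f <=
   (((C * lam `^ (r + s) * Rad) `^ p + (Gam * Rad) `^ p * bad_prob k) `^ p^-1)%:E)%E.
Proof.
move=> Rad0 [/= decay [h fE hRad] _].
set nu := marginal rho in decay fE *; set T := ncov_op HK kappa nu in decay fE *.
(* In the degenerate case the default values force [f = 0], and the error vanishes. *)
case: (cov_op_cases nu h r_gt0) => [f0|[I [hI TI sd]]].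
  by rewrite fE f0 approx_error0// lee_fin powR_ge0.
rewrite -/T in TI sd; set mu := (spectral_pair (ip HK) T).1 in sd.
set e := (spectral_pair (ip HK) T).2 in sd.
have mu1 := cov_mu_le1 kappa_gt0 K_bounded H_measurable hI TI sd.
have mu0 j : 0 <= mu j by exact: (sd_mu_ge0 sd).
have [N [mN nuN subN]] := ae_feat_range kappa_gt0 K_bounded H_measurable hI TI sd.
pose a j (z : Z) : R := ev HK (e j) z.1 / kappa.
have ma j : measurable_fun setT (a j).
  apply: measurable_funM => //; apply: measurableT_comp; first exact: H_measurable.
  exact: measurable_fst.
have a_le1 J z : \sum_(j < J) a j z ^+ 2 <= 1.
  have := bessel hP sd (feat HK z.1) (iota_uniq 0 J).
  rewrite -[iota 0 J](_ : index_iota 0 J = _); last by rewrite /index_iota subn0.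
  rewrite big_mkord => hb.
  under eq_bigr => j _ do rewrite /a expr_div_n (ev_ip HK) (inner_sym hP).
  rewrite -mulr_suml ler_pdivrMr ?exprn_gt0// mul1r; apply: le_trans hb _.
  by rewrite -(inner_norm hP) -(ev_ip HK) (ev_feat HK).
have a_cov l j : (\int[rho]_z (a l z * a j z)%:E = ((l == j)%:R * mu j)%:E)%E.
  have -> : (fun z => (a l z * a j z)%:E) = (fun z : Z =>
      (kappa ^+ 2)^-1%:E * ((fun x => (ev HK (e l) x * ev HK (e j) x)%:E) \o (@input R d X)) z)%E.
    apply/funext => z; rewrite /= -EFinM /a /input; congr (_%:E).
    by rewrite mulrACA -invfM -expr2 mulrC.
  have int1 : rho.-integrable setT
      ((fun x => (ev HK (e l) x * ev HK (e j) x)%:E) \o (@input R d X)).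
    apply: (bounded_integrable rho (f := fun z : Z => ev HK (e l) z.1 * ev HK (e j) z.1)
      (M := (`|e l| * kappa) * (`|e j| * kappa))).
      by apply: measurable_funM; apply: measurableT_comp (H_measurable _) _; exact: measurable_fst.
    by move=> z; rewrite normrM ler_pM//; exact: ev_le.
  rewrite integralZl//.
  have <- : (\int[nu]_x (ev HK (e l) x * ev HK (e j) x)%:E =
      \int[rho]_x ((fun x => (ev HK (e l) x * ev HK (e j) x)%:E) \o (@input R d X)) x)%E.
    rewrite /nu /marginal integral_distribution//.
    by apply/measurable_EFinP; apply: measurable_funM; exact: H_measurable.
  rewrite (ev_intE kappa_gt0 K_bounded H_measurable) -EFinM -(cov_op_ip kappa_gt0 K_bounded H_measurable hI TI).
  rewrite (sd_coord _ _ hP sd) (sd_ee sd); congr (_%:E).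
  have [->|_] /= := eqVneq l j; last by rewrite mulr0 mul0r.
  by have [->|_] := eqVneq (mu j) 0; rewrite ?mul0r ?mulr0// mulrC.
have Nb_ge J : \sum_(j < J) mu j / (mu j + lam) <= Nc * lam `^ (- theta).
  by apply: hN => // j; exact: decay.
pose thr := n0%:R ^+ 2 * delta_sqr.
have n0R : 0 < n0%:R :> R by rewrite ltr0n.
have del0 : 0 < delta_sqr by rewrite /delta_sqr mulr_gt0 ?invr_gt0 ?powR_gt0.
have thr0 : 0 < thr by rewrite mulr_gt0 ?exprn_gt0.
pose Bad j := dev_bad (n := n) a mu lam (fun i => i \in block c j) thr.
have mBad j : measurable (Bad j) by exact: measurable_dev_bad.
pose NZ := (@input R d X) @^-1` N.
have mNZ : measurable NZ.
  by rewrite -[NZ]setTI; exact: measurable_fst.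
have rNZ : rho NZ = 0%E by exact: nuN.
have h0 : 0 <= `|h| by [].
have sub1 D : (op_power (ip HK) T s (f - avg_approx HK kappa g lam c D f)) =
   sc (ip HK) mu e (fun t => t `^ s) (sc (ip HK) mu e (fun t => t `^ r) h -
     avg_approx HK kappa g lam c D (sc (ip HK) mu e (fun t => t `^ r) h)).
  by rewrite fE /op_power !spectral_calculusE.
have blk j : (0 < #|block c j|)%N by rewrite block_card.
pose err D := `|op_power (ip HK) T s (f - avg_approx HK kappa g lam c D f)|.
have err0 D : 0 <= err D by exact: normr_ge0.
have triv D : err D <= Gam * Rad.
  rewrite /err sub1; apply: le_trans (avg_error_trivial kappa_gt0 K_bounded g_reg
    r_gt0 s_ge0 lam01 Gam_ge1 hGam sd mu1 D m_gt0 blk h) _.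
  by rewrite ler_wpM2l// (le_trans _ Gam_ge1).
have good D : (forall j, ~ Bad j D) -> (forall i, ~ NZ (tnth D i)) ->
    err D <= C * lam `^ (r + s) * Rad.
  move=> nbad nN; rewrite /err sub1.
  apply: (avg_error_le kappa_gt0 K_bounded g_reg s_ge0 lam01 sd mu1 m_gt0 blk) => j.
  have [sdA A1] := emp_op_pair HK kappa_gt0 K_bounded D blk j.
  apply: le_trans (hC _ sd mu1 sdA A1 lam01 (bounded_residual r_gt0 s_ge0 hGam) hGam _) _.
    move=> w; apply: (diff_sqr_le (B := block c j) (blk j) sd mu1 lam_gt0 (delta2 := delta_sqr)).
      move=> i _; apply: contrapT => hi; apply: (nN i).
      exact: subN.
    move=> J; rewrite leNgt; apply/negP => hJ; apply: (nbad j).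
    by exists J; rewrite /thr -(block_card j).
  by rewrite ler_wpM2l// mulr_ge0// powR_ge0.
have p0 : 0 < p by apply: lt_le_trans p_ge1.
set aa := (C * lam `^ (r + s) * Rad) `^ p; set bb := (Gam * Rad) `^ p.
have aa0 : 0 <= aa by exact: powR_ge0.
have bb0 : 0 <= bb by exact: powR_ge0.
(* [ind] counts the bad blocks and the observations in the null set. It is at least 1 as soon as
   anything fails, so integrating it is the union bound. *)
pose ind D : \bar R := (\sum_(j < m) (\1_(Bad j) D)%:E + \sum_(t < n) (\1_NZ (tnth D t))%:E)%E.
have ind0 D : (0 <= ind D)%E.
  by rewrite adde_ge0// sume_ge0// => j _; rewrite lee_fin.
have pw D : ((err D `^ p)%:E <= aa%:E + bb%:E * ind D)%E.
  have [ex|nex] := pselect ((exists j, Bad j D) \/ (exists t, NZ (tnth D t))).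
    have i1 : (1 <= ind D)%E.
      case: ex => [[j hj]|[t ht]].
        rewrite /ind (bigD1 j)//= indicE mem_set// -addeA leeDl//.
        by rewrite adde_ge0// sume_ge0// => *; rewrite lee_fin.
      rewrite /ind [X in (_ <= _ + X)%E](bigD1 t)//= indicE mem_set// addeCA leeDl//.
      by rewrite adde_ge0// sume_ge0// => *; rewrite lee_fin.
    apply: (@le_trans _ _ (bb%:E * ind D)%E); last by rewrite leeDr// lee_fin.
    apply: (@le_trans _ _ (bb%:E * 1)%E); last by rewrite lee_wpmul2l// lee_fin.
    rewrite mule1 lee_fin ge0_ler_powR ?nnegrE ?(ltW p0)//.
    by rewrite mulr_ge0// (le_trans _ Gam_ge1).
  apply: (@le_trans _ _ aa%:E); last by rewrite leeDl// mule_ge0// lee_fin.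
  rewrite lee_fin ge0_ler_powR ?nnegrE ?(ltW p0)//.
    by rewrite !mulr_ge0// powR_ge0.
  apply: good => [j hj|t ht]; apply: nex; first by left; exists j.
  by right; exists t.
have mind1 j : measurable_fun [set: n.-tuple Z] (fun D => (\1_(Bad j) D)%:E : \bar R).
  by apply/measurable_EFinP; exact: measurable_indic.
have mind2 t : measurable_fun [set: n.-tuple Z] (fun D => (\1_NZ (tnth D t))%:E : \bar R).
  apply/measurable_EFinP; apply: measurableT_comp; first exact: measurable_indic.
  exact: measurable_tnth.
have ms1 : measurable_fun [set: n.-tuple Z] (fun D => (\sum_(j < m) (\1_(Bad j) D)%:E)%E : \bar R).
  apply: emeasurable_sum => j; exact: mind1.
have ms2 : measurable_fun [set: n.-tuple Z] (fun D => (\sum_(t < n) (\1_NZ (tnth D t))%:E)%E : \bar R).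
  apply: emeasurable_sum => t; exact: mind2.
have int_ind : (\int[iid_law rho n]_D ind D <= (bad_prob k)%:E)%E.
  rewrite /ind ge0_integralD//; last 2 first.
  - by move=> D _; rewrite sume_ge0// => j _; rewrite lee_fin.
  - by move=> D _; rewrite sume_ge0// => j _; rewrite lee_fin.
  rewrite (iid_law_null n mNZ rNZ) adde0 ge0_integral_sum//.
  apply: (@le_trans _ _ (\sum_(j < m) (moment_const R k *
    ((n0%:R * (Nc * lam `^ (- theta)) + 4 / lam) / thr) ^+ k)%:E)%E).
    apply: lee_sum => j _; rewrite integral_indic// setIT.
    have := dev_bad_le ma a_le1 a_cov mu0 lam01 Nb_ge (fun i => i \in block c j) k thr0.
    have -> // : \sum_t (t \in block c j)%:R = n0%:R :> R.
    rewrite -(block_card j) -sum1_card natr_sum [RHS]big_mkcond /=.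
    by apply: eq_bigr => i _; case: (i \in _).
  by rewrite sumEFin lee_fin sumr_const card_ord /bad_prob -[X in X <= _]mulr_natl.
have int_err : (\int[iid_law rho n]_D (err D `^ p)%:E <= (aa + bb * bad_prob k)%:E)%E.
  apply: (@le_trans _ _ (\int[iid_law rho n]_D (aa%:E + bb%:E * ind D))%E).
    by apply: ge0_integral_mono => D //; rewrite lee_fin powR_ge0.
  have mi : measurable_fun [set: n.-tuple Z] ind by exact: emeasurable_funD.
  rewrite ge0_integralD//; last 2 first.
  - by move=> D _; rewrite mule_ge0// lee_fin.
  - exact: measurable_funeM.
  rewrite integral_cst_probability ge0_integralZl// EFinD leeD2l// EFinM.
  by rewrite lee_wpmul2l// lee_fin.
rewrite /approx_error -/nu -/T -poweR_EFin.
have i0 : (0 <= \int[iid_law rho n]_D (err D `^ p)%:E)%E.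
  by apply: integral_ge0 => D _; rewrite lee_fin powR_ge0.
apply: gt0_ler_poweR => //.
- by rewrite invr_ge0 ltW.
- by rewrite in_itv /= leey andbT; exact: i0.
- by rewrite in_itv /= leey andbT (le_trans i0).
Qed.

End error_bound.

(** * Rates *)

Section rate_numerics.
Context (R : realType).

Lemma powR_rate (a x k e : R) : 0 < a -> 0 < x ->
  (a * x `^ (- k)) `^ e = a `^ e * x `^ (- (k * e)).
Proof. by move=> a0 x0; rewrite powRM ?powR_ge0 ?ltW// -powRrM mulNr. Qed.

Lemma bad_prob_ge0 (r lam theta Nc : R) m n0 k : 0 <= lam -> 0 <= Nc ->
  0 <= bad_prob r lam theta Nc m n0 k.
Proof.
move=> lam0 Nc0; rewrite /bad_prob /delta_sqr !mulr_ge0 ?moment_const_ge0// exprn_ge0//.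
by rewrite divr_ge0 ?addr_ge0 ?mulr_ge0 ?powR_ge0 ?invr_ge0 ?sqr_ge0.
Qed.

Lemma bad_prob_le (r alpha kap theta Nc a0 t : R) :
  0 < theta -> 0 <= kap -> 0 < a0 -> 0 <= Nc ->
  0 < 1 - alpha - kap * (2 * Num.max r 1 - 1 + theta) ->
  exists k N, forall n m n0, (N <= n)%N -> (0 < n)%N -> n = (m * n0)%N ->
    m%:R <= n%:R `^ alpha :> R ->
    bad_prob r (a0 * n%:R `^ (- kap)) theta Nc m n0 k
      <= (a0 * n%:R `^ (- kap)) `^ t.
Proof.
move=> th0 kap0 a00 Nc0; set e2 := 2 * Num.max r 1; set e1 := _ - 1 + theta.
set eps := (X in 0 < X) => eps0.
have e2_ge : 2 <= e2 by rewrite /e2 ler_peMr// le_max lexx orbT.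
pose Q := 4 * Nc * a0 `^ (- e1) + 16 * a0 `^ (- e2).
have Q0 : 0 <= Q by rewrite addr_ge0 ?mulr_ge0 ?powR_ge0.
(* In [2 + kap * t], one unit pays for the union over [m <= n] blocks, one for the constant
   [B <= n], and [kap * t] for the target [lam^t]. *)
pose k := (Num.trunc ((2 + kap * t) / eps)).+1.
have hk : 2 + kap * t <= eps * k%:R.
  by rewrite [leRHS]mulrC -ler_pdivrMr// ltW// truncnS_gt.
pose B := moment_const R k * Q ^+ k / a0 `^ t.
exists k, (Num.trunc B).+1 => n m n0 Nn n_gt0 nE m_le.
have nB : B <= n%:R.
  apply: (@le_trans _ _ (Num.trunc B).+1%:R); last by rewrite ler_nat.
  exact/ltW/truncnS_gt.
set x : R := n%:R in m_le nB *.
have x1 : 1 <= x by rewrite ler1n.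
have x0 : 0 < x by rewrite ltr0n.
have xD u v : x `^ u * x `^ v = x `^ (u + v).
  by rewrite powRD// (gt_eqF x0) implybT.
have n0_gt0 : (0 < n0)%N by move: n_gt0; rewrite nE muln_gt0 => /andP[].
have n0R : 0 < n0%:R :> R by rewrite ltr0n.
have mx : m%:R <= x by rewrite ler_nat nE leq_pmulr.
have n0x : n0%:R^-1 <= x `^ (alpha - 1).
  rewrite -[leLHS]mul1r ler_pdivrMr// -(@ler_pM2l _ x)// mulr1 mulrA.
  rewrite -{2}(powRr1 (ltW x0)) xD addrC subrK {1}/x nE natrM ler_wpM2r ?ler0n//.
set lam := a0 * x `^ (- kap).
have lam0 : 0 < lam by rewrite mulr_gt0// powR_gt0.
set w := lam `^ (e2 - 1).
have w0 : 0 < w by exact: powR_gt0.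
have lD u v : lam `^ u * lam `^ v = lam `^ (u + v).
  by rewrite powRD// (gt_eqF lam0) implybT.
have quot_le : (n0%:R * (Nc * lam `^ (- theta)) + 4 / lam) / (n0%:R ^+ 2 * delta_sqr r lam)
    <= Q * x `^ (- eps).
  have -> : (n0%:R * (Nc * lam `^ (- theta)) + 4 / lam) / (n0%:R ^+ 2 * delta_sqr r lam) =
      4 * Nc * (lam `^ (- e1) * n0%:R^-1) + 16 * (lam `^ (- e2) * n0%:R^-1 ^+ 2).
    have -> : lam `^ (- e1) = lam `^ (- theta) / w.
      by rewrite /w -powRN lD; congr (_ `^ _); rewrite /e1 -/e2; ring.
    have -> : lam `^ (- e2) = lam^-1 / w.
      rewrite -(powR_inv1 (ltW lam0)) /w -powRN lD; congr (_ `^ _); ring.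
    rewrite /delta_sqr -/e2 -/w; field.
    by rewrite !gt_eqF.
  rewrite /Q [leRHS]mulrDl; apply: lerD; rewrite -!mulrA; apply: ler_wpM2l => //.
    apply: ler_wpM2l => //; rewrite powR_rate// -mulrA ler_wpM2l ?powR_ge0//.
    apply: (@le_trans _ _ (x `^ (- (kap * - e1)) * x `^ (alpha - 1))).
      by rewrite ler_wpM2l ?powR_ge0.
    rewrite xD ler_powR// /eps; lra.
  rewrite powR_rate// -mulrA ler_wpM2l ?powR_ge0//.
  apply: (@le_trans _ _ (x `^ (- (kap * - e2)) * (x `^ (alpha - 1)) ^+ 2)).
    rewrite ler_wpM2l ?powR_ge0// ler_pXn2r ?nnegrE ?powR_ge0 ?invr_ge0//.
  rewrite expr2 !xD ler_powR// /eps /e1 -/e2.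
  (* The sup-norm term is of no larger order than the variance term: this amounts to
     [kap (1 - theta) <= 1 - alpha], which follows from [eps > 0] and [e2 >= 2]. *)
  have : 0 <= kap * (e2 - 2) by rewrite mulr_ge0// subr_ge0.
  have : 0 <= kap * theta by rewrite mulr_ge0// ltW.
  move: eps0; rewrite /eps /e1 -/e2; nra.
have M0 := moment_const_ge0 R k.
have quot0 : 0 <= (n0%:R * (Nc * lam `^ (- theta)) + 4 / lam) /
    (n0%:R ^+ 2 * delta_sqr r lam).
  rewrite divr_ge0 ?addr_ge0 ?mulr_ge0 ?powR_ge0 ?invr_ge0 ?sqr_ge0 ?(ltW lam0)//.
apply: (@le_trans _ _ (x * (moment_const R k * (Q * x `^ (- eps)) ^+ k))).
  apply: ler_pM => //; first by rewrite mulr_ge0 ?exprn_ge0.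
  by apply: ler_wpM2l => //; apply: lerXn2r => //; rewrite nnegrE ?mulr_ge0 ?powR_ge0.
rewrite powR_rate// exprMn -(powR_mulrn k (powR_ge0 x _)) -powRrM.
have -> : x * (moment_const R k * (Q ^+ k * x `^ (- eps * k%:R))) =
    moment_const R k * Q ^+ k * (x `^ 1 * x `^ (- eps * k%:R)).
  by rewrite powRr1 ?ltW//; ring.
rewrite xD.
apply: (@le_trans _ _ (moment_const R k * Q ^+ k * (x `^ (- 1) * x `^ (- (kap * t))))).
  apply: ler_wpM2l; first by rewrite mulr_ge0 ?exprn_ge0.
  by rewrite xD; apply: ler_powR => //; move: hk; lra.
rewrite mulrA ler_wpM2r ?powR_ge0// (powR_inv1 (ltW x0)) ler_pdivrMr//.
by move: nB; rewrite /B ler_pdivrMr ?powR_gt0// [x * _]mulrC.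
Qed.

(** At [theta = 1/b] the last expression is exactly the gap in the hypothesis on [alpha], because
    [min(r, 1) + max(r, 1) = r + 1]; a slightly larger [theta] keeps it positive. *)
Lemma exponent_exists (r b alpha : R) : 0 < r -> 1 < b ->
  alpha < 2 * b * Num.min r 1 / (2 * b * r + b + 1) ->
  exists theta, [/\ 0 < theta <= 1, 1 < b * theta &
    0 < 1 - alpha - b / (2 * b * r + b + 1) * (2 * Num.max r 1 - 1 + theta)].
Proof.
move=> r0 b1; have b0 : 0 < b by apply: lt_trans b1.
set Dn := 2 * b * r + b + 1.
have D0 : 0 < Dn by rewrite !addr_gt0 ?mulr_gt0.
rewrite -subr_gt0; set eps := (X in 0 < X) => eps0.
set kap := b / Dn; have kap0 : 0 < kap by exact: divr_gt0.
have ib1 : b^-1 < 1 by rewrite invf_lt1.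
(* The first bound keeps [theta] below 1, the second spends at most half of the gap. *)
pose eta := Num.min ((1 - b^-1) / 2) (eps / (2 * kap)).
have eta0 : 0 < eta.
  have h1 : 0 < (1 - b^-1) / 2 by rewrite divr_gt0// subr_gt0.
  have h2 : 0 < eps / (2 * kap) by apply: divr_gt0 => //; exact: mulr_gt0.
  by rewrite /eta lt_min h1.
have eta1 : eta <= (1 - b^-1) / 2 by rewrite /eta ge_min lexx.
have eta2 : kap * eta <= eps / 2.
  have -> : eps / 2 = kap * (eps / (2 * kap)) by field; rewrite gt_eqF.
  by rewrite ler_wpM2l ?(ltW kap0)// /eta ge_min lexx orbT.
have ib0 : 0 < b^-1 by rewrite invr_gt0.
exists (b^-1 + eta); split.
- by apply/andP; split; lra.
- by rewrite mulrDr divff ?gt_eqF// ltrDl mulr_gt0.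
have minE : Num.min r 1 = r + 1 - Num.max r 1 by rewrite -(addr_max_min r 1); ring.
have key : 1 - kap * (2 * Num.max r 1 - 1 + b^-1) = 2 * b * Num.min r 1 / Dn.
  rewrite minE /kap /Dn; field.
  by rewrite !gt_eqF.
have -> : 1 - alpha - kap * (2 * Num.max r 1 - 1 + (b^-1 + eta)) =
    (1 - kap * (2 * Num.max r 1 - 1 + b^-1)) - alpha - kap * eta by ring.
by rewrite key -/eps; lra.
Qed.

Lemma limn_esup_le (u : nat -> \bar R) (c : \bar R) N :
  (forall n, (N <= n)%N -> (u n <= c)%E) -> (limn_esup u <= c)%E.
Proof.
move=> h; apply: (@le_trans _ _ (ereal_sup (u @` [set n | (N <= n)%N]))).
  by apply: ereal_inf_lbound; exists [set n | (N <= n)%N] => //; exists N.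
by apply: ge_ereal_sup => _ [n /= Nn <-]; exact: h.
Qed.

End rate_numerics.

Theorem theorem3p1 (R : realType) (d : measure_display) (X : measurableType d)
  (X_standard : standard_borel R X)
  (K : X -> X -> R) (kappa : R) (H : completeNormedModType R) (HK : rkhs K H)
  (K_psd : psd_kernel K) (kappa_gt0 : 0 < kappa)
  (K_bounded : forall x, K x x <= kappa ^+ 2)
  (H_measurable : forall f : H, measurable_fun setT (ev HK f))
  (r b beta s p : R) (r_gt0 : 0 < r) (b_gt1 : 1 < b) (beta_gt0 : 0 < beta)
  (s_range : 0 <= s <= 2^-1) (p_ge1 : 1 <= p)
  (g : R -> R -> R) (q : \bar R) (g_reg : regularization_function g)
  (g_qual : is_qualification g q) (q_ge : ((r + s)%:E <= q)%E)
  (alpha : R) (alpha_lt : alpha < 2 * b * Num.min r 1 / (2 * b * r + b + 1))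
  (m : nat -> nat) (m_dvd : forall n, (0 < n)%N -> (m n %| n)%N)
  (m_le : forall n, (0 < n)%N -> (m n)%:R <= n%:R `^ alpha :> R)
  (c : forall n, 'I_n -> 'I_(m n))
  (c_card : forall n, (0 < n)%N ->
     forall j : 'I_(m n), #|block (c n) j| = (n %/ m n)%N) :
  (ereal_sup
     [set limn_esup (fun n =>
        ereal_sup
          [set approx_error HK kappa g s p (lambda_rate b r t.1.1 t.2 n)
                 (c n) rf.1 rf.2 * ((a_rate b r s t.1.1 t.2 n)^-1)%:E
          | rf in model HK kappa b beta r t.1.1 t.1.2 t.2])
     | t in [set t : R * R * R | [/\ (0 < t.1.1)%R, (0 < t.1.2)%R & (0 < t.2)%R]]]
   < +oo)%E.
Proof.
have [s0 s1] : 0 <= s /\ s <= 1 by case/andP: s_range => h1 h2; split=> //; lra.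
have p0 : 0 < p by apply: lt_le_trans p_ge1.
have rs0 : 0 < r + s by rewrite ltr_pwDl.
have [Gam Gam1 hGam] := residual_le g_reg g_qual (ltW rs0) q_ge.
have Gam0 : 0 <= Gam by apply: le_trans Gam1.
have [C C0 hC] : exists2 C : R, 0 <= C & _ :=
  approximation_le (rkhs_inner HK) r_gt0 (introT andP (conj s0 s1)) Gam0.
have [theta [th01 bth eps0]] := exponent_exists r_gt0 b_gt1 alpha_lt.
have [th0 _] := andP th01.
have [Nc Nc0 hNc] := effective_dim_le beta_gt0 th01 bth.
have b0 : 0 < b by apply: lt_trans b_gt1.
set Dn := 2 * b * r + b + 1 in eps0; set kap := b / Dn in eps0.
have D0 : 0 < Dn by rewrite !addr_gt0 ?mulr_gt0.
have kap0 : 0 < kap by exact: divr_gt0.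
(* [K0] involves none of [sigma], [M], [Rad]: they only affect how large [n] must be, which the
   upper limit inside the supremum permits. *)
pose K0 := (C `^ p + Gam `^ p) `^ p^-1.
apply: (@le_lt_trans _ _ K0%:E); last exact: ltry.
apply: ge_ereal_sup => _ [[[sigma M] Rad] /= [sg _ Rg] <-].
pose L := sigma ^+ 2 / Rad ^+ 2.
have L0 : 0 < L by rewrite divr_gt0 ?exprn_gt0.
have a00 : 0 < L `^ kap by exact: powR_gt0.
(* The exponent [(r + s) * p] makes the bad event contribute at the same order as the good one to
   the [p]-th moment. *)
have [k [N hN]] := bad_prob_le ((r + s) * p) th0 (ltW kap0) a00 (ltW Nc0) eps0.
(* From [n >= L] on, the minimum in [lambda_rate] is attained by the power, and [a_rate] equals
   [Rad * lam^(r + s)]. *)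
apply: (@limn_esup_le _ _ _ (maxn N (Num.trunc L).+1)) => n.
rewrite geq_max => /andP[Nn Ln].
apply: ge_ereal_sup => _ [[rho f] hm <-] /=.
have n0 : (0 < n)%N by apply: leq_trans Ln.
have x0 : 0 < n%:R :> R by rewrite ltr0n.
have Lx : L <= n%:R.
  by apply: le_trans (ltW (truncnS_gt L)) _; rewrite ler_nat.
have baseE : sigma ^+ 2 / (Rad ^+ 2 * n%:R) = L / n%:R by rewrite invfM mulrA.
have Ln0 : 0 <= L / n%:R by rewrite divr_ge0 ?ltW.
set lam := L `^ kap * n%:R `^ (- kap) in hN.
have lamE : lam = (L / n%:R) `^ kap.
  by rewrite powRM ?invr_ge0 ?(ltW L0) ?(ltW x0)// -(powR_inv1 (ltW x0)) -powRrM mulN1r.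
have lam0 : 0 < lam by rewrite mulr_gt0 ?powR_gt0.
have lam1 : lam <= 1.
  apply: (@le_trans _ _ (1 `^ kap)); last by rewrite powR1.
  rewrite lamE ge0_ler_powR ?nnegrE ?(ltW kap0)//.
  by rewrite ler_pdivrMr// mul1r.
have -> : lambda_rate b r sigma Rad n = lam.
  by rewrite /lambda_rate baseE -/Dn -/kap -lamE; exact/min_idPl.
have -> : a_rate b r s sigma Rad n = Rad * lam `^ (r + s).
  by rewrite /a_rate baseE -/Dn lamE -powRrM; congr (_ * _ `^ _); rewrite mulrAC.
have an0 : 0 < Rad * lam `^ (r + s) by rewrite mulr_gt0 ?powR_gt0.
rewrite lee_pdivrMr//.
have m0 : (0 < m n)%N by apply: dvdn_gt0 (m_dvd _ n0).
have nE : n = (m n * (n %/ m n))%N by rewrite mulnC divnK// m_dvd.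
have q0 : (0 < n %/ m n)%N by rewrite divn_gt0// dvdn_leq// m_dvd.
have lam01 : 0 < lam <= 1 by rewrite lam0.
have hk := hN n (m n) (n %/ m n)%N Nn n0 nE (m_le _ n0).
apply: le_trans (approx_error_le kappa_gt0 K_bounded H_measurable g_reg r_gt0 s0 p_ge1
  lam01 Gam1 (hGam lam lam01) C0 hC hNc m0 q0 (c_card _ n0) k (ltW Rg) hm) _.
rewrite -EFinM lee_fin.
have anp : (lam `^ (r + s) * Rad) `^ p = lam `^ ((r + s) * p) * Rad `^ p.
  by rewrite powRM ?powR_ge0 ?(ltW Rg)// -powRrM.
apply: (@le_trans _ _ (((lam `^ (r + s) * Rad) `^ p * (C `^ p + Gam `^ p)) `^ p^-1)).
  rewrite ge0_ler_powR ?nnegrE ?invr_ge0 ?(ltW p0)//.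
  - apply: addr_ge0; first exact: powR_ge0.
    apply: mulr_ge0; first exact: powR_ge0.
    by rewrite bad_prob_ge0 ?(ltW lam0) ?(ltW Nc0).
  - by rewrite mulr_ge0 ?addr_ge0 ?powR_ge0.
  rewrite mulrDr; apply: lerD.
    by rewrite -mulrA powRM// ?mulr_ge0 ?powR_ge0 ?(ltW Rg)// mulrC.
  rewrite anp powRM ?(ltW Rg)//.
  rewrite [leRHS](_ : _ = Gam `^ p * Rad `^ p * lam `^ ((r + s) * p)); last by ring.
  by rewrite ler_wpM2l ?mulr_ge0 ?powR_ge0.
rewrite powRM ?addr_ge0 ?powR_ge0// -powRrM divff ?gt_eqF// powRr1; last first.
  by rewrite mulr_ge0 ?powR_ge0 ?ltW.
rewrite -/K0.
by move: K0 (lam `^ (r + s)) => K1 l; rewrite (mulrC K1) (mulrC Rad).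
Qed.
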